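(* Let $R$ be a commutative regular Noetherian domain with quotient field $K$. Let $(A,\{\Delta(\lambda)_{\lambda\in\Lambda}\})$ be a split quasi-hereditary $R$-algebra with a characteristic tilting module $T$, and let $R(A)=\operatorname{End}_A(T)^{op}$ be the Ringel dual of $A$. Let $Q\in\operatorname{add}T$ be a (partial) tilting module of $A$ such that $Q\text{-}\operatorname{codomdim}_{(A,R)}T\geq 1$ and $(K\otimes_R Q)\text{-}\operatorname{codomdim}_{K\otimes_R A}(K\otimes_R T)\geq 2$. Then $(R(A),\operatorname{Hom}_A(T,Q))$ is a split quasi-hereditary cover of $\operatorname{End}_A(Q)^{op}$. Moreover, $(R(A),\operatorname{Hom}_A(T,Q))$ is a $0$-$\mathcal F(\tilde\Delta_{R(A)})$ split quasi-hereditary cover of $\operatorname{End}_A(Q)^{op}$.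
   Context: Conventions. A commutative Noetherian ring $R$ is regular if every localization at a prime ideal has finite global dimension. A projective Noetherian $R$-algebra is an $R$-algebra finitely generated and projective as $R$-module. $A\text{-mod}$: finitely generated left $A$-modules; $A\text{-proj}$, $R\text{-proj}$: finitely generated projectives; $D=\operatorname{Hom}_R(-,R)$; $\operatorname{add}M$: direct summands of finite direct sums of copies of $M$. For $\Theta\subset A\text{-mod}\cap R\text{-proj}$, $\mathcal F(\Theta)$ is the full subcategory of modules in $A\text{-mod}\cap R\text{-proj}$ having a finite filtration with factors in $\Theta$. Split quasi-hereditary algebra: a projective Noetherian $R$-algebra $A$ with modules $\Delta(\lambda)\in A\text{-mod}$ (standard modules) indexed by a (finite) poset $\Lambda$ such that: (i) $\Delta(\lambda)\in R\text{-proj}$; (ii) $\operatorname{Hom}_A(\Delta(\lambda),\Delta(\mu))\neq 0$ implies $\lambda\leq\mu$; (iii) $\operatorname{End}_A(\Delta(\lambda))\simeq R$; (iv) for each $\lambda$ there are $P(\lambda)\in A\text{-proj}$ and an exact sequence $0\to C(\lambda)\to P(\lambda)\to\Delta(\lambda)\to 0$ with $C(\lambda)$ finitely filtered by modules $\Delta(\mu)\otimes_R U_\mu$, $U_\mu\in R\text{-proj}$, $\mu>\lambda$; (v) $\bigoplus_\lambda P(\lambda)$ is a progenerator of $A\text{-mod}$. Put $\tilde\Delta=\tilde\Delta_A=\{\Delta(\lambda)\otimes_R U\colon\lambda\in\Lambda,U\in R\text{-proj}\}$. Costandard modules $\nabla(\lambda)$: the modules, unique up to isomorphism, such that $(A^{op},\{D\nabla(\lambda)\}_{\lambda\in\Lambda})$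 is split quasi-hereditary and, with $\tilde\nabla=\{\nabla(\lambda)\otimes_R U\colon\lambda\in\Lambda,U\in R\text{-proj}\}$, $\mathcal F(\tilde\nabla)=\{X\in A\text{-mod}\cap R\text{-proj}\colon\operatorname{Ext}^1_A(M,X)=0\ \forall M\in\mathcal F(\tilde\Delta)\}$, $\operatorname{Hom}_A(\Delta(\lambda),\nabla(\lambda))\simeq R$ and $\operatorname{Hom}_A(\Delta(\mu),\nabla(\lambda))=0$ for $\mu\neq\lambda$. A tilting module is a module $T$ of finite projective dimension with $\operatorname{Ext}_A^{i>0}(T,T)=0$ such that $A$ has a finite coresolution by modules in $\operatorname{add}T$; it is a characteristic tilting module if $\operatorname{add}T=\mathcal F(\tilde\Delta)\cap\mathcal F(\tilde\nabla)$. Modules in $\operatorname{add}T$ are called (partial) tilting. The Ringel dual $R(A)=\operatorname{End}_A(T)^{op}$ is split quasi-hereditary with standard modules $\operatorname{Hom}_A(T,\nabla(\lambda))$, $\lambda\in\Lambda^{op}$. Relative codominant dimension: an exact sequence of $A$-modules is $(A,R)$-exact if it splits over $R$. For $Q,X\in A\text{-mod}\cap R\text{-proj}$: if there is no surjection $Y\to X$ with $Y\in\operatorname{add}Q$ and $\operatorname{Hom}_A(Q,Y)\to\operatorname{Hom}_A(Q,X)$ surjective, then $Q\text{-}\operatorname{codomdim}_{(A,R)}X=0$; otherwise it is the supremum in $\mathbb N\cup\{+\infty\}$ of all $n$ such that there is an $(A,R)$-exact sequence $Q_n\to\cdots\to Q_1\to X\to0$ with $Q_i\in\operatorname{add}Q$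 such that $\operatorname{Hom}_A(Q,Q_n)\to\cdots\to\operatorname{Hom}_A(Q,X)\to0$ is exact (infinite if some $Q_i=0$). The subscript $R$ is omitted over a field. Covers: for a projective Noetherian $R$-algebra $C$ and $P\in C\text{-proj}$ with $E=\operatorname{End}_C(P)^{op}$, $(C,P)$ is a cover of $E$ if $F_P=\operatorname{Hom}_C(P,-)\colon C\text{-mod}\to E\text{-mod}$ is fully faithful on $C\text{-proj}$; it is a split quasi-hereditary cover if moreover $C$ is split quasi-hereditary. For a resolving subcategory $\mathcal A$ of $C\text{-mod}$ and $i\geq0$, $(C,P)$ is an $i$-$\mathcal A$ cover of $E$ if $F_P$ induces isomorphisms $\operatorname{Ext}_C^j(M,N)\to\operatorname{Ext}_E^j(F_PM,F_PN)$ for all $M,N\in\mathcal A$, $0\leq j\leq i$. *)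

(* Defs.v *)
From HB Require Import structures.
From mathcomp Require Import all_boot all_order all_algebra.
From mathcomp Require Import boolp.

Set Implicit Arguments.
Unset Strict Implicit.
Unset Printing Implicit Defensive.

Import GRing.Theory.
Local Open Scope ring_scope.

(* Associative unital algebras over a commutative ring. The library structure
   [algType] is restricted to nonzero rings; endomorphism algebras of possibly
   zero modules are needed here, so an algebra is a [pzRingType] together with
   a central ring morphism from the base ring. *)
HB.mixin Record isRAlgebra (R : comPzRingType) A of GRing.PzRing A := {
  alg_map : R -> A;
  alg_map_zmod : zmod_morphism alg_map;
  alg_map_monoid : monoid_morphism alg_map;
  alg_map_central : forall r a, alg_map r * a = a * alg_map r
}.

#[short(type="ralgType")]
HB.structure Definition RAlgebra (R : comPzRingType) :=
  {A of isRAlgebra R A & GRing.PzRing A}.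

HB.instance Definition _ (R : comPzRingType) (A : ralgType R) :=
  GRing.isZmodMorphism.Build R A (@alg_map R A) (@alg_map_zmod R A).
HB.instance Definition _ (R : comPzRingType) (A : ralgType R) :=
  GRing.isMonoidMorphism.Build R A (@alg_map R A) (@alg_map_monoid R A).

Section BaseAlgebra.
Variable R : comPzRingType.
Definition base_map (r : R) : R^o := r.
Fact base_zmod : zmod_morphism base_map. Proof. by []. Qed.
Fact base_monoid : monoid_morphism base_map. Proof. by []. Qed.
Fact base_central (r : R) (a : R^o) : (r : R^o) * a = a * r.
Proof. exact: mulrC. Qed.
HB.instance Definition _ :=
  isRAlgebra.Build R R^o base_zmod base_monoid base_central.
End BaseAlgebra.

Section OppositeAlgebra.
Variables (R : comPzRingType) (A : ralgType R).
Definition alg_map_op (r : R) : A^c := alg_map r : A.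
Fact alg_map_op_zmod : zmod_morphism alg_map_op.
Proof. exact: (@alg_map_zmod R A). Qed.
Fact alg_map_op_monoid : monoid_morphism alg_map_op.
Proof.
split; first exact: (rmorph1 (@alg_map R A)).
by move=> x y; rewrite mulrC; exact: (rmorphM (@alg_map R A)).
Qed.
Fact alg_map_op_central r a : alg_map_op r * a = a * alg_map_op r.
Proof. by symmetry; apply: (@alg_map_central R A). Qed.
HB.instance Definition _ :=
  isRAlgebra.Build R A^c alg_map_op_zmod alg_map_op_monoid alg_map_op_central.
End OppositeAlgebra.

Section FractionAlgebra.
Variable R : idomainType.
Fact tofrac_central (r : R) (a : {fraction R}) : tofrac r * a = a * tofrac r.
Proof. exact: mulrC. Qed.
HB.instance Definition _ := isRAlgebra.Build R {fraction R}
  (@tofrac_is_zmod_morphism R) (@tofrac_is_monoid_morphism R) tofrac_central.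
End FractionAlgebra.

Definition alg_iso (R : comPzRingType) (A B : ralgType R) : Prop :=
  exists f : {rmorphism A -> B},
    bijective f /\ forall r : R, f (alg_map r) = alg_map r.

(* [res M] is the [A]-module [M] regarded as an [R]-module. *)
Definition res (R : comPzRingType) (A : ralgType R) (M : lmodType A) : Type := M.

Section Restriction.
Variables (R : comPzRingType) (A : ralgType R) (M : lmodType A).
HB.instance Definition _ := GRing.Zmodule.on (res M).
Definition res_scale (r : R) (m : res M) : res M :=
  (alg_map r : A) *: (m : M).
Fact res_scaleA a b v : res_scale a (res_scale b v) = res_scale (a * b) v.
Proof. by rewrite /res_scale scalerA rmorphM. Qed.
Fact res_scale1 : left_id 1 res_scale.
Proof. by move=> v; rewrite /res_scale rmorph1 scale1r. Qed.
Fact res_scaleDr : right_distributive res_scale +%R.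
Proof. by move=> a u v; rewrite /res_scale scalerDr. Qed.
Fact res_scaleDl v : {morph res_scale^~ v : a b / a + b}.
Proof. by move=> a b; rewrite /res_scale rmorphD scalerDl. Qed.
HB.instance Definition _ := GRing.Zmodule_isLmodule.Build R (res M)
  res_scaleA res_scale1 res_scaleDr res_scaleDl.
End Restriction.

Lemma linear_ext (A : pzRingType) (M N : lmodType A) (f g : {linear M -> N}) :
  f =1 g -> f = g.
Proof.
case: f g => f [[fa] [fs]] [g [[ga] [gs]]] /= /funext e; subst g.
by rewrite (Prop_irrelevance fa ga) (Prop_irrelevance fs gs).
Qed.

(* [homm T X] is Hom_A(T, X). *)
Definition homm (A : pzRingType) (T X : lmodType A) : Type := {linear T -> X}.

Section HomGroup.
Variables (A : pzRingType) (T X : lmodType A).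
HB.instance Definition _ := gen_eqMixin (homm T X).
HB.instance Definition _ := gen_choiceMixin (homm T X).
Definition homm0 : homm T X := (\0 : T -> X).
Definition hommN (f : homm T X) : homm T X := \- f.
Definition hommD (f g : homm T X) : homm T X := f \+ g.
Fact hommDA : associative hommD.
Proof. by move=> f g h; apply: linear_ext => t; exact: addrA. Qed.
Fact hommDC : commutative hommD.
Proof. by move=> f g; apply: linear_ext => t; exact: addrC. Qed.
Fact homm0D : left_id homm0 hommD.
Proof. by move=> f; apply: linear_ext => t; exact: add0r. Qed.
Fact hommND : left_inverse homm0 hommN hommD.
Proof. by move=> f; apply: linear_ext => t; exact: addNr. Qed.
HB.instance Definition _ :=
  GRing.isZmodule.Build (homm T X) hommDA hommDC homm0D hommND.
End HomGroup.

(* [Endo T] is End_A(T), with composition as product. *)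
Definition Endo (A : pzRingType) (T : lmodType A) : Type := homm T T.

Section EndRing.
Variables (A : pzRingType) (T : lmodType A).
HB.instance Definition _ := GRing.Zmodule.on (Endo T).
Definition End1 : Endo T := (idfun : T -> T).
Definition EndM (f g : Endo T) : Endo T := (f : homm T T) \o (g : homm T T).
Fact EndMA : associative EndM.
Proof. by move=> f g h; apply: linear_ext. Qed.
Fact End1M : left_id End1 EndM.
Proof. by move=> f; apply: linear_ext. Qed.
Fact EndM1 : right_id End1 EndM.
Proof. by move=> f; apply: linear_ext. Qed.
Fact EndMDl : left_distributive EndM +%R.
Proof. by move=> f g h; apply: linear_ext. Qed.
Fact EndMDr : right_distributive EndM +%R.
Proof. by move=> f g h; apply: linear_ext => t; exact: raddfD. Qed.
HB.instance Definition _ :=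
  GRing.Zmodule_isPzRing.Build (Endo T) EndMA End1M EndM1 EndMDl EndMDr.
End EndRing.

Section EndAlgebra.
Variables (R : comPzRingType) (A : ralgType R) (T : lmodType A).
Definition homothety_fun (r : R) (t : T) : T := (alg_map r : A) *: t.
Fact homothety_zmod r : zmod_morphism (homothety_fun r).
Proof. by move=> x y; rewrite /homothety_fun scalerBr. Qed.
Fact homothety_scalable r : scalable (homothety_fun r).
Proof. by move=> a x; rewrite /homothety_fun !scalerA alg_map_central. Qed.
HB.instance Definition _ r :=
  GRing.isZmodMorphism.Build T T (homothety_fun r) (homothety_zmod r).
HB.instance Definition _ r :=
  GRing.isScalable.Build A T T *:%R (homothety_fun r) (homothety_scalable r).
Definition homothety (r : R) : Endo T := (homothety_fun r : {linear T -> T}).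
Fact homothety_is_zmod : zmod_morphism homothety.
Proof.
move=> r s; apply: linear_ext => t.
by rewrite /= /homothety_fun raddfB scalerBl.
Qed.
Fact homothety_is_monoid : monoid_morphism homothety.
Proof.
split; first by apply: linear_ext => t; rewrite /= /homothety_fun rmorph1 scale1r.
move=> r s; apply: linear_ext => t.
by rewrite /= /homothety_fun rmorphM -scalerA.
Qed.
Fact homothety_central r (f : Endo T) : homothety r * f = f * homothety r.
Proof.
by apply: linear_ext => t; rewrite /= /homothety_fun [in RHS]linearZ.
Qed.
HB.instance Definition _ := isRAlgebra.Build R (Endo T)
  homothety_is_zmod homothety_is_monoid homothety_central.
End EndAlgebra.

(* Hom_A(T, X) is a left End_A(T)^op-module by precomposition. *)
Section HomModule.
Variables (A : pzRingType) (T X : lmodType A).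
Definition homm_scale (a : (Endo T)^c) (f : homm T X) : homm T X :=
  f \o (a : homm T T).
Fact homm_scaleA a b f : homm_scale a (homm_scale b f) = homm_scale (a * b) f.
Proof. by apply: linear_ext. Qed.
Fact homm_scale1 : left_id 1 homm_scale.
Proof. by move=> f; apply: linear_ext. Qed.
Fact homm_scaleDr : right_distributive homm_scale +%R.
Proof. by move=> a f g; apply: linear_ext. Qed.
Fact homm_scaleDl f : {morph homm_scale^~ f : a b / a + b}.
Proof. by move=> a b; apply: linear_ext => t; exact: raddfD. Qed.
HB.instance Definition _ := GRing.Zmodule_isLmodule.Build (Endo T)^c (homm T X)
  homm_scaleA homm_scale1 homm_scaleDr homm_scaleDl.
End HomModule.

(* The functor Hom_A(T, -) on morphisms. *)
Section HomFunctor.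
Variables (A : pzRingType) (T X Y : lmodType A) (u : {linear X -> Y}).
Definition hom_fun (f : homm T X) : homm T Y := u \o f.
Fact hom_fun_zmod : zmod_morphism hom_fun.
Proof. by move=> f g; apply: linear_ext => t; exact: raddfB. Qed.
Fact hom_fun_scalable : scalable hom_fun.
Proof. by move=> a f; apply: linear_ext. Qed.
HB.instance Definition _ :=
  GRing.isZmodMorphism.Build (homm T X) (homm T Y) hom_fun hom_fun_zmod.
HB.instance Definition _ :=
  GRing.isScalable.Build (Endo T)^c (homm T X) (homm T Y) *:%R
    hom_fun hom_fun_scalable.
Definition hom_map : {linear homm T X -> homm T Y} := hom_fun.
End HomFunctor.
Arguments hom_map {A} T {X Y} u.

(* [dual M] is the A^op-module DM = Hom_R(M, R). *)
Definition dual (R : comPzRingType) (A : ralgType R) (M : lmodType A) : Type :=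
  homm (res M) R^o.

Section Dual.
Variables (R : comPzRingType) (A : ralgType R) (M : lmodType A).
HB.instance Definition _ := GRing.Zmodule.on (dual M).
Definition mul_fun (a : A) (m : res M) : res M := a *: (m : M).
Fact mul_fun_zmod a : zmod_morphism (mul_fun a).
Proof. by move=> x y; rewrite /mul_fun scalerBr. Qed.
Fact mul_fun_scalable a : scalable (mul_fun a).
Proof.
by move=> r x; rewrite /GRing.scale /= /res_scale /mul_fun !scalerA alg_map_central.
Qed.
HB.instance Definition _ a :=
  GRing.isZmodMorphism.Build (res M) (res M) (mul_fun a) (mul_fun_zmod a).
HB.instance Definition _ a :=
  GRing.isScalable.Build R (res M) (res M) *:%R (mul_fun a) (mul_fun_scalable a).
Definition dual_scale (a : A^c) (f : dual M) : dual M :=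
  (f : homm (res M) R^o) \o mul_fun (a : A).
Fact dual_scaleA a b f : dual_scale a (dual_scale b f) = dual_scale (a * b) f.
Proof. by apply: linear_ext => m; rewrite /= /mul_fun scalerA. Qed.
Fact dual_scale1 : left_id 1 dual_scale.
Proof. by move=> f; apply: linear_ext => m; rewrite /= /mul_fun scale1r. Qed.
Fact dual_scaleDr : right_distributive dual_scale +%R.
Proof. by move=> a f g; apply: linear_ext. Qed.
Fact dual_scaleDl f : {morph dual_scale^~ f : a b / a + b}.
Proof.
by move=> a b; apply: linear_ext => m; rewrite /= /mul_fun scalerDl; exact: raddfD.
Qed.
HB.instance Definition _ := GRing.Zmodule_isLmodule.Build A^c (dual M)
  dual_scaleA dual_scale1 dual_scaleDr dual_scaleDl.
End Dual.

Definition dsum (A : pzRingType) (I : finType) (P : I -> lmodType A) : Type :=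
  forall i, P i.

Section DirectSum.
Variables (A : pzRingType) (I : finType) (P : I -> lmodType A).
HB.instance Definition _ := gen_eqMixin (dsum P).
HB.instance Definition _ := gen_choiceMixin (dsum P).
Definition dsum0 : dsum P := fun=> 0.
Definition dsumN (x : dsum P) : dsum P := fun i => - x i.
Definition dsumD (x y : dsum P) : dsum P := fun i => x i + y i.
Definition dsumZ (a : A) (x : dsum P) : dsum P := fun i => a *: x i.
Fact dsumDA : associative dsumD.
Proof. by move=> x y z; apply: functional_extensionality_dep => i; exact: addrA. Qed.
Fact dsumDC : commutative dsumD.
Proof. by move=> x y; apply: functional_extensionality_dep => i; exact: addrC. Qed.
Fact dsum0D : left_id dsum0 dsumD.
Proof. by move=> x; apply: functional_extensionality_dep => i; exact: add0r. Qed.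
Fact dsumND : left_inverse dsum0 dsumN dsumD.
Proof. by move=> x; apply: functional_extensionality_dep => i; exact: addNr. Qed.
HB.instance Definition _ :=
  GRing.isZmodule.Build (dsum P) dsumDA dsumDC dsum0D dsumND.
Fact dsumZA a b x : dsumZ a (dsumZ b x) = dsumZ (a * b) x.
Proof. by apply: functional_extensionality_dep => i; exact: scalerA. Qed.
Fact dsumZ1 : left_id 1 dsumZ.
Proof. by move=> x; apply: functional_extensionality_dep => i; exact: scale1r. Qed.
Fact dsumZDr : right_distributive dsumZ +%R.
Proof. by move=> a x y; apply: functional_extensionality_dep => i; exact: scalerDr. Qed.
Fact dsumZDl x : {morph dsumZ^~ x : a b / a + b}.
Proof. by move=> a b; apply: functional_extensionality_dep => i; exact: scalerDl. Qed.
HB.instance Definition _ := GRing.Zmodule_isLmodule.Build A (dsum P)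
  dsumZA dsumZ1 dsumZDr dsumZDl.
End DirectSum.

Section Modules.
Variable A : pzRingType.
Implicit Types M N X Y Z T : lmodType A.

Definition surj (X Y : Type) (f : X -> Y) : Prop := forall y, exists x, f x = y.

Definition zero_mod M : Prop := forall m : M, m = 0.

Definition exact_at (X Y Z : zmodType) (f : X -> Y) (g : Y -> Z) : Prop :=
  forall y, g y = 0 <-> exists x, f x = y.

Definition short_exact X Y Z (f : {linear X -> Y}) (g : {linear Y -> Z}) : Prop :=
  [/\ injective f, exact_at f g & surj g].

Definition iso_mod M N : Prop := exists f : {linear M -> N}, bijective f.

Definition fin_gen M : Prop :=
  exists n (g : 'I_n -> M),
    forall m, exists c : 'I_n -> A, m = \sum_(i < n) c i *: g i.

Definition projective M : Prop :=
  forall X Y (p : {linear X -> Y}) (f : {linear M -> Y}),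
    surj p -> exists h : {linear M -> X}, forall m, p (h m) = f m.

(* Membership in [A]-proj. *)
Definition fgp M : Prop := fin_gen M /\ projective M.

Definition add_cat M X : Prop :=
  exists n (s : {linear X -> {ffun 'I_n -> M}}) (r : {linear {ffun 'I_n -> M} -> X}),
    forall x, r (s x) = x.

Definition progenerator M : Prop :=
  fgp M /\
  forall X, fin_gen X ->
    exists n (p : {linear {ffun 'I_n -> M} -> X}), surj p.

(* A sequence ... -> term 1 -> term 0 -> X of modules over [X]. *)
Record chain X := Chain {
  term : nat -> lmodType A;
  diff : forall i, {linear term i.+1 -> term i};
  aug : {linear term 0 -> X}
}.

(* The truncation term (n-1) -> ... -> term 0 -> X -> 0 is exact (no condition
   on the kernel of its leftmost map). *)
Definition exact_upto n X (P : chain X) : Prop :=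
  [/\ (0 < n)%N -> surj (aug P),
      (1 < n)%N -> exact_at (diff P 0) (aug P)
    & forall i, (i.+2 < n)%N -> exact_at (diff P i.+1) (diff P i)].

Definition proj_resolution X (P : chain X) : Prop :=
  (forall i, projective (term P i)) /\ (forall n, exact_upto n P).

Definition pd_le (n : nat) X : Prop :=
  exists P : chain X,
    proj_resolution P /\ forall i, (n < i)%N -> zero_mod (term P i).

Definition coboundary X N (P : chain X) (i : nat) : {linear term P i -> N} -> Prop :=
  match i return {linear term P i -> N} -> Prop with
  | 0 => fun f => forall x, f x = 0
  | j.+1 => fun f => exists g : {linear term P j -> N},
                       forall x, f x = g (diff P j x)
  end.

(* Ext^i_A(M, N) = 0, computed as the cohomology of Hom_A(P, N) for a
   projective resolution P of M. *)
Definition Ext_zero (i : nat) M N : Prop :=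
  exists P : chain M,
    proj_resolution P /\
    forall f : {linear term P i -> N},
      (forall x, f (diff P i x) = 0) -> coboundary f.

(* Finite coresolutions 0 -> X -> T_0 -> ... -> T_r -> 0 by modules in [C],
   spliced from short exact sequences. *)
Inductive fin_cores (C : lmodType A -> Prop) : lmodType A -> Prop :=
| fin_cores_base X : C X -> fin_cores C X
| fin_cores_step X T Y (f : {linear X -> T}) (g : {linear T -> Y}) :
    C T -> short_exact f g -> fin_cores C Y -> fin_cores C X.

Inductive filtered (C : lmodType A -> Prop) : lmodType A -> Prop :=
| filtered_zero X : zero_mod X -> filtered C X
| filtered_step X' X X'' (f : {linear X' -> X}) (g : {linear X -> X''}) :
    filtered C X' -> C X'' -> short_exact f g -> filtered C X.

Definition tilting T : Prop :=
  [/\ fin_gen T, exists n, pd_le n T,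
      forall i, (0 < i)%N -> Ext_zero i T T
    & fin_cores (add_cat T) A^o].

End Modules.

Definition finite_gldim (A : pzRingType) : Prop :=
  exists n, forall M : lmodType A, pd_le n M.

(* [idealr_closed] means "proper ideal"; the unit ideal is generated by 1. *)
Definition noetherian (R : comNzRingType) : Prop :=
  forall I : {pred R}, idealr_closed I ->
    exists n (g : 'I_n -> R),
      forall x, x \in I <-> exists c : 'I_n -> R, x = \sum_(i < n) c i * g i.

Definition prime_ideal (R : comNzRingType) (p : {pred R}) : Prop :=
  idealr_closed p /\ prime_idealr_closed p.

(* [f] exhibits [S] as the localization of [R] at the prime ideal [p]. *)
Definition is_localization (R : comNzRingType) (p : {pred R})
    (S : comPzRingType) (f : {rmorphism R -> S}) : Prop :=
  [/\ forall s, s \notin p -> exists t, f s * t = 1,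
      forall x : S, exists a s, s \notin p /\ f s * x = f a
    & forall a, f a = 0 -> exists s, s \notin p /\ s * a = 0].

Definition regular_ring (R : comNzRingType) : Prop :=
  noetherian R /\
  forall p : {pred R}, prime_ideal p ->
    exists (S : comPzRingType) (f : {rmorphism R -> S}),
      is_localization p f /\ finite_gldim S.

Section Tensor.
Variable R : comPzRingType.

Definition balanced (M N : lmodType R) (Z : zmodType) (b : M -> N -> Z) : Prop :=
  [/\ forall n, zmod_morphism (b^~ n), forall m, zmod_morphism (b m)
    & forall r m n, b (r *: m) n = b m (r *: n)].

(* [b] exhibits the abelian group [P] as the tensor product of [M] and [N]. *)
Definition is_tensor (M N : lmodType R) (P : zmodType) (b : M -> N -> P) : Prop :=
  balanced b /\
  forall (Z : zmodType) (c : M -> N -> Z), balanced c ->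
    (exists h : {additive P -> Z}, forall m n, h (b m n) = c m n) /\
    (forall h h' : {additive P -> Z},
       (forall m n, h (b m n) = h' (b m n)) -> h =1 h').

(* [X] is isomorphic to the [A]-module D (x)_R U. *)
Definition is_tensor_mod (A : ralgType R) (D : lmodType A) (U : lmodType R)
    (X : lmodType A) : Prop :=
  exists b : res D -> U -> X,
    is_tensor b /\ forall (a : A) (d : D) u, b (a *: d) u = a *: b d u.

End Tensor.

Section QuasiHereditary.
Variables (R : comPzRingType) (A : ralgType R).

Definition proj_noetherian_alg : Prop := fgp (res A^o).

(* Membership in [A]-mod \cap [R]-proj. *)
Definition lattice (M : lmodType A) : Prop := fin_gen M /\ fgp (res M).

Definition Filt (C : lmodType A -> Prop) (X : lmodType A) : Prop :=
  lattice X /\ filtered C X.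

Definition twists (I : Type) (S : pred I) (D : I -> lmodType A) (X : lmodType A) : Prop :=
  exists i (U : lmodType R), [/\ S i, fgp U & is_tensor_mod (D i) U X].

Definition tilde (I : Type) (D : I -> lmodType A) : lmodType A -> Prop :=
  twists predT D.

Variables (d : Order.disp_t) (L : finPOrderType d).

Record split_qh (Delta : L -> lmodType A) : Prop := SplitQH {
  qh_alg : proj_noetherian_alg;
  qh_fin_gen : forall l, fin_gen (Delta l);
  qh_proj : forall l, fgp (res (Delta l));
  qh_order : forall l m, (exists f : {linear Delta l -> Delta m}, exists x, f x != 0) ->
    (l <= m)%O;
  qh_end : forall l, alg_iso (Endo (Delta l)) R^o;
  qh_progen : exists P : L -> lmodType A,
    (forall l, fgp (P l) /\
       exists (C : lmodType A) (f : {linear C -> P l}) (g : {linear P l -> Delta l}),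
         short_exact f g /\ filtered (twists (fun m => (l < m)%O) Delta) C) /\
    progenerator (dsum P)
}.

End QuasiHereditary.

Section Costandard.
Variables (R : comPzRingType) (A : ralgType R).
Variables (d : Order.disp_t) (L : finPOrderType d).

(* Hom_A(Delta, nabla) is an R-module through R -> End_A(Delta)^op. *)
Record costandard (Delta nabla : L -> lmodType A) : Prop := Costandard {
  cs_lattice : forall l, lattice (nabla l);
  cs_op : split_qh (fun l => dual (nabla l) : lmodType A^c);
  cs_filt : forall X : lmodType A, Filt (tilde nabla) X <->
    lattice X /\ forall M : lmodType A, Filt (tilde Delta) M -> Ext_zero 1 M X;
  cs_hom : forall l, iso_mod (res (homm (Delta l) (nabla l))) R^o;
  cs_hom0 : forall l m, m != l -> zero_mod (homm (Delta m) (nabla l))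
}.

Definition char_tilting (Delta nabla : L -> lmodType A) (T : lmodType A) : Prop :=
  tilting T /\
  forall X : lmodType A,
    add_cat T X <-> Filt (tilde Delta) X /\ Filt (tilde nabla) X.

End Costandard.

(* Suprema in N \cup {+oo}, with [None] for +oo. *)
Definition enat_sup (S : nat -> Prop) : option nat :=
  match pselect (exists m, `[< forall n, S n -> (n <= m)%N >]) with
  | left h => Some (ex_minn h)
  | right _ => None
  end.

Definition enat_le (n : nat) (e : option nat) : Prop :=
  if e is Some m then (n <= m)%N else True.

Section Codominant.
Variables (R : comPzRingType) (A : ralgType R).

(* The kernel and the image of [f] are [R]-direct summands. *)
Definition R_split (X Y : lmodType A) (f : {linear X -> Y}) : Prop :=
  exists s : {linear res Y -> res X}, forall x : X, f (s (f x)) = f x.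

Definition R_split_upto n (X : lmodType A) (P : chain X) : Prop :=
  ((0 < n)%N -> R_split (aug P)) /\
  forall i, (i.+1 < n)%N -> R_split (diff P i).

Definition hom_chain (Q X : lmodType A) (P : chain X) : chain (homm Q X) :=
  Chain (term := fun i => homm Q (term P i))
    (fun i => hom_map Q (diff P i)) (hom_map Q (aug P)).

(* The term Q_i of a sequence Q_n -> ... -> Q_1 -> X -> 0 is [term P i.-1]. *)
Definition codom_seq (Q X : lmodType A) (n : nat) : Prop :=
  exists P : chain X,
    [/\ forall i, (i < n)%N -> add_cat Q (term P i),
        exact_upto n P, R_split_upto n P & exact_upto n (hom_chain Q P)].

Definition codom_cover (Q X : lmodType A) : Prop :=
  exists (Y : lmodType A) (p : {linear Y -> X}),
    [/\ add_cat Q Y, surj p & surj (hom_map Q p)].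

Definition codomdim (Q X : lmodType A) : option nat :=
  if pselect (codom_cover Q X) then enat_sup (codom_seq Q X) else Some 0%N.

End Codominant.

Section Covers.
Variables (R : comPzRingType) (C : ralgType R).

Definition fully_faithful_on (S : lmodType C -> Prop) (P : lmodType C) : Prop :=
  forall M N, S M -> S N ->
    bijective (hom_map P : {linear M -> N} -> {linear homm P M -> homm P N}).

(* (C, P) is a cover of E. *)
Definition is_cover (P : lmodType C) (E : ralgType R) : Prop :=
  [/\ fgp P, alg_iso E (Endo P)^c & fully_faithful_on (@fgp C) P].

(* (C, P) is a 0-S cover of E; Ext^0 is Hom. *)
Definition is_cover0 (S : lmodType C -> Prop) (P : lmodType C) (E : ralgType R) : Prop :=
  [/\ fgp P, alg_iso E (Endo P)^c & fully_faithful_on S P].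

End Covers.

Section BaseChange.
Variable R : idomainType.
Local Notation K := {fraction R}.

(* [b] exhibits the K-algebra [AK] as K (x)_R A. *)
Definition is_frac_alg (A : ralgType R) (AK : ralgType K)
    (b : res K^o -> res A^o -> AK) : Prop :=
  [/\ is_tensor b, b (1 : K) (1 : A) = 1,
      forall (k k' : K) (a a' : A), b (k * k') (a * a') = b k a * b k' a'
    & forall k : K, alg_map k = b k (1 : A)].

(* [c] exhibits the [AK]-module [MK] as K (x)_R M. *)
Definition is_frac_mod (A : ralgType R) (AK : ralgType K)
    (b : res K^o -> res A^o -> AK) (M : lmodType A) (MK : lmodType AK)
    (c : res K^o -> res M -> MK) : Prop :=
  is_tensor c /\
  forall (k k' : K) (a : A) (m : M), c (k * k') (a *: m) = b k a *: c k' m.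

End BaseChange.

(* Main.v *)
(** Every X with a costandard filtration is an epimorphic image of some T^n such
    that Hom(T, T^n) -> Hom(T, X) is onto and the kernel is again costandardly
    filtered, so Hom(T, -) is fully faithful and exact on these modules.  The
    modules T(l), obtained from Delta(l) by universal extensions and having
    nabla(l) as top costandard factor, therefore give the projective covers
    Hom(T, T(l)) that make the Ringel dual split quasi-hereditary.

    For the cover property let F = Hom(P, -) with P = Hom(T, Q), and let G be its
    right adjoint.  It suffices that the unit N -> GFN is an isomorphism for
    N = Hom(T, X) with X projective over R, since this passes to direct summands
    and extensions.  The unit is then the map Hom(T, X) ->
    Hom_E(Hom(Q, T), Hom(Q, X)), which is injective because there is an epimorphism
    Q^n -> T that is onto under Hom(Q, -).  An E-linear map
    Hom(Q, T) -> Hom(Q, X) defines a map Q^n -> X; it vanishes on the kernel of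
    Q^n -> T because, by the codominant dimension over K, that kernel is generated
    by Q after multiplication by nonzero elements of R, and X is torsion free. *)

Require Import Defs.
From HB Require Import structures.
From mathcomp Require Import all_boot all_order all_algebra.
From mathcomp Require Import boolp ring.

Set Implicit Arguments.
Unset Strict Implicit.
Unset Printing Implicit Defensive.

Import GRing.Theory.
Local Open Scope ring_scope.

(** * Linear maps, kernels and quotients *)

(** Extensions are therefore taken along arbitrary finite generating families, which exist because
    [R] is noetherian. Only afterwards is the multiplicity module of the top costandard factor shown
    to be free of rank one, by computing Hom from the standard module in two ways. The vanishing of
    Ext^1 between costandard modules is carried over by [R]-duality from the opposite algebra. One
    reconstruction principle serves twice: a map Hom(S, X) -> Hom(S, Y) that is linear over
    End(S)^op comes from a map X -> Y as soon as the relations between suitable maps S -> X are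
    generated by S, up to a multiple acting injectively on Y. For S = T the multiple is 1; for S = Q
    it is a common denominator, which is where K enters. The adjoint G is never built: with B the
    Ringel dual, G sends Y to Hom_E(FB, Y), and N is Hom_B(B, N), so the unit at N compares B-linear
    maps B -> N with E-linear maps FB -> FN. *)

Section LinearMaps.
Variable A : pzRingType.
Implicit Types X Y Z : lmodType A.

Definition mklin X Y (f : X -> Y) (fl : linear f) : {linear X -> Y} :=
  HB.pack f (GRing.isLinear.Build A X Y *:%R f fl).

Lemma mklinE X Y (f : X -> Y) (fl : linear f) x : mklin fl x = f x.
Proof. by []. Qed.

Lemma lsum_linear (I : finType) X Y (a : I -> {linear X -> Y}) :
  linear (fun x => \sum_i a i x).
Proof.
move=> r x y; rewrite scaler_sumr -big_split /=.
by apply: eq_bigr => i _; rewrite linearP.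
Qed.
Definition lsum (I : finType) X Y (a : I -> {linear X -> Y}) := mklin (lsum_linear a).

Lemma addl_linear X Y (f g : {linear X -> Y}) : linear (fun x => f x + g x).
Proof. by move=> r x y; rewrite !linearP scalerDr addrACA. Qed.
Definition addl X Y (f g : {linear X -> Y}) := mklin (addl_linear f g).

Lemma subl_linear X Y (f g : {linear X -> Y}) : linear (fun x => f x - g x).
Proof. by move=> r x y; rewrite (linearP f) (linearP g) scalerBr opprD addrACA. Qed.
Definition subl X Y (f g : {linear X -> Y}) := mklin (subl_linear f g).

Lemma zerol_linear X Y : linear (fun _ : X => 0 : Y).
Proof. by move=> r x y; rewrite scaler0 addr0. Qed.
Definition zerol X Y := mklin (@zerol_linear X Y).

Lemma idl_linear X : linear (fun x : X => x).
Proof. by []. Qed.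
Definition idl X : {linear X -> X} := mklin (@idl_linear X).

Lemma compl_linear X Y Z (g : {linear Y -> Z}) (f : {linear X -> Y}) :
  linear (fun x => g (f x)).
Proof. by move=> r x y; rewrite !linearP. Qed.
Definition compl X Y Z (g : {linear Y -> Z}) (f : {linear X -> Y}) :=
  mklin (compl_linear g f).

Lemma scall_linear X (x : X) : linear (fun a : A^o => (a : A) *: x).
Proof. by move=> r a b; rewrite scalerDl scalerA. Qed.
Definition scall X (x : X) : {linear A^o -> X} := mklin (scall_linear x).

Lemma pairl_linear X Y Z (f : {linear X -> Z}) (g : {linear Y -> Z}) :
  linear (fun xy : (X * Y)%type => f xy.1 + g xy.2).
Proof. by move=> r x y; rewrite !linearP scalerDr addrACA. Qed.
Definition pairl X Y Z (f : {linear X -> Z}) (g : {linear Y -> Z})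
  : {linear (X * Y)%type -> Z} := mklin (pairl_linear f g).

Lemma mkpairl_linear X Y Z (f : {linear Z -> X}) (g : {linear Z -> Y}) :
  linear (fun z => (f z, g z)).
Proof. by move=> r x y; rewrite !linearP. Qed.
Definition mkpairl X Y Z (f : {linear Z -> X}) (g : {linear Z -> Y})
  : {linear Z -> (X * Y)%type} := mklin (mkpairl_linear f g).

Lemma fstl_linear X Y : linear (fun z : (X * Y)%type => z.1).
Proof. by []. Qed.
Definition fstl X Y := mklin (@fstl_linear X Y).
Lemma sndl_linear X Y : linear (fun z : (X * Y)%type => z.2).
Proof. by []. Qed.
Definition sndl X Y := mklin (@sndl_linear X Y).

Lemma projl_linear (I : finType) X (i : I) : linear (fun z : {ffun I -> X} => z i).
Proof. by move=> r x y; rewrite !ffunE. Qed.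
Definition projl (I : finType) X (i : I) := mklin (@projl_linear I X i).

Lemma tupl_linear (I : finType) X Y (a : I -> {linear X -> Y}) :
  linear (fun x => [ffun i => a i x] : {ffun I -> Y}).
Proof. by move=> r x y; apply/ffunP => i; rewrite !ffunE linearP. Qed.
Definition tupl (I : finType) X Y (a : I -> {linear X -> Y}) := mklin (tupl_linear a).

Definition delta (I : finType) X (i : I) (x : X) : {ffun I -> X} :=
  [ffun j => if j == i then x else 0].
Lemma injl_linear (I : finType) X (i : I) : linear (@delta I X i).
Proof.
move=> r x y; apply/ffunP => j; rewrite !ffunE.
by case: eqP => // _; rewrite scaler0 addr0.
Qed.
Definition injl (I : finType) X (i : I) := mklin (@injl_linear I X i).

Lemma ffun_decomp (I : finType) X (z : {ffun I -> X}) :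
  z = \sum_i delta i (z i).
Proof.
apply/ffunP => j; rewrite sum_ffunE (bigD1 j) //= ffunE eqxx big1 ?addr0 //.
by move=> i ij; rewrite ffunE eq_sym (negbTE ij).
Qed.

Lemma sum_delta (I : finType) X Y (a : I -> {linear X -> Y}) i x :
  \sum_j a j (delta i x j) = a i x.
Proof.
rewrite (bigD1 i) //= ffunE eqxx big1 ?addr0 // => j ij.
by rewrite ffunE (negbTE ij) linear0.
Qed.

Definition summl (I : finType) X Y (a : I -> {linear X -> Y})
  : {linear {ffun I -> X} -> Y} := lsum (fun i => compl (a i) (projl X i)).

Lemma summlE (I : finType) X Y (a : I -> {linear X -> Y}) z :
  summl a z = \sum_i a i (z i).
Proof. by []. Qed.

Lemma factor_surj X Y Z (p : {linear X -> Y}) (h : {linear X -> Z}) :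
  surj p -> (forall x, p x = 0 -> h x = 0) ->
  exists g : {linear Y -> Z}, forall x, g (p x) = h x.
Proof.
move=> ps ph; pose s y := projT1 (cid (ps y)).
have sK y : p (s y) = y by rewrite /s; case: cid.
have hs x : h (s (p x)) = h x.
  apply/eqP; rewrite -subr_eq0 -linearB; apply/eqP/ph.
  by rewrite linearB sK subrr.
have gl : linear (fun y => h (s y)).
  move=> r x y; rewrite -[in LHS](sK x) -[in LHS](sK y).
  by rewrite -linearP hs linearP.
by exists (mklin gl) => x; rewrite mklinE hs.
Qed.

Lemma factor_inj X Y Z (i : {linear X -> Y}) (h : {linear Z -> Y}) :
  injective i -> (forall z, exists x, i x = h z) ->
  exists g : {linear Z -> X}, forall z, i (g z) = h z.
Proof.
move=> ii ih; pose g z := projT1 (cid (ih z)).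
have gK z : i (g z) = h z by rewrite /g; case: cid.
have gl : linear g by move=> r x y; apply: ii; rewrite linearP !gK linearP.
by exists (mklin gl) => z; rewrite mklinE gK.
Qed.

Lemma inj0 X Y (f : {linear X -> Y}) : (forall x, f x = 0 -> x = 0) -> injective f.
Proof.
move=> f0 x y /eqP; rewrite -subr_eq0 -linearB => /eqP/f0/eqP.
by rewrite subr_eq0 => /eqP.
Qed.

End LinearMaps.

Section Kernel.
Variables (A : pzRingType) (X Y : lmodType A) (f : {linear X -> Y}).
Definition ker_pred : {pred X} := fun x => f x == 0.
Fact ker_pred_closed : submod_closed ker_pred.
Proof.
split=> [|r x y]; rewrite /ker_pred !unfold_in ?linear0 // linearP.
by move=> /eqP-> /eqP->; rewrite scaler0 addr0.
Qed.
HB.instance Definition _ := GRing.isSubmodClosed.Build A X ker_pred ker_pred_closed.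
Definition kerm : Type := {x : X | x \in ker_pred}.
HB.instance Definition _ := [isSub of kerm for sval].
HB.instance Definition _ := [Choice of kerm by <:].
HB.instance Definition _ := [SubChoice_isSubLmodule of kerm by <:].

Fact kerm_inclusion : {g : {linear kerm -> X} | injective g /\ exact_at g f}.
Proof.
have vl : linear (val : kerm -> X) by [].
exists (mklin vl); split=> [|x]; first exact: val_inj.
split=> [fx|[y <-]]; last by apply/eqP/(valP y).
have xk : x \in ker_pred by rewrite unfold_in /= fx.
by exists (Sub x xk).
Qed.
(* Obtained from an opaque proof, so that [simpl] never unfolds it. *)
Definition kerm_val : {linear kerm -> X} := sval kerm_inclusion.

Lemma kerm_val_inj : injective kerm_val.
Proof. by case: (svalP kerm_inclusion). Qed.

Lemma kerm_exact : exact_at kerm_val f.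
Proof. by case: (svalP kerm_inclusion). Qed.
End Kernel.
Arguments kerm_val {A X Y} f : simpl never.

Section Quotient.
Variables (A : pzRingType) (Y : lmodType A) (S : Y -> Prop).
Hypothesis S0 : S 0.
Hypothesis SP : forall a x y, S x -> S y -> S (a *: x + y).

Fact quot_subD x y : S x -> S y -> S (x + y).
Proof. by move=> Sx Sy; rewrite -[x]scale1r; apply: SP. Qed.
Fact quot_subZ a x : S x -> S (a *: x).
Proof. by move=> Sx; rewrite -[_ *: _]addr0; apply: SP. Qed.
Fact quot_subN x : S x -> S (- x).
Proof. by move=> Sx; rewrite -scaleN1r; apply: quot_subZ. Qed.
Fact quot_subB x y : S x -> S y -> S (x - y).
Proof. by move=> Sx Sy; apply: quot_subD => //; apply: quot_subN. Qed.

Definition quot_rel (y : Y) : pred Y := fun z => `[< S (z - y) >].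
(** A canonical representative: [choose] picks the same element for equal predicates, so this is
    constant on classes and the quotient can be the type of its fixed points. *)
Definition quot_repr (y : Y) : Y := choose (quot_rel y) y.

Fact quot_rel_refl y : quot_rel y y.
Proof. by apply/asboolP; rewrite subrr. Qed.
Fact quot_reprP y : S (quot_repr y - y).
Proof. exact/asboolP/(chooseP (quot_rel_refl y)). Qed.
Fact quot_repr_eq y z : S (y - z) -> quot_repr y = quot_repr z.
Proof.
move=> yz; have e : quot_rel y =1 quot_rel z.
  move=> t; rewrite /quot_rel; congr (asbool _); apply/propext; split=> tu.
    by rewrite -[t](subrK y) -addrA; apply: quot_subD.
  have -> : t - y = (t - z) - (y - z) by rewrite opprB addrA subrK.
  exact: quot_subB.
rewrite /quot_repr (eq_choose e); apply: choose_id; first exact/asboolP.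
exact: quot_rel_refl.
Qed.

(* The type carries the proofs [S0] and [SP], so that its module structure can
   be inferred from it. *)
Definition quot_mod : Type := let _ := S0 in let _ := SP in {y : Y | quot_repr y == y}.
Fact quot_pi_subproof y : quot_repr (quot_repr y) == quot_repr y.
Proof. by apply/eqP/quot_repr_eq/quot_reprP. Qed.
Definition quot_pi (y : Y) : quot_mod := exist _ (quot_repr y) (quot_pi_subproof y).

Fact quot_piK (q : quot_mod) : quot_pi (sval q) = q.
Proof. by case: q => y yP; apply: val_inj => /=; apply/eqP. Qed.
Fact quot_piP y z : quot_pi y = quot_pi z <-> S (y - z).
Proof.
split=> [/(congr1 sval) /= e|e]; last exact/val_inj/quot_repr_eq.
have -> : y - z = (quot_repr z - z) - (quot_repr y - y).
  by rewrite e opprB [RHS]addrC addrA subrK.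
exact: quot_subB (quot_reprP z) (quot_reprP y).
Qed.

HB.instance Definition _ := gen_eqMixin quot_mod.
HB.instance Definition _ := gen_choiceMixin quot_mod.
Definition quot_add (p q : quot_mod) := quot_pi (sval p + sval q).
Definition quot_opp (p : quot_mod) := quot_pi (- sval p).
Definition quot_scale (a : A) (p : quot_mod) := quot_pi (a *: sval p).

Fact quot_ind (P : quot_mod -> Prop) : (forall y, P (quot_pi y)) -> forall q, P q.
Proof. by move=> h q; rewrite -(quot_piK q). Qed.
Fact quot_piD y z : quot_add (quot_pi y) (quot_pi z) = quot_pi (y + z).
Proof.
apply/quot_piP; rewrite opprD addrACA.
exact: quot_subD (quot_reprP y) (quot_reprP z).
Qed.
Fact quot_piN y : quot_opp (quot_pi y) = quot_pi (- y).
Proof.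
apply/quot_piP; rewrite -opprD.
exact: quot_subN (quot_reprP y).
Qed.
Fact quot_piZ a y : quot_scale a (quot_pi y) = quot_pi (a *: y).
Proof. by apply/quot_piP; rewrite -scalerBr; apply: quot_subZ (quot_reprP y). Qed.
Fact quot_addA : associative quot_add.
Proof.
by elim/quot_ind=> x; elim/quot_ind=> y; elim/quot_ind=> z; rewrite !quot_piD addrA.
Qed.
Fact quot_addC : commutative quot_add.
Proof. by elim/quot_ind=> x; elim/quot_ind=> y; rewrite !quot_piD addrC. Qed.
Fact quot_add0 : left_id (quot_pi 0) quot_add.
Proof. by elim/quot_ind=> x; rewrite quot_piD add0r. Qed.
Fact quot_addN : left_inverse (quot_pi 0) quot_opp quot_add.
Proof. by elim/quot_ind=> x; rewrite quot_piN quot_piD addNr. Qed.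
HB.instance Definition _ :=
  GRing.isZmodule.Build quot_mod quot_addA quot_addC quot_add0 quot_addN.
Fact quot_scaleA a b q : quot_scale a (quot_scale b q) = quot_scale (a * b) q.
Proof. by elim/quot_ind: q => y; rewrite !quot_piZ scalerA. Qed.
Fact quot_scale1 : left_id 1 quot_scale.
Proof. by elim/quot_ind=> y; rewrite !quot_piZ scale1r. Qed.
Fact quot_scaleDr : right_distributive quot_scale +%R.
Proof.
move=> a; elim/quot_ind=> y; elim/quot_ind=> z.
change (quot_scale a (quot_add (quot_pi y) (quot_pi z)) =
  quot_add (quot_scale a (quot_pi y)) (quot_scale a (quot_pi z))).
by rewrite quot_piD !quot_piZ quot_piD scalerDr.
Qed.
Fact quot_scaleDl q : {morph quot_scale^~ q : a b / a + b}.
Proof.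
move=> a b; elim/quot_ind: q => y.
change (quot_scale (a + b) (quot_pi y) =
  quot_add (quot_scale a (quot_pi y)) (quot_scale b (quot_pi y))).
by rewrite !quot_piZ quot_piD scalerDl.
Qed.
HB.instance Definition _ := GRing.Zmodule_isLmodule.Build A quot_mod
  quot_scaleA quot_scale1 quot_scaleDr quot_scaleDl.

Fact quot_pi_linear : linear quot_pi.
Proof.
move=> a y z.
change (quot_pi (a *: y + z) = quot_add (quot_scale a (quot_pi y)) (quot_pi z)).
by rewrite quot_piZ quot_piD.
Qed.
Definition quot_proj : {linear Y -> quot_mod} := mklin quot_pi_linear.

Lemma quot_proj_surj : surj quot_proj.
Proof. by move=> q; exists (sval q); apply: quot_piK. Qed.

Lemma quot_exact y : quot_proj y = 0 <-> S y.
Proof. by split=> [/quot_piP|Sy]; [| apply/quot_piP]; rewrite subr0. Qed.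
End Quotient.

Section Cokernel.
Variables (A : pzRingType) (X Y : lmodType A) (f : {linear X -> Y}).
Definition in_image (y : Y) : Prop := exists x, f x = y.
Fact in_image0 : in_image 0.
Proof. by exists 0; rewrite linear0. Qed.
Fact in_imageP a x y : in_image x -> in_image y -> in_image (a *: x + y).
Proof. by move=> [u <-] [v <-]; exists (a *: u + v); rewrite linearP. Qed.

Definition coker := quot_mod in_image0 in_imageP.
Definition coker_proj : {linear Y -> coker} := quot_proj in_image0 in_imageP.

Lemma coker_proj_surj : surj coker_proj.
Proof. exact: quot_proj_surj. Qed.

Lemma coker_exact : exact_at f coker_proj.
Proof. exact: quot_exact. Qed.
End Cokernel.

(** * Projective modules and noetherian base rings *)

Section Generation.
Variable A : pzRingType.
Implicit Types M N X Y Z : lmodType A.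

Definition gen_set M (I : finType) (g : I -> M) : Prop :=
  forall m, exists c : I -> A, m = \sum_i c i *: g i.

Definition dual_basis M (I : finType) (g : I -> M) (f : I -> {linear M -> A^o}) : Prop :=
  forall m, m = \sum_i (f i m : A) *: g i.

(* [add M], with the two maps of a retraction given by their components. *)
Definition radd M X : Prop :=
  exists (I : finType) (a : I -> {linear M -> X}) (b : I -> {linear X -> M}),
    forall x, x = \sum_i a i (b i x).

Lemma sum_enum_val (V : zmodType) (I : finType) (F : I -> V) :
  \sum_i F i = \sum_(k < #|I|) F (enum_val k).
Proof. exact: (reindex _ (onW_bij _ (@enum_val_bij I))). Qed.

Lemma fin_genP M : fin_gen M <-> exists (I : finType) (g : I -> M), gen_set g.
Proof.
split=> [[n [g gP]]|[I [g gP]]]; first by exists 'I_n, g.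
exists #|I|, (fun k => g (enum_val k)) => m; have [c ->] := gP m.
by exists (fun k => c (enum_val k)); rewrite sum_enum_val.
Qed.

Lemma add_catP M X : add_cat M X <-> radd M X.
Proof.
split=> [[n [s [r rs]]]|[I [a [b ab]]]].
  exists 'I_n, (fun i => compl r (injl M i)), (fun i => compl (projl M i) s) => x.
  by rewrite -[LHS]rs [s x]ffun_decomp linear_sum.
exists #|I|, (tupl (fun k => b (enum_val k))), (summl (fun k => a (enum_val k))) => x.
rewrite summlE [RHS]ab [RHS]sum_enum_val.
by apply: eq_bigr => k _; rewrite mklinE ffunE.
Qed.

Lemma radd_refl M : radd M M.
Proof.
exists unit, (fun=> idl M), (fun=> idl M) => x.
by rewrite (big_pred1 tt) // => -[].
Qed.

Lemma radd_trans M N X : radd M N -> radd N X -> radd M X.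
Proof.
move=> [I [a [b ab]]] [J [c [e ce]]].
exists (J * I)%type, (fun k => compl (c k.1) (a k.2)), (fun k => compl (b k.2) (e k.1)).
move=> x; rewrite -(pair_bigA _ (fun j i => c j (a i (b i (e j x))))) /= [LHS]ce.
by apply: eq_bigr => j _; rewrite [in LHS](ab (e j x)) linear_sum.
Qed.

Lemma radd_ffun M (I : finType) : radd M {ffun I -> M}.
Proof. by exists I, (@injl A I M), (@projl A I M) => x; apply: ffun_decomp. Qed.

Lemma dual_basis_projective M (I : finType) (g : I -> M) f :
  dual_basis g f -> projective M.
Proof.
move=> gf X Y p h ps; pose x i := projT1 (cid (ps (h (g i)))).
have xK i : p (x i) = h (g i) by rewrite /x; case: cid.
exists (lsum (fun i => compl (scall (x i)) (f i))) => m.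
rewrite /= linear_sum [in RHS](gf m) linear_sum; apply: eq_bigr => i _.
by rewrite !linearZ /= xK.
Qed.

Lemma free_dual_basis (I : finType) :
  @dual_basis {ffun I -> A^o} I (fun i => delta i (1 : A^o)) (fun i => projl A^o i).
Proof.
move=> x; rewrite [LHS]ffun_decomp; apply: eq_bigr => i _; apply/ffunP => j.
by rewrite !ffunE; case: eqP => // _; rewrite ?scaler0 // /GRing.scale /= mulr1.
Qed.

Lemma free_projective (I : finType) : projective {ffun I -> A^o}.
Proof. exact: dual_basis_projective (@free_dual_basis I). Qed.

Definition free_map M (I : finType) (g : I -> M) : {linear {ffun I -> A^o} -> M} :=
  summl (fun i => scall (g i)).

Lemma free_map_surj M (I : finType) (g : I -> M) : gen_set g -> surj (free_map g).
Proof.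
move=> gP m; have [c ->] := gP m; exists [ffun i => c i : A^o].
by rewrite summlE; apply: eq_bigr => i _; rewrite ffunE.
Qed.

Lemma dual_basis_exists M (I : finType) (g : I -> M) :
  projective M -> gen_set g -> exists f, dual_basis g f.
Proof.
move=> pM /free_map_surj/pM - /(_ (idl M)) [s sK].
exists (fun i => compl (projl _ i) s) => m; rewrite -[LHS]sK summlE.
by apply: eq_bigr.
Qed.

Lemma fgpP M : fgp M <-> exists (I : finType) (g : I -> M) f, dual_basis g f.
Proof.
split=> [[/fin_genP [I [g gP]] pM]|[I [g [f gf]]]].
  by have [f gf] := dual_basis_exists pM gP; exists I, g, f.
split; last exact: dual_basis_projective gf.
by apply/fin_genP; exists I, g => m; exists (fun i => f i m).
Qed.

Lemma fgp_radd_free M : fgp M <-> radd A^o M.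
Proof.
split=> [/fgpP [I [g [f gf]]]|[I [a [b ab]]]].
  by exists I, (fun i => scall (g i)), f.
apply/fgpP; exists I, (fun i => a i 1), b => m.
rewrite [LHS]ab; apply: eq_bigr => i _.
by rewrite -linearZ /= /GRing.scale /= mulr1.
Qed.

Lemma fgp_radd M X : fgp M -> radd M X -> fgp X.
Proof. by rewrite !fgp_radd_free; apply: radd_trans. Qed.

Lemma fgp_zero M : zero_mod M -> fgp M.
Proof.
move=> M0; apply/fgpP.
exists void, (fun v : void => match v with end), (fun v : void => match v with end).
by move=> m; rewrite big1 ?M0 // => -[].
Qed.

Lemma short_exact_split X' X X'' (f : {linear X' -> X}) (g : {linear X -> X''})
    (s : {linear X'' -> X}) : short_exact f g -> (forall y, g (s y) = y) ->
  exists t : {linear X -> X'}, (forall x, x = f (t x) + s (g x)) /\ forall y, t (f y) = y.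
Proof.
move=> [fi fg gs] sK.
have [|t tP] := factor_inj (h := subl (idl X) (compl s g)) fi.
  by move=> x; apply/fg; rewrite linearB /= sK subrr.
exists t; split=> [x|y]; first by rewrite tP /= subrK.
have gf : g (f y) = 0 by apply/fg; exists y.
by apply: fi; rewrite tP /= gf linear0 subr0.
Qed.

Lemma fgp_ext X' X X'' (f : {linear X' -> X}) (g : {linear X -> X''}) :
  short_exact f g -> fgp X' -> fgp X'' -> fgp X.
Proof.
move=> se /fgpP [I [u [a ua]]] fX; have [_ pX] := fX.
move/fgpP: fX => [J [v [b vb]]].
have [_ _ gs] := se; have [s sK] := pX _ _ g (idl X'') gs.
have [t [tP _]] := short_exact_split se sK.
apply/fgpP; exists (I + J)%type,
  (fun k => match k with inl i => f (u i) | inr j => s (v j) end),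
  (fun k => match k with inl i => compl (a i) t | inr j => compl (b j) g end).
move=> m; rewrite big_sumType /= [LHS]tP {1}(ua (t m)) {1}(vb (g m)) !linear_sum.
by congr (_ + _); apply: eq_bigr => i _; rewrite linearZ.
Qed.

Lemma fgp_kernel X' X X'' (f : {linear X' -> X}) (g : {linear X -> X''}) :
  short_exact f g -> fgp X -> fgp X'' -> fgp X'.
Proof.
move=> se fX [_ pX]; have [_ _ gs] := se.
have [s sK] := pX _ _ g (idl X'') gs.
have [t [_ tf]] := short_exact_split se sK.
apply: (fgp_radd fX); exists unit, (fun=> t), (fun=> f) => x.
by rewrite (big_pred1 tt) ?tf // => -[].
Qed.

Lemma ker_short_exact X Y (f : {linear X -> Y}) :
  surj f -> short_exact (kerm_val f) f.
Proof. by move=> fs; split=> //; [apply: kerm_val_inj | apply: kerm_exact]. Qed.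

Lemma projective_ffun M (I : finType) : projective M -> projective {ffun I -> M}.
Proof.
move=> pM X Y p f ps.
have H i := cid (pM X Y p (compl f (injl M i)) ps).
exists (summl (fun i => projT1 (H i))) => m.
rewrite summlE linear_sum [in RHS](ffun_decomp m) linear_sum; apply: eq_bigr => i _.
exact: (projT2 (H i)).
Qed.

End Generation.

Section Noetherian.
Variables (R : idomainType) (hR : noetherian R).

Definition submodule (M : lmodType R) (S : M -> Prop) : Prop :=
  S 0 /\ forall r x y, S x -> S y -> S (r *: x + y).

Lemma submodule_sum (M : lmodType R) (S : M -> Prop) (I : finType) (c : I -> R)
  (g : I -> M) : submodule S -> (forall i, S (g i)) -> S (\sum_i c i *: g i).
Proof.
move=> [S0 SP] gS; apply: (@big_ind M S) => //.
  by move=> x y Sx Sy; rewrite -[x]scale1r; apply: SP.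
by move=> i _; rewrite -[_ *: _]addr0; apply: SP.
Qed.

Lemma ideal_fg (P : R -> Prop) :
  P 0 -> (forall r x y, P x -> P y -> P (r * x + y)) ->
  exists n (g : 'I_n -> R), (forall i, P (g i)) /\
    forall x, P x -> exists c : 'I_n -> R, x = \sum_i c i * g i.
Proof.
(* [noetherian] speaks only of proper ideals, so the unit ideal is treated apart. *)
move=> P0 PP; have [P1|P1] := pselect (P 1).
  exists 1, (fun=> 1); split=> // x _; exists (fun=> x).
  by rewrite big_ord_recl big_ord0 mulr1 addr0.
pose I : {pred R} := fun x => `[< P x >].
have IP x : x \in I <-> P x by rewrite unfold_in; split=> /asboolP.
have cI : idealr_closed I.
  split; [exact/IP | by apply/negP => /IP | by move=> a x y /IP ? /IP ?; apply/IP/PP].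
have [n [g gP]] := hR cI; exists n, g; split=> [i|x /IP/gP //].
apply/IP/gP; exists (fun j => (j == i)%:R).
rewrite (bigD1 i) //= eqxx mul1r big1 ?addr0 // => j /negbTE->.
by rewrite mul0r.
Qed.

(** Induction on the number of generators: the coefficients of elements of [S] at the first
    generator form an ideal. Lifts of finitely many generators of this ideal, together with
    generators of the part of [S] in the span of the remaining [g], generate [S]. *)
Lemma submodule_span_fg (M : lmodType R) n (g : 'I_n -> M) (S : M -> Prop) :
  submodule S -> (forall x, S x -> exists c : 'I_n -> R, x = \sum_i c i *: g i) ->
  exists (I : finType) (h : I -> M), (forall i, S (h i)) /\
    forall x, S x -> exists c : I -> R, x = \sum_i c i *: h i.
Proof.
elim: n g S => [|n IH] g S [S0 SP] Sg.
  exists void, (fun v : void => match v with end); split=> [[]//|x /Sg [c ->]].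
  by exists (fun v : void => match v with end); rewrite big_ord0 big1 // => -[].
pose tail x := exists c : 'I_n -> R, x = \sum_i c i *: g (lift ord0 i).
have tailP r x y : tail x -> tail y -> tail (r *: x + y).
  move=> [c ->] [e ->]; exists (fun i => r * c i + e i).
  rewrite scaler_sumr -big_split /=; apply: eq_bigr => i _.
  by rewrite scalerDl scalerA.
have tail0 : tail 0.
  by exists (fun=> 0); rewrite big1 // => i _; rewrite scale0r.
pose P r := exists t, tail t /\ S (r *: g ord0 + t).
have [|r x y [t [tt St]] [u [tu Su]]|m [a [aP aG]]] := @ideal_fg P.
- by exists 0; rewrite scale0r addr0.
- exists (r *: t + u); split; first exact: tailP.
  by rewrite scalerDl addrACA -scalerA -scalerDr; apply: SP.
have [t tP] := choice aP.
pose h i := a i *: g ord0 + t i.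
have [|x [_ tx] //|J [k [kS kG]]] := IH (fun i => g (lift ord0 i)) (fun x => S x /\ tail x).
  by split=> [//|r x y [Sx tx] [Sy ty]]; split; [apply: SP | apply: tailP].
exists ('I_m + J)%type, (fun z => match z with inl i => h i | inr j => k j end).
split=> [[i|j]|x Sx]; [by case: (tP i) | by case: (kS j) |].
have [c xc] := Sg x Sx; rewrite big_ord_recl in xc.
have [|e ce] := aG (c ord0).
  exists (\sum_(i < n) c (lift ord0 i) *: g (lift ord0 i)); rewrite -xc; split=> //.
  by exists (fun i => c (lift ord0 i)).
have [|q xq] := kG (x - \sum_i e i *: h i).
  split.
    rewrite addrC -scaleN1r; apply: (SP) => //.
    exact: (submodule_sum (S := S) e (conj S0 SP) (fun i => proj2 (tP i))).
  have -> : x - \sum_i e i *: h i =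
     \sum_(i < n) c (lift ord0 i) *: g (lift ord0 i) - \sum_i e i *: t i.
    rewrite /h; under eq_bigr do rewrite scalerDr scalerA.
    rewrite big_split /= -scaler_suml -ce {1}xc.
    by rewrite opprD addrACA subrr add0r.
  rewrite addrC -scaleN1r; apply: (tailP); last by exists (fun i => c (lift ord0 i)).
  exact: (submodule_sum (S := tail) e (conj tail0 tailP) (fun i => proj1 (tP i))).
exists (fun z => match z with inl i => e i | inr j => q j end).
by rewrite big_sumType /= -xq addrC subrK.
Qed.

Lemma noetherian_sub (M N : lmodType R) (i : {linear N -> M}) :
  injective i -> fin_gen M -> fin_gen N.
Proof.
move=> ii [n [g gP]].
have [|x _|I [h [hS hG]]] := @submodule_span_fg M n g (fun x => exists y, i y = x).
- split; first by exists 0; rewrite linear0.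
  by move=> r _ _ [x <-] [y <-]; exists (r *: x + y); rewrite linearP.
- exact: gP.
have [k kP] := choice hS; apply/fin_genP; exists I, k => x.
have [|c xc] := hG (i x); first by exists x.
exists c; apply: ii; rewrite xc linear_sum; apply: eq_bigr => j _.
by rewrite linearZ /= kP.
Qed.

End Noetherian.

(** * Vanishing of Ext^1 *)

Section Extensions.
Variable A : pzRingType.
Implicit Types M N P Q X Y Z C : lmodType A.

(* Ext^1(M, N) = 0, in a form that needs neither resolutions nor pushouts. *)
Definition Ext1_zero M N : Prop :=
  forall C P (i : {linear C -> P}) (p : {linear P -> M}),
    short_exact i p -> forall h : {linear C -> N},
    exists k : {linear P -> N}, forall c, k (i c) = h c.

Lemma exact_comp0 X Y Z (f : {linear X -> Y}) (g : {linear Y -> Z}) :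
  exact_at f g -> forall x, g (f x) = 0.
Proof. by move=> fg x; apply/fg; exists x. Qed.

(** Any other extension [P'] of [M] receives a map from [P] and is the quotient of [C' + P] by a
    copy of [C]; [h] on [C'] and a suitable [k] on [P] therefore define a map on [P']. *)
Lemma Ext1_of_presentation M N C P (i : {linear C -> P}) (p : {linear P -> M}) :
  short_exact i p -> projective P ->
  (forall h : {linear C -> N}, exists k : {linear P -> N}, forall c, k (i c) = h c) ->
  Ext1_zero M N.
Proof.
move=> [ii ip ps] pP E C' P' i' p' [ii' ip' ps'] h.
have [u uK] := pP _ _ p' p ps'.
have [|v vK] := factor_inj (h := compl u i) ii'.
  by move=> c; apply/ip'; rewrite /= uK (exact_comp0 ip).
have [k kK] := E (compl h v).
have [||g gK] := factor_surj (p := pairl i' u) (h := pairl h k).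
- move=> x; have [y yx] := ps (p' x).
  have [|c cx] := (ip' (x - u y)).1; first by rewrite linearB uK yx subrr.
  by exists (c, y); rewrite /= cx subrK.
- move=> [c y] /= e.
  have [|c0 yc] := (ip y).1.
    by rewrite -uK -[RHS](linear0 p') -e linearD (exact_comp0 ip') add0r.
  have cv : c = - v c0.
    by apply: ii'; rewrite linearN vK /= yc; apply/eqP; rewrite -addr_eq0 e.
  by rewrite -yc kK cv linearN /= addNr.
by exists g => c; have := gK (c, 0); rewrite /= !linear0 !addr0.
Qed.

(** Maps out of the first syzygy, the kernel of [aug P], are the cocycles on [term P 1]; those that
    extend to [term P 0] are the coboundaries. *)
Lemma Ext1_of_Ext_zero M N : Ext_zero 1 M N -> Ext1_zero M N.
Proof.
move=> [P [[pP ex] van]].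
have [+ _ _] := ex 1; move=> /(_ isT) as_.
have [_ + _] := ex 2; move=> /(_ isT) e0.
have [_ _ /(_ 0 isT) e1] := ex 3.
apply: (Ext1_of_presentation (ker_short_exact as_) (pP 0)) => h.
have [|d dK] := factor_inj (h := diff P 0) (@kerm_val_inj _ _ _ (aug P)).
  by move=> z; apply/(kerm_exact (aug P)); rewrite (exact_comp0 e0).
have [|g gK] := van (compl h d).
  move=> x /=; suff -> : d (diff P 1 x) = 0 by rewrite linear0.
  by apply: kerm_val_inj; rewrite dK linear0 (exact_comp0 e1).
exists g => c; have /e0 [x xc] := exact_comp0 (kerm_exact (aug P)) c.
rewrite -xc -gK /=; congr (h _); apply: kerm_val_inj.
by rewrite dK.
Qed.

Lemma Ext_zero_of_resolution M N (P : chain M) : proj_resolution P -> Ext1_zero M N -> Ext_zero 1 M N.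
Proof.
move=> rP E; exists P; split=> // f fd; have [pP ex] := rP.
have [+ _ _] := ex 1; move=> /(_ isT) as_.
have [_ + _] := ex 2; move=> /(_ isT) e0.
have [_ _ /(_ 0 isT) e1] := ex 3.
have [|d dK] := factor_inj (h := diff P 0) (@kerm_val_inj _ _ _ (aug P)).
  by move=> z; apply/(kerm_exact (aug P)); rewrite (exact_comp0 e0).
have [||h hK] := factor_surj (p := d) (h := f).
- move=> c; have /e0 [x xc] := exact_comp0 (kerm_exact (aug P)) c.
  by exists x; apply: kerm_val_inj; rewrite dK.
- move=> x dx; have /e1 [y <-] : diff P 0 x = 0 by rewrite -dK dx linear0.
  exact: fd.
have [k kK] := E _ _ _ _ (ker_short_exact as_) h.
by exists k => x; rewrite -dK kK hK.
Qed.

(** The pullback of the extension along [u], realized as the kernel of [q'], splits because Ext^1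
    vanishes; the splitting followed by the projection to [N] is the lift. *)
Lemma Ext1_lift M N' N N'' (f : {linear N' -> N}) (g : {linear N -> N''})
    (u : {linear M -> N''}) :
  short_exact f g -> Ext1_zero M N' -> exists v : {linear M -> N}, forall m, g (v m) = u m.
Proof.
move=> [fi fg gs] E.
pose q' := subl (compl u (fstl M N)) (compl g (sndl M N)).
have [|j jK] := factor_inj (h := mkpairl (zerol N' M) f) (@kerm_val_inj _ _ _ q').
  move=> z; apply/kerm_exact.
  by rewrite /= linear0 (exact_comp0 fg) subrr.
pose t := compl (fstl M N) (kerm_val q').
pose t2 := compl (sndl M N) (kerm_val q').
have tt x : u (t x) = g (t2 x).
  apply/eqP; rewrite -subr_eq0; apply/eqP.
  exact: (exact_comp0 (kerm_exact q') x).
have t2j z : t2 (j z) = f z by rewrite /t2 /= jK.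
have tj z : t (j z) = 0 by rewrite /t /= jK.
have ts : surj t.
  move=> m; have [n nm] := gs (u m).
  have [|x xE] := ((kerm_exact q') (m, n)).1; first by rewrite /= nm subrr.
  by exists x; rewrite /t /= xE.
have [|k kK] := E _ _ j t _ (idl N').
  split=> // [x y e|x]; first by apply: fi; rewrite -!t2j e.
  split=> [tx|[y <-]]; last exact: tj.
  have [|y yx] := (fg (t2 x)).1; first by rewrite -tt tx linear0.
  exists y; apply: kerm_val_inj; rewrite jK /=.
  by apply: injective_projections => /=; [rewrite -[LHS]tx | rewrite yx].
have [//||s sK] := factor_surj (p := t) (h := subl t2 (compl f k)).
  move=> x tx; have [|y yx] := (fg (t2 x)).1; first by rewrite -tt tx linear0.
  have <- : j y = x.
    apply: kerm_val_inj; rewrite jK /=.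
    by apply: injective_projections => /=; [rewrite -[LHS]tx | rewrite yx].
  by rewrite -[LHS]/(t2 (j y) - f (k (j y))) kK t2j subrr.
exists s => m; have [x <-] := ts m.
by rewrite sK /= linearB (exact_comp0 fg) subr0 tt.
Qed.

(** A map on [C] is extended in two stages: to the preimage of [M'] in [P], which is the kernel of
    [q], and then to [P]. *)
Lemma Ext1_ext_l M' M M'' N (f : {linear M' -> M}) (g : {linear M -> M''}) :
  short_exact f g -> Ext1_zero M' N -> Ext1_zero M'' N -> Ext1_zero M N.
Proof.
move=> [fi fg gs] E' E'' C P i p [ii ip ps] h.
pose q := compl g p.
have qs : surj q.
  by move=> z; have [m <-] := gs z; have [x <-] := ps m; exists x.
have [|j jK] := factor_inj (h := i) (@kerm_val_inj _ _ _ q).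
  by move=> c; apply/kerm_exact; rewrite /q /= (exact_comp0 ip) linear0.
have [|r rK] := factor_inj (h := compl p (kerm_val q)) fi.
  by move=> x; apply/fg; exact: (exact_comp0 (kerm_exact q) x).
have [|k kK] := E' _ _ j r _ h.
  split=> [x y e|x|m].
  - by apply: ii; rewrite -!jK e.
  - split=> [rx|[c <-]].
      have [|c cx] := (ip (kerm_val q x)).1; first by rewrite -[LHS]rK rx linear0.
      by exists c; apply: kerm_val_inj; rewrite jK.
    by apply: fi; rewrite rK /= jK (exact_comp0 ip) linear0.
  have [x xm] := ps (f m).
  have [|y yx] := (kerm_exact q x).1; first by rewrite /q /= xm (exact_comp0 fg).
  by exists y; apply: fi; rewrite rK /= yx.
have [k' k'K] := E'' _ _ _ _ (ker_short_exact qs) k.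
by exists k' => c; rewrite -jK k'K kK.
Qed.

Lemma fin_gen_presentation M : fin_gen M ->
  exists (n : nat) (p : {linear {ffun 'I_n -> A^o} -> M}), surj p.
Proof.
by move=> [n [g gP]]; exists n, (free_map g); apply: free_map_surj.
Qed.

(** On a free presentation of [M], the image of [h] in [N''] is extended and lifted back to [N]; the
    error lies in [N'] and is extended separately. *)
Lemma Ext1_ext_r M N' N N'' (f : {linear N' -> N}) (g : {linear N -> N''}) :
  fin_gen M -> short_exact f g -> Ext1_zero M N' -> Ext1_zero M N'' -> Ext1_zero M N.
Proof.
move=> /fin_gen_presentation [n [p ps]] [fi fg gs] E' E''.
have se := ker_short_exact ps.
apply: (Ext1_of_presentation se (@free_projective _ _)) => h.
have [u uK] := E'' _ _ _ _ se (compl g h).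
have [v vK] := free_projective u gs.
have [|w wK] := factor_inj (h := subl h (compl v (kerm_val p))) fi.
  by move=> c; apply/fg; rewrite linearB /= vK uK subrr.
have [k kK] := E' _ _ _ _ se w.
exists (addl v (compl f k)) => c.
by rewrite /= kK wK /= addrC subrK.
Qed.

Lemma Ext1_radd_r M N X : radd N X -> Ext1_zero M N -> Ext1_zero M X.
Proof.
move=> [I [a [b ab]]] E C P i p se h.
have H j := cid (E _ _ _ _ se (compl (b j) h)).
exists (lsum (fun j => compl (a j) (projT1 (H j)))) => c /=.
rewrite [RHS]ab; apply: eq_bigr => j _; congr (a j _).
exact: (projT2 (H j)).
Qed.

Definition ffmap (I : finType) X Y (f : {linear X -> Y}) :
  {linear {ffun I -> X} -> {ffun I -> Y}} := tupl (fun i => compl f (projl X i)).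

Lemma ffmap_short_exact (I : finType) X Y Z (f : {linear X -> Y}) (g : {linear Y -> Z}) :
  short_exact f g -> short_exact (ffmap I f) (ffmap I g).
Proof.
move=> [fi fg gs]; split=> [x y /ffunP e|y|z].
- by apply/ffunP => i; have := e i; rewrite !ffunE => /fi.
- split=> [/ffunP gy|[x <-]]; last first.
    by apply/ffunP => i; rewrite !ffunE /= ffunE; apply: exact_comp0.
  have H i : exists x, f x = y i by apply/fg; have := gy i; rewrite !ffunE.
  have [x xE] := choice H; exists [ffun i => x i].
  by apply/ffunP => i; rewrite !ffunE /= ffunE.
have H i : exists y, g y = z i by apply: gs.
have [y yE] := choice H; exists [ffun i => y i].
by apply/ffunP => i; rewrite !ffunE /= ffunE.
Qed.

Lemma Ext1_ffun_l (I : finType) M N : fin_gen M -> Ext1_zero M N -> Ext1_zero {ffun I -> M} N.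
Proof.
move=> /fin_gen_presentation [n [p ps]] E.
have se := ker_short_exact ps.
apply: (Ext1_of_presentation (ffmap_short_exact I se)).
  exact/projective_ffun/free_projective.
move=> h; have H j := cid (E _ _ _ _ se (compl h (injl _ j))).
exists (summl (fun j => projT1 (H j))) => z.
rewrite [in RHS](ffun_decomp z) linear_sum summlE; apply: eq_bigr => j _.
by rewrite ffunE (projT2 (H j)).
Qed.

(** The extension is pulled back along the retraction [r] from a power of [M] to [X]. [P] embeds in
    the pullback by sending [x] to the pair of [x] and [s (p x)], and the extension of [h] found
    there is restricted to [P]. *)
Lemma Ext1_radd_l M N X : fin_gen M -> radd M X -> Ext1_zero M N -> Ext1_zero X N.
Proof.
move=> fM [I [a [b ab]]] /(@Ext1_ffun_l I _ _ fM) E C P i p [ii ip ps] h.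
pose s := tupl b; pose r := summl a.
have rs x : r (s x) = x.
  by rewrite /r summlE [RHS]ab; apply: eq_bigr => j _; rewrite ffunE.
pose q := subl (compl p (fstl P {ffun I -> M})) (compl r (sndl P {ffun I -> M})).
have [|j jK] := factor_inj (h := mkpairl i (zerol C {ffun I -> M})) (@kerm_val_inj _ _ _ q).
  move=> c; apply/kerm_exact; rewrite -[LHS]/(p (i c) - r 0).
  by rewrite linear0 (exact_comp0 ip) subrr.
pose t := compl (sndl P {ffun I -> M}) (kerm_val q).
have [|k kK] := E _ _ j t _ h.
  split=> [x y e|x|w].
  - by apply: ii; have := congr1 (fun z => (kerm_val q z).1) e; rewrite !jK.
  - split=> [tx|[c <-]]; last by rewrite /t /= jK.
    have e := exact_comp0 (kerm_exact q) x.
    have [|c cx] := (ip (kerm_val q x).1).1.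
      by rewrite -[LHS]subr0 -[X in _ - X](linear0 r) -[X in r X]tx; exact: e.
    exists c; apply: kerm_val_inj; rewrite jK.
    by apply: injective_projections => /=; [rewrite cx | rewrite -[LHS]tx].
  have [x xw] := ps (r w).
  have [|y yx] := (kerm_exact q (x, w)).1.
    by rewrite -[LHS]/(p x - r w) xw subrr.
  by exists y; rewrite /t /= yx.
have [|v vK] := factor_inj (h := mkpairl (idl P) (compl s p)) (@kerm_val_inj _ _ _ q).
  by move=> x; apply/kerm_exact; rewrite -[LHS]/(p x - r (s (p x))) rs subrr.
exists (compl k v) => c; rewrite -[LHS]/(k (v (i c))) -kK; congr (k _).
apply: kerm_val_inj; rewrite vK jK -[LHS]/(i c, s (p (i c))).
by rewrite (exact_comp0 ip) linear0.
Qed.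

Lemma Ext1_zero_l M N : zero_mod M -> Ext1_zero M N.
Proof.
move=> M0 C P i p [ii ip ps] h.
have [||k kK] := factor_surj (p := i) (h := h); last by exists k.
  by move=> x; apply/ip; apply: M0.
by move=> x; rewrite -(linear0 i) => /ii ->; rewrite linear0.
Qed.

Lemma Ext1_zero_r M N : zero_mod N -> Ext1_zero M N.
Proof. by move=> N0 C P i p se h; exists (zerol P N) => c; rewrite [RHS]N0. Qed.

Lemma Ext1_filtered_l (S : lmodType A -> Prop) M N :
  (forall X, S X -> Ext1_zero X N) -> filtered S M -> Ext1_zero M N.
Proof.
move=> SE; elim=> [X|X' X X'' f g _ E' SX se]; first exact: Ext1_zero_l.
exact: Ext1_ext_l se E' (SE _ SX).
Qed.

Lemma Ext1_filtered_r (S : lmodType A -> Prop) M N : fin_gen M ->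
  (forall X, S X -> Ext1_zero M X) -> filtered S N -> Ext1_zero M N.
Proof.
move=> fM SE; elim=> [X|X' X X'' f g _ E' SX se]; first exact: Ext1_zero_r.
exact: Ext1_ext_r fM se E' (SE _ SX).
Qed.

Definition hom0 M N : Prop := forall (f : {linear M -> N}) x, f x = 0.

Lemma hom0_filtered_l (S : lmodType A -> Prop) M N :
  (forall X, S X -> hom0 X N) -> filtered S M -> hom0 M N.
Proof.
move=> SE; elim=> [X X0 f x|X' X X'' f g _ E' SX [_ fg gs] h x].
  by rewrite (X0 x) linear0.
have [|k kK] := factor_surj (h := h) gs.
  by move=> y /fg [z <-]; exact: (E' (compl h f)).
by rewrite -kK (SE _ SX).
Qed.

Lemma hom0_filtered_r (S : lmodType A -> Prop) M N :
  (forall X, S X -> hom0 M X) -> filtered S N -> hom0 M N.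
Proof.
move=> SE; elim=> [X X0 f x|X' X X'' f g _ E' SX [fi fg gs] h x].
  exact: X0.
have [|k kK] := factor_inj (h := h) fi.
  by move=> y; apply/fg; exact: (SE _ SX (compl g h)).
by rewrite -kK E' linear0.
Qed.

Lemma fin_gen_radd M X : fin_gen M -> radd M X -> fin_gen X.
Proof.
move=> /fin_genP [I [g gP]] [J [a [b ab]]].
apply/fin_genP; exists (J * I)%type, (fun k => a k.1 (g k.2)) => x.
have [c cP] := choice (fun j => gP (b j x)).
exists (fun k => c k.1 k.2).
rewrite -(pair_bigA _ (fun j i => c j i *: a j (g i))) /= [LHS]ab.
apply: eq_bigr => j _; rewrite [in LHS]cP linear_sum.
by apply: eq_bigr => i _; rewrite linearZ.
Qed.

Lemma filtered_imp (S S' : lmodType A -> Prop) X :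
  (forall Y, S Y -> S' Y) -> filtered S X -> filtered S' X.
Proof.
move=> SS; elim=> [Y|X' Y X'' u g _ F SX se]; first exact: filtered_zero.
exact: filtered_step F (SS _ SX) se.
Qed.

Lemma filtered1 (S : lmodType A -> Prop) X : S X -> filtered S X.
Proof.
move=> SX.
have Z : zero_mod {ffun void -> X} by move=> z; apply/ffunP => -[].
apply: (filtered_step (f := zerol {ffun void -> X} X) (g := idl X) (filtered_zero _ Z) SX).
split=> [x y _|x|x]; [by rewrite (Z x) (Z y) | | by exists x].
by split=> [/= ->|[y <-] //]; exists 0.
Qed.

End Extensions.

(** * Restriction of scalars and tensor products with projectives *)

Section Restrict.
Variables (R : comPzRingType) (A : ralgType R).
Implicit Types M N X Y Z D T : lmodType A.

Lemma res_scaleE M (r : R) (x : res M) : r *: x = (alg_map r : A) *: (x : M).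
Proof. by []. Qed.

Lemma resl_linear X Y (f : {linear X -> Y}) : linear (f : res X -> res Y).
Proof. by move=> r x y; rewrite !res_scaleE; exact: (linearP f). Qed.
Definition resl X Y (f : {linear X -> Y}) : {linear res X -> res Y} :=
  mklin (resl_linear f).

Lemma short_exact_res X Y Z (f : {linear X -> Y}) (g : {linear Y -> Z}) :
  short_exact f g -> short_exact (resl f) (resl g).
Proof. by []. Qed.

Lemma radd_res M X : radd M X -> radd (res M) (res X).
Proof.
by move=> [I [a [b ab]]]; exists I, (fun i => resl (a i)), (fun i => resl (b i)).
Qed.

Lemma fin_gen_res M : fin_gen (res M) -> fin_gen M.
Proof.
move=> [n [g gP]]; exists n, g => m; have [c cP] := gP m.
by exists (fun i => alg_map (c i)).
Qed.

Lemma latticeP M : lattice M <-> fgp (res M).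
Proof.
by split=> [[]//|fM]; split=> //; case: fM => /fin_gen_res.
Qed.

End Restrict.

Section HomRestrict.
Variables (R : comPzRingType) (A : ralgType R).
Implicit Types M N X Y Z D T : lmodType A.

Lemma scl_linear M (r : R) : linear (fun x : M => (alg_map r : A) *: x).
Proof.
move=> a x y; rewrite scalerDr !scalerA; congr (_ *: _ + _).
exact: alg_map_central.
Qed.
Definition scl M (r : R) : {linear M -> M} := mklin (@scl_linear M r).

Lemma central_scale (r : R) (a : A) M (x : M) :
  (alg_map r : A) *: (a *: x) = a *: ((alg_map r : A) *: x).
Proof. by rewrite !scalerA alg_map_central. Qed.

(** By construction [R] acts on [homm M N] by precomposition with homotheties of [M]; linearity of
    [f] moves the scalar to the values. *)
Lemma res_hommE M N (r : R) (f : res (homm M N)) (x : M) :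
  (r *: f : homm M N) x = (alg_map r : A) *: (f : homm M N) x.
Proof. exact: (linearZ_LR (f : homm M N)). Qed.

Definition precomp_fun M M' N (u : {linear M' -> M}) (f : res (homm M N)) :
  res (homm M' N) := (compl (f : homm M N) u : homm M' N).
Fact precomp_linear M M' N (u : {linear M' -> M}) : linear (@precomp_fun M M' N u).
Proof.
move=> r f g; apply: linear_ext => x.
transitivity ((alg_map r : A) *: (f : homm M N) (u x) + (g : homm M N) (u x)).
  by congr (_ + _); apply: (res_hommE r f).
by congr (_ + _); symmetry; apply: (res_hommE r (precomp_fun u f)).
Qed.
Definition precomp M M' N (u : {linear M' -> M}) :
  {linear res (homm M N) -> res (homm M' N)} := mklin (@precomp_linear M M' N u).

Definition postcomp M N N' (u : {linear N -> N'}) :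
  {linear res (homm M N) -> res (homm M N')} := resl (A := (Endo M)^c) (hom_map M u).

Lemma homm_sumE M N (I : finType) (F : I -> homm M N) x :
  (\sum_i F i : homm M N) x = \sum_i F i x.
Proof.
apply: (big_morph (fun f : homm M N => f x)) => //.
Qed.

Lemma hom_fgp_radd_r M N X : radd N X -> fgp (res (homm M N)) -> fgp (res (homm M X)).
Proof.
move=> [I [a [b ab]]] F; apply: (fgp_radd F).
exists I, (fun i => postcomp M (a i)), (fun i => postcomp M (b i)) => f.
by apply: linear_ext => x; rewrite homm_sumE; apply: ab.
Qed.

Lemma hom_fgp_radd_l M X N : radd M X -> fgp (res (homm M N)) -> fgp (res (homm X N)).
Proof.
move=> [I [a [b ab]]] F; apply: (fgp_radd F).
exists I, (fun i => precomp N (b i)), (fun i => precomp N (a i)) => f.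
apply: linear_ext => x; rewrite homm_sumE /= [in LHS](ab x) (linear_sum f).
by apply: eq_bigr.
Qed.

Lemma hom_fgp_ext_r M N' N N'' (f : {linear N' -> N}) (g : {linear N -> N''}) :
  short_exact f g -> Ext1_zero M N' -> fgp (res (homm M N')) -> fgp (res (homm M N'')) ->
  fgp (res (homm M N)).
Proof.
move=> se E; apply: (@fgp_ext _ _ _ _ (postcomp M f) (postcomp M g)).
have [fi fg gs] := se; split.
- move=> u v e; apply: linear_ext => x; apply: fi.
  exact: (congr1 (fun w : homm M N => w x) e).
- move=> u; split=> [e|[v <-]].
    have [|w wK] := factor_inj (h := u) fi.
      by move=> x; apply/fg; exact: (congr1 (fun w : homm M N'' => w x) e).
    by exists w; apply: linear_ext.
  by apply: linear_ext => x; exact: (exact_comp0 fg ((v : homm M N') x)).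
by move=> u; have [v vK] := Ext1_lift u se E; exists v; apply: linear_ext.
Qed.

Lemma hom_fgp_ext_l M' M M'' N (f : {linear M' -> M}) (g : {linear M -> M''}) :
  short_exact f g -> Ext1_zero M'' N -> fgp (res (homm M' N)) -> fgp (res (homm M'' N)) ->
  fgp (res (homm M N)).
Proof.
move=> se E F' F''; apply: (@fgp_ext _ _ _ _ (precomp N g) (precomp N f)) F'' F'.
have [fi fg gs] := se; split.
- move=> u v e; apply: linear_ext => x; have [y <-] := gs x.
  exact: (congr1 (fun w : homm M N => w y) e).
- move=> u; split=> [e|[v <-]].
    have [|w wK] := factor_surj (h := u) gs.
      by move=> x /fg [y <-]; exact: (congr1 (fun w : homm M' N => w y) e).
    by exists w; apply: linear_ext.
  apply: linear_ext => x /=; rewrite (exact_comp0 fg); exact: (linear0 v).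
by move=> u; have [v vK] := E _ _ _ _ se u; exists v; apply: linear_ext.
Qed.

Lemma hom_fgp_zero M N : hom0 M N -> fgp (res (homm M N)).
Proof. by move=> Z; apply: fgp_zero => f; apply: linear_ext => x; exact: Z. Qed.

Lemma filtered_lattice (S : lmodType A -> Prop) X :
  (forall Y, S Y -> lattice Y) -> filtered S X -> lattice X.
Proof.
move=> SL FX; apply/latticeP; elim: FX => [Y Y0|X' Y X'' f g _ F' SX se].
  exact: fgp_zero.
apply: (fgp_ext (short_exact_res se) F').
exact/latticeP/SL.
Qed.

End HomRestrict.

Section Tensor.
Variables (R : comPzRingType).

Definition mkadd (V W : zmodType) (f : V -> W) (fz : zmod_morphism f) : {additive V -> W} :=
  HB.pack f (GRing.isZmodMorphism.Build V W f fz).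

Lemma balanced_sum (M N : lmodType R) (Z : zmodType) (b : M -> N -> Z) (I : finType)
  m (F : I -> N) : balanced b -> b m (\sum_i F i) = \sum_i b m (F i).
Proof. by move=> [_ bz _]; apply: (raddf_sum (mkadd (bz m))). Qed.

Variable A : ralgType R.
Implicit Types D X Y T : lmodType A.

Lemma tensor_ext (M N : lmodType R) (P Z : zmodType) (b : M -> N -> P) (f g : P -> Z) :
  is_tensor b -> zmod_morphism f -> zmod_morphism g ->
  (forall m n, f (b m n) = g (b m n)) -> f =1 g.
Proof.
move=> [bb univ] fz gz fg.
have c_bal : balanced (fun m n => f (b m n)).
  case: bb => bl br bs; split=> [n x y|m x y|r m n]; last by rewrite bs.
    by rewrite bl fz.
  by rewrite br fz.
have [_ U] := univ _ _ c_bal.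
exact: (U (mkadd fz) (mkadd gz) fg).
Qed.

Section Coordinates.
Variables (U : lmodType R) (I : finType) (u : I -> U) (f : I -> {linear U -> R^o}).
Hypothesis uf : dual_basis u f.

(** A dual basis of [U] gives coordinates on the tensor product: [e i] is [f i] applied to the
    second factor. Arguments on twisted modules use these coordinates in place of the universal
    property. *)
Lemma tensor_coords D X (b : res D -> U -> X) :
  is_tensor b -> (forall (a : A) (d : D) v, b (a *: d) v = a *: b d v) ->
  exists e : I -> {linear X -> D},
    (forall x, x = \sum_i b (e i x) (u i)) /\
    (forall i d v, e i (b d v) = (alg_map (f i v : R) : A) *: (d : D)).
Proof.
move=> bt bA; have [bb univ] := bt; have [bl br bs] := bb.
have H i : exists e : {linear X -> D},
    forall d v, e (b d v) = (alg_map (f i v : R) : A) *: (d : D).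
  pose c (d : res D) (v : U) : D := (alg_map (f i v : R) : A) *: (d : D).
  have cb : balanced c.
    split=> [v x y|d x y|r d v]; rewrite /c.
    - exact: scalerBr.
    - by rewrite linearB raddfB scalerBl.
    - have -> : f i (r *: v) = r * f i v by rewrite linearZ.
      by rewrite rmorphM res_scaleE scalerA alg_map_central.
  have [[h hK] _] := univ _ _ cb.
  (* The universal property yields only an additive map; linearity over [A] is tested on pure
     tensors. *)
  have hl : linear h.
    move=> a x y; rewrite raddfD; congr (_ + _).
    move: x; apply: (tensor_ext bt); first by move=> x y'; rewrite scalerBr raddfB.
      by move=> x y'; rewrite raddfB scalerBr.
    by move=> d v; rewrite -bA !hK /c central_scale.
  by exists (mklin hl) => d v; rewrite mklinE hK.
have [e eP] := choice H; exists e; split=> // x.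
move: x; apply: (tensor_ext bt) => [//|x y|d v].
  rewrite -sumrB; apply: eq_bigr => i _; rewrite linearB.
  exact: bl.
rewrite [in LHS](uf v) (balanced_sum _ _ bb); apply: eq_bigr => i _.
by rewrite eP -bs res_scaleE.
Qed.

(** Converse of [tensor_coords]: a balanced map [c] is extended by sending [x] to the sum of the
    [c (e i x) (u i)], and the coordinates make this the only choice. *)
Lemma tensor_of_coords D X (b : res D -> U -> X) (e : I -> {linear X -> D}) :
  balanced b -> (forall (a : A) (d : D) v, b (a *: d) v = a *: b d v) ->
  (forall x, x = \sum_i b (e i x) (u i)) ->
  (forall i d v, e i (b d v) = (alg_map (f i v : R) : A) *: (d : D)) ->
  is_tensor_mod D U X.
Proof.
move=> bb bA be eb; exists b; split=> //; split=> // Z c cb.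
have [cl _ cs] := cb.
split=> [|h h' hh x]; last first.
  by rewrite (be x) !raddf_sum; apply: eq_bigr => i _; apply: hh.
have hz : zmod_morphism (fun x : X => \sum_i c (e i x) (u i)).
  move=> x y; rewrite -sumrB; apply: eq_bigr => i _; rewrite linearB.
  exact: cl.
exists (mkadd hz) => d v /=; rewrite [in RHS](uf v) (balanced_sum _ _ cb).
by apply: eq_bigr => i _; rewrite eb -cs.
Qed.

End Coordinates.

Lemma tensor_slice_linear (U : lmodType R) D X (b : res D -> U -> X) v :
  balanced b -> (forall (a : A) (d : D) w, b (a *: d) w = a *: b d w) ->
  linear (fun d : D => b d v).
Proof.
move=> [bl _ _] bA a x y; rewrite -bA.
exact: (raddfD (mkadd (bl v))).
Qed.

Lemma tensor_radd (U : lmodType R) D X : fgp U -> is_tensor_mod D U X -> radd D X.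
Proof.
move=> /fgpP [I [u [f uf]]] [b [bt bA]].
have [e [be _]] := tensor_coords uf bt bA.
by exists I, (fun i => mklin (tensor_slice_linear (u i) bt.1 bA)), e.
Qed.

End Tensor.

Section TensorHom.
Variables (R : comPzRingType) (A : ralgType R).
Implicit Types D X Y T : lmodType A.

(** Postcomposition with the coordinates of [X] gives coordinates of [homm T X], so
    [tensor_of_coords] applies. *)
Lemma tensor_hom (U : lmodType R) T D X : fgp U -> is_tensor_mod D U X ->
  is_tensor_mod (homm T D : lmodType (Endo T)^c) U (homm T X).
Proof.
move=> /fgpP [I [u [f uf]]] [b [bt bA]].
have [e [be eb]] := tensor_coords uf bt bA.
have bb := bt.1; have [bl br bs] := bb.
pose sl v := mklin (tensor_slice_linear v bb bA).
pose b' (g : res (homm T D)) (v : U) : homm T X := compl (sl v) (g : homm T D).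
apply: (tensor_of_coords uf (b := b') (e := fun i => hom_map T (e i))).
- split=> [v x y|g x y|r g v]; apply: linear_ext => t.
  + exact: bl.
  + exact: br.
  + transitivity (b ((alg_map r : A) *: (g : homm T D) t) v); last exact: bs.
    exact: (congr1 (b^~ v) (res_hommE r g t)).
- by move=> a g v; apply: linear_ext.
- by move=> g; apply: linear_ext => t; rewrite homm_sumE; apply: be.
- by move=> i g v; apply: linear_ext => t; rewrite /= eb; symmetry; apply: (linearZ_LR (g : homm T D)).
Qed.

Lemma pair_split (V W : zmodType) (v : V) (w : W) : (v, 0) + (0, w) = (v, w).
Proof. by apply: injective_projections; rewrite /= (addr0, add0r). Qed.

Lemma sum_pair1 (V W : zmodType) (I : finType) (F : I -> V) :
  \sum_i ((F i, 0) : (V * W)%type) = (\sum_i F i, 0).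
Proof.
by symmetry; apply: (big_morph (fun v : V => (v, 0 : W)));
  [move=> v w; apply: injective_projections; rewrite /= ?addr0 |].
Qed.

Lemma sum_pair2 (V W : zmodType) (I : finType) (F : I -> W) :
  \sum_i ((0, F i) : (V * W)%type) = (0, \sum_i F i).
Proof.
by symmetry; apply: (big_morph (fun w : W => (0 : V, w)));
  [move=> v w; apply: injective_projections; rewrite /= ?addr0 |].
Qed.

(** Serves to merge two filtration factors with the same index into one. *)
Lemma tensor_pair (U1 U2 : lmodType R) D X1 X2 : fgp U1 -> fgp U2 ->
  is_tensor_mod D U1 X1 -> is_tensor_mod D U2 X2 ->
  is_tensor_mod D (U1 * U2)%type (X1 * X2)%type.
Proof.
move=> /fgpP [I1 [u1 [f1 uf1]]] /fgpP [I2 [u2 [f2 uf2]]] [b1 [bt1 bA1]] [b2 [bt2 bA2]].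
have [e1 [be1 eb1]] := tensor_coords uf1 bt1 bA1.
have [e2 [be2 eb2]] := tensor_coords uf2 bt2 bA2.
have [bl1 br1 bs1] := bt1.1; have [bl2 br2 bs2] := bt2.1.
pose u (k : I1 + I2) : (U1 * U2)%type :=
  match k with inl i => (u1 i, 0) | inr i => (0, u2 i) end.
pose f (k : I1 + I2) : {linear (U1 * U2)%type -> R^o} :=
  match k with inl i => compl (f1 i) (fstl U1 U2) | inr i => compl (f2 i) (sndl U1 U2) end.
pose b (d : res D) (v : U1 * U2) := (b1 d v.1, b2 d v.2).
pose e (k : I1 + I2) : {linear (X1 * X2)%type -> D} :=
  match k with inl i => compl (e1 i) (fstl X1 X2) | inr i => compl (e2 i) (sndl X1 X2) end.
have b10 d : b1 d 0 = 0 by apply: (raddf0 (mkadd (br1 d))).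
have b20 d : b2 d 0 = 0 by apply: (raddf0 (mkadd (br2 d))).
apply: (tensor_of_coords (u := u) (f := f) _ (b := b) (e := e)).
- move=> [v w]; rewrite big_sumType /= [in LHS](uf1 v) [in LHS](uf2 w) -[LHS]pair_split.
  rewrite -sum_pair1 -sum_pair2; congr (_ + _); apply: eq_bigr => i _ /=.
    by apply: injective_projections => //=; rewrite scaler0.
  by apply: injective_projections => //=; rewrite scaler0.
- split=> [v x y|d x y|r d v]; rewrite /b.
  + by rewrite bl1 bl2.
  + by rewrite /= br1 br2.
  + by rewrite /= bs1 bs2.
- by move=> a d v; rewrite /b bA1 bA2.
- move=> [x y]; rewrite big_sumType /= [in LHS](be1 x) [in LHS](be2 y) -[LHS]pair_split.
  by rewrite -sum_pair1 -sum_pair2; congr (_ + _); apply: eq_bigr => i _; rewrite /b /= ?b10 ?b20.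
- by move=> [i|i] d [v w]; rewrite /= (eb1, eb2).
Qed.

Lemma tensor_zero D X : zero_mod X ->
  is_tensor_mod D {ffun void -> R^o} X.
Proof.
move=> X0; have U0 (v : {ffun void -> R^o}) : v = 0 by apply/ffunP => -[].
pose u (i : void) : {ffun void -> R^o} := match i with end.
pose f (i : void) : {linear {ffun void -> R^o} -> R^o} := match i with end.
pose e (i : void) : {linear X -> D} := match i with end.
apply: (tensor_of_coords (u := u) (f := f) _ (b := fun _ _ => 0) (e := e)).
- by move=> v; rewrite [LHS]U0 [RHS]U0.
- by split=> [v x y|d x y|r d v]; rewrite ?subrr.
- by move=> a d v; rewrite scaler0.
- by move=> x; rewrite [LHS]X0 [RHS]X0.
- by case.
Qed.

Lemma fgp_pair (B : pzRingType) (U V : lmodType B) : fgp U -> fgp V -> fgp (U * V)%type.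
Proof.
have se : short_exact (mkpairl (idl U) (zerol U V)) (sndl U V).
  split=> [x y [] //|[x y]|y]; last by exists (0, y).
  split=> /= [->|[z [_ <-]] //]; by exists x.
exact: fgp_ext se.
Qed.

End TensorHom.

(** * Resolutions and universal extensions *)

Section NoetherianAlgebra.
Variables (R : idomainType) (hR : noetherian R) (A : ralgType R).
Hypothesis hA : fin_gen (res A^o).
Implicit Types M N X Y Z D T C P : lmodType A.

Lemma fin_gen_ker X Y (f : {linear X -> Y}) : fin_gen (res X) -> fin_gen (res (kerm f)).
Proof. by apply: (noetherian_sub hR (i := resl (kerm_val f))); apply: kerm_val_inj. Qed.

Lemma fin_gen_free (I : finType) : fin_gen (res {ffun I -> A^o}).
Proof. exact: (fin_gen_radd hA (radd_res (radd_ffun A^o I))). Qed.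

Section Resolution.
Variable M : lmodType A.
Hypothesis fM : fin_gen (res M).

(** The recursion runs over modules bundled with finite generation over [R]: syzygies inherit it
    because [R] is noetherian, and it supplies the next free cover. *)
Let fgmod := {X : lmodType A | fin_gen (res X)}.
Let cover_ex (X : fgmod) := cid (fin_gen_presentation (fin_gen_res (svalP X))).
Let rank (X : fgmod) : nat := projT1 (cover_ex X).
Let cov_ex (X : fgmod) := cid (projT2 (cover_ex X)).
Let cov (X : fgmod) : {linear {ffun 'I_(rank X) -> A^o} -> sval X} := projT1 (cov_ex X).
Let cov_surj (X : fgmod) : surj (cov X) := projT2 (cov_ex X).
Let syzygy (X : fgmod) : fgmod :=
  exist _ (kerm (cov X) : lmodType A) (fin_gen_ker (cov X) (@fin_gen_free _)).
Let stage := fix stage n : fgmod :=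
  if n is k.+1 then syzygy (stage k) else exist _ M fM.
Let res_term n : lmodType A := {ffun 'I_(rank (stage n)) -> A^o}.
Let res_diff n : {linear res_term n.+1 -> res_term n} :=
  compl (kerm_val (cov (stage n))) (cov (stage n.+1)).

Lemma free_resolution : exists P : chain M, proj_resolution P.
Proof.
exists (Chain (term := res_term) res_diff (cov (stage 0) : {linear res_term 0 -> M})).
have ex0 n : exact_at (res_diff n) (cov (stage n)).
  move=> y; rewrite (kerm_exact (cov (stage n)) y); split=> -[x <-].
    by have [z <-] := @cov_surj (stage n.+1) x; exists z.
  by exists (cov (stage n.+1) x).
split=> [i|n]; first exact: free_projective.
split=> [_|_|i _]; [exact: cov_surj | exact: (ex0 0) |].
move=> y; rewrite -(ex0 i.+1 y); split=> e.
  by apply: (@kerm_val_inj _ _ _ (cov (stage i))); rewrite linear0; exact: e.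
rewrite -[LHS]/(kerm_val (cov (stage i)) (cov (stage i.+1) y)).
by rewrite -[RHS](linear0 (kerm_val (cov (stage i)))); congr (kerm_val _ _); exact: e.
Qed.
End Resolution.

Lemma Ext_zero_of_Ext1 M N : fin_gen (res M) -> Ext1_zero M N -> Ext_zero 1 M N.
Proof.
by move=> fM E; have [P rP] := free_resolution fM; exact: Ext_zero_of_resolution rP E.
Qed.

(** A map is determined by its values on generators [u] of [C], so Hom(C, X) embeds in a finite
    power of [X], in which the tuples of values form a submodule [S], finitely generated over
    [R]. *)
Lemma hom_fin_gen C X : fin_gen C -> fin_gen (res X) ->
  exists n (g : 'I_n -> {linear C -> X}), forall h : {linear C -> X},
    exists r : 'I_n -> R, forall c, h c = \sum_i (alg_map (r i) : A) *: g i c.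
Proof.
move=> [m [u uP]] fX.
have [n [e eP]] : fin_gen {ffun 'I_m -> res X}.
  exact: (fin_gen_radd fX (radd_ffun (res X) 'I_m)).
pose S (z : {ffun 'I_m -> res X}) := exists h : {linear C -> X}, forall j, z j = h (u j).
have [|z _|I [k [kS kG]]] := @submodule_span_fg R hR _ _ e S; last 1 first.
- have [g gP] := choice kS.
  exists #|I|, (fun i => g (enum_val i)) => h.
  have [|r rP] := kG [ffun j => (h (u j) : res X)].
    by exists h => j; rewrite ffunE.
  exists (fun i => r (enum_val i)) => c; have [a ->] := uP c.
  rewrite [LHS]linear_sum -(sum_enum_val (fun i => (alg_map (r i) : A) *: g i (\sum_j a j *: u j))).
  transitivity (\sum_j \sum_i a j *: ((alg_map (r i) : A) *: g i (u j))).
    apply: eq_bigr => j _; rewrite linearZ /= -scaler_sumr; congr (_ *: _).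
    have := congr1 (fun z : {ffun 'I_m -> res X} => z j) rP.
    rewrite ffunE sum_ffunE => ->; apply: eq_bigr => i _.
    by rewrite ffunE gP.
  rewrite exchange_big /=; apply: eq_bigr => i _.
  rewrite linear_sum scaler_sumr; apply: eq_bigr => j _.
  by rewrite linearZ /= central_scale.
- split; first by exists (zerol C X) => j; rewrite ffunE.
  move=> r x y [h hP] [k kP]; exists (addl (compl (scl X r) h) k) => j.
  by rewrite !ffunE hP kP.
exact: eP.
Qed.

(* Push out a free presentation [C -> F -> M], [n] times, along generators
   [C -> X] of the [R]-module Hom(C, X). *)
Lemma universal_extension M X : fin_gen (res M) -> fin_gen (res X) -> Ext1_zero M M ->
  exists (n : nat) (E : lmodType A) (f : {linear X -> E}) (g : {linear E -> {ffun 'I_n -> M}}),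
    short_exact f g /\ Ext1_zero M E.
Proof.
move=> fM fX EM.
have [m [p ps]] := fin_gen_presentation (fin_gen_res fM).
have se := ker_short_exact ps.
set C := (kerm p : lmodType A); set F := ({ffun 'I_m -> A^o} : lmodType A).
pose i : {linear C -> F} := kerm_val p.
have [n [e eP]] := @hom_fin_gen C X (fin_gen_res (fin_gen_ker p (@fin_gen_free _))) fX.
(* The cokernel of this antidiagonal map is the pushout of the power of [i] along [summl e]. *)
pose phi : {linear {ffun 'I_n -> C} -> (X * {ffun 'I_n -> F})%type} :=
  mkpairl (summl e) (compl (scl {ffun 'I_n -> F} (-1)) (ffmap 'I_n i)).
have phi2 z : (phi z).2 = - ffmap 'I_n i z by rewrite /= rmorphN1 scaleN1r.
have [iin iex isu] := ffmap_short_exact 'I_n se.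
pose pi := coker_proj phi.
have piE := coker_exact phi.
pose f : {linear X -> coker phi} := compl pi (mkpairl (idl X) (zerol X {ffun 'I_n -> F})).
have [||g gK] := factor_surj (p := pi) (h := compl (ffmap 'I_n p) (sndl X {ffun 'I_n -> F})).
- exact: coker_proj_surj.
- move=> x /piE [z <-]; rewrite -[LHS]/(ffmap 'I_n p (phi z).2) phi2.
  by rewrite linearN (exact_comp0 iex) oppr0.
have seE : short_exact f g.
  split.
  - apply: inj0 => x /piE [z zx].
    have : ffmap 'I_n i z = 0.
      by apply/eqP; rewrite -oppr_eq0 -phi2 zx.
    rewrite -[X in _ = X -> _](linear0 (ffmap 'I_n i)) => /iin z0.
    by have := congr1 fst zx; rewrite z0 linear0.
  - move=> y; have [[x w] <-] := coker_proj_surj y; rewrite gK.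
    split=> [/iex [z zw]|[x' x'E]].
      exists (x + summl e z); rewrite -[LHS]/(pi (x + summl e z, 0)).
      apply/eqP; rewrite -subr_eq0 -linearB; apply/eqP/piE; exists z.
      apply: injective_projections; first by rewrite /= addrAC subrr add0r.
      by rewrite phi2 zw /= sub0r.
    rewrite -gK -[pi _]x'E -[f x']/(pi (x', 0)) gK.
    exact: linear0.
  - move=> z; have [w wz] := isu z; exists (pi (0, w)).
    by rewrite gK.
exists n, (coker phi), f, g; split=> //.
apply: (Ext1_of_presentation se (@free_projective _ _)) => h.
(* As [M] has no extensions by its own powers, [g h] extends to [F] and lifts to [v]; the remainder
   [h - v i] comes from [X] through [w]. *)
have EMn : Ext1_zero M {ffun 'I_n -> M} by apply: (Ext1_radd_r (radd_ffun M 'I_n)).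
have [u uK] := EMn _ _ _ _ se (compl g h).
have [fi fg gs] := seE.
have [v vK] := free_projective u gs.
have [|w wK] := factor_inj (h := subl h (compl v i)) fi.
  by move=> c; apply/fg; rewrite linearB /= vK uK subrr.
have [r rP] := eP w.
(* In the pushout, [f] after [e j] extends to [F] through the [j]-th summand; [w] is a combination
   of the [e j], so [f w] extends too. *)
pose q j : {linear F -> coker phi} := compl pi (compl (mkpairl (zerol _ X) (idl _)) (injl F j)).
exists (addl v (lsum (fun j => compl (scl _ (r j)) (q j)))) => c.
have -> : h c = v (i c) + f (w c) by rewrite wK /= addrC subrK.
congr (_ + _); rewrite rP linear_sum; apply: eq_bigr => j _.
rewrite -[LHS]/((alg_map (r j) : A) *: pi (0, delta j (i c))).
rewrite (linearZ_LR f) -[f _]/(pi (e j c, 0)); congr (_ *: _); symmetry.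
apply/eqP; rewrite -subr_eq0 -linearB; apply/eqP/piE; exists (delta j c).
apply: injective_projections.
  by rewrite -[LHS]/(summl e (delta j c)) summlE sum_delta /= subr0.
rewrite phi2 /= sub0r; congr (- _).
apply/ffunP => k; rewrite !ffunE /=; case: eqP => // _.
exact: linear0.
Qed.

End NoetherianAlgebra.

(** * Twists by free modules, and vanishing of Hom under twists *)

Section TensorExamples.
Variables (R : comPzRingType) (A : ralgType R).
Implicit Types D M N X Y : lmodType A.

Lemma tensor_ffun D (I : finType) : is_tensor_mod D {ffun I -> R^o} {ffun I -> D}.
Proof.
pose b (d : res D) (v : {ffun I -> R^o}) : {ffun I -> D} :=
  [ffun i => (alg_map (v i : R) : A) *: (d : D)].
apply: (tensor_of_coords (@free_dual_basis R I) (b := b) (e := fun i => projl D i)).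
- split=> [v x y|d x y|r d v]; apply/ffunP => i; rewrite !ffunE.
  + exact: scalerBr.
  + by rewrite raddfB scalerBl.
  + by rewrite res_scaleE -[r *: v i]/(r * v i) rmorphM scalerA alg_map_central.
- by move=> a d v; apply/ffunP => i; rewrite !ffunE central_scale.
- move=> x; rewrite [LHS]ffun_decomp; apply: eq_bigr => i _; apply/ffunP => j.
  by rewrite !ffunE; case: eqP => _; rewrite ?rmorph1 ?scale1r ?rmorph0 ?scale0r.
- by move=> i d v; rewrite /= ffunE.
Qed.

Lemma tensor_unit D : is_tensor_mod D R^o D.
Proof.
pose b (d : res D) (v : R^o) : D := (alg_map (v : R) : A) *: (d : D).
pose u (_ : unit) : R^o := 1.
apply: (tensor_of_coords (u := u) (f := fun=> idl R^o) _ (b := b) (e := fun=> idl D)).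
- move=> v; rewrite (big_pred1 tt) /=; last by case.
  by rewrite /u -[RHS]/(v * 1) mulr1.
- split=> [v x y|d x y|r d v].
  + exact: scalerBr.
  + by rewrite /b raddfB scalerBl.
  + by rewrite /b res_scaleE -[r *: v]/(r * v) rmorphM scalerA alg_map_central.
- by move=> a d v; rewrite /b central_scale.
- move=> x; rewrite (big_pred1 tt) /=; last by case.
  by rewrite /b /u rmorph1 scale1r.
- by [].
Qed.

Lemma fgp_free (I : finType) : fgp ({ffun I -> R^o} : lmodType R).
Proof. by apply/fgp_radd_free/radd_ffun. Qed.

Lemma fgp_unit : fgp (R^o : lmodType R).
Proof. exact/fgp_radd_free/radd_refl. Qed.

Lemma hom0_tensor_l (U : lmodType R) D X N :
  is_tensor_mod D U X -> hom0 D N -> hom0 X N.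
Proof.
move=> [b [bt bA]] D0 f; have [[bl br bs] _] := bt.
apply: (tensor_ext bt) => [x y|x y|d v]; rewrite ?subrr ?linearB //.
exact: (D0 (compl f (mklin (tensor_slice_linear v bt.1 bA)))).
Qed.

Lemma hom0_radd_r M N X : radd N X -> hom0 M N -> hom0 M X.
Proof.
move=> [I [a [b ab]]] N0 f x; rewrite [LHS]ab big1 // => i _.
have -> : b i (f x) = 0 by exact: (N0 (compl (b i) f)).
exact: linear0.
Qed.

End TensorExamples.

(** * Duality over the base ring *)

Section Duality.
Variables (R : comPzRingType) (A : ralgType R).
Implicit Types M N X Y F : lmodType A.

Definition dmap_fun X Y (u : {linear X -> Y}) (f : dual Y) : dual X :=
  (compl (f : homm (res Y) R^o) (resl u) : homm (res X) R^o).
Fact dmap_linear X Y (u : {linear X -> Y}) : linear (dmap_fun u).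
Proof.
move=> a f g; apply: linear_ext => x.
rewrite -[LHS]/((f : homm (res Y) R^o) ((a : A) *: u x) + (g : homm (res Y) R^o) (u x)).
by rewrite -linearZ.
Qed.
Definition dmap X Y (u : {linear X -> Y}) : {linear dual Y -> dual X} :=
  mklin (@dmap_linear X Y u).

Definition ev M (f : dual M) (x : M) : R := (f : homm (res M) R^o) x.

Lemma ev_sum M (I : finType) (F : I -> dual M) x : ev (\sum_i F i) x = \sum_i ev (F i) x.
Proof. exact: (big_morph (fun f : dual M => ev f x)). Qed.

Lemma ev_scale M (r : R) (f : dual M) (x : M) :
  ev ((alg_map r : A^c) *: f) x = r * ev f x.
Proof. exact: (linearZ_LR (f : homm (res M) R^o)). Qed.

Lemma ev_lin M (f : dual M) (I : finType) (r : I -> R) (x : I -> M) :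
  ev f (\sum_i (alg_map (r i) : A) *: x i) = \sum_i r i * ev f (x i).
Proof.
transitivity (\sum_i (f : homm (res M) R^o) (r i *: (x i : res M))).
  exact: (linear_sum (f : homm (res M) R^o)).
by apply: eq_bigr => i _; apply: (linearZ_LR (f : homm (res M) R^o)).
Qed.

Lemma ev_sep M (x y : M) : fgp (res M) -> (forall f : dual M, ev f x = ev f y) -> x = y.
Proof.
move=> /fgpP [I [g [f gf]]] e; rewrite (gf x) (gf y).
by apply: eq_bigr => i _; rewrite [f i x : R](e (f i)).
Qed.

(* A projective presentation of [D N] over [A^op] such that [Hom(K, D M) = 0]
   gives Ext^1(D N, D M) = 0, which is Ext^1(M, N) = 0 for [R]-projective modules. *)
Lemma Ext1_dual M N (K Q : lmodType A^c) (k : {linear K -> Q}) (q : {linear Q -> dual N}) :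
  fgp (res A^o) -> fin_gen M -> fgp (res M) -> fgp (res N) ->
  short_exact k q -> projective Q -> hom0 K (dual M : lmodType A^c) -> Ext1_zero M N.
Proof.
move=> fA /fin_gen_presentation [n [p ps]] fM fN [ki kq qs] pQ K0.
have [F [C [i [p' [se pF]]]]] : exists (F C : lmodType A) (i : {linear C -> F})
    (p' : {linear F -> M}), short_exact i p' /\ projective F.
  exists {ffun 'I_n -> A^o}, (kerm p), (kerm_val p), p.
  by split; [apply: ker_short_exact | apply: free_projective].
apply: (Ext1_of_presentation se pF) => h.
move: {p ps} p' se => p se.
have [ii ip ps] := se.
(* [M] is projective over [R], so the presentation splits over [R] and restriction of functionals
   from [F] to [C] is onto. *)
have [s sK] := fM.2 _ _ (resl p) (idl _) ps.
have [rho [_ rhoK]] := short_exact_split (short_exact_res se) sK.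
have dis : surj (dmap i).
  move=> f; exists (compl (f : homm (res C) R^o) rho : homm (res F) R^o).
  by apply: linear_ext => c; rewrite -[LHS]/((f : homm (res C) R^o) (rho (resl i c))) rhoK.
have [w wK] := pQ _ _ (dmap i) (compl (dmap h) q) dis.
(* On [K], the values of [w] are functionals that vanish on [C], hence elements of [dual M], into
   which [K] has no nonzero maps. *)
have wk z : w (k z) = 0.
  have dpi : injective (dmap p).
    move=> f g e; apply: linear_ext => x; have [y <-] := ps x.
    exact: (congr1 (fun v : homm (res F) R^o => v y) e).
  have [|t tK] := factor_inj (h := compl w k) dpi.
    move=> y; have e : dmap i (w (k y)) = 0.
      by rewrite wK -[LHS]/(dmap h (q (k y))) (exact_comp0 kq) linear0.
    have [|v vK] := factor_surj (p := resl p) (h := (w (k y) : homm (res F) R^o)) ps.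
      move=> x /ip [c <-].
      exact: (congr1 (fun v : homm (res C) R^o => v c) e).
    by exists (v : homm (res M) R^o); apply: linear_ext.
  by rewrite -[LHS]tK K0 linear0.
have [|w' w'K] := factor_surj (p := q) (h := w) qs.
  by move=> x /kq [z <-]; exact: wk.
have w'i (xi : dual N) c : ev (w' xi) (i c) = ev xi (h c).
  have [x <-] := qs xi; rewrite w'K.
  exact: (congr1 (fun v : homm (res C) R^o => v c) (wK x)).
have /fgpP [I [g [f gf]]] := fN.
(* [k0] is the transpose of [w'] under the identification of [N] with its double dual, written in a
   dual basis of [N]. *)
pose k0 (x : F) : N := \sum_i (alg_map (ev (w' (f i : dual N)) x) : A) *: g i.
have k0E (xi : dual N) x : ev xi (k0 x) = ev (w' xi) x.
  have xiE : xi = \sum_i (alg_map (ev xi (g i)) : A^c) *: (f i : dual N).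
    apply: linear_ext => y; rewrite -[LHS]/(ev xi y) -[RHS]/(ev _ (y : N)) ev_sum.
    rewrite [in LHS](gf y) ev_lin; apply: eq_bigr => j _.
    by rewrite ev_scale mulrC.
  rewrite [in RHS]xiE linear_sum ev_sum /k0 ev_lin; apply: eq_bigr => j _.
  by rewrite linearZ ev_scale mulrC.
have k0l : linear k0.
  move=> a x y; apply: (ev_sep fN) => xi; rewrite k0E.
  rewrite -[LHS]/(ev (w' xi) (a *: x + y)).
  have -> : ev (w' xi) (a *: x + y) = ev ((a : A^c) *: w' xi) x + ev (w' xi) y.
    exact: (linearD (w' xi : homm (res F) R^o)).
  rewrite -linearZ -!k0E; symmetry.
  exact: (linearD (xi : homm (res N) R^o)).
exists (mklin k0l) => c; apply: (ev_sep fN) => xi.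
by rewrite mklinE k0E w'i.
Qed.

End Duality.

(** * Tilting modules with a prescribed top costandard factor *)

Section Standard.
Variables (R : comPzRingType) (A : ralgType R).
Variables (d : Order.disp_t) (L : finPOrderType d) (Delta : L -> lmodType A).
Hypothesis qh : split_qh Delta.
Implicit Types l m : L.

Lemma standard_hom0 l m : ~~ (l <= m)%O -> hom0 (Delta l) (Delta m).
Proof.
move=> lm f x; apply/eqP/negPn/negP => fx.
by move/negP: lm; apply; apply: (qh_order qh); exists f, x.
Qed.

(** The kernel [C] has factors twisted from [Delta n] with [n > l]; a nonzero map from one of them
    to [Delta m] would force [l < n <= m]. *)
Lemma standard_presentation l m : ~~ (l < m)%O ->
  exists (C P : lmodType A) (f : {linear C -> P}) (g : {linear P -> Delta l}),
    [/\ short_exact f g, projective P & hom0 C (Delta m)].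
Proof.
move=> lm; have [P [PP _]] := qh_progen qh.
have [[_ pP] [C [f [g [se FC]]]]] := PP l.
exists C, (P l), f, g; split=> //.
apply: (hom0_filtered_l _ FC) => X [n [U [ln _ t]]].
apply: (hom0_tensor_l t); apply: standard_hom0.
by apply: contra lm => nm; apply: Order.POrderTheory.lt_le_trans nm.
Qed.

Lemma Ext1_standard l m : ~~ (l < m)%O -> Ext1_zero (Delta l) (Delta m).
Proof.
move=> /standard_presentation [C [P [f [g [se pP C0]]]]].
apply: (Ext1_of_presentation se pP) => h; exists (zerol P (Delta m)) => c.
by rewrite C0.
Qed.

Lemma twist_lattice (I : Type) (S : pred I) (D : I -> lmodType A) X :
  (forall i, fgp (res (D i))) -> twists S D X -> lattice X.
Proof.
move=> lD [i [U [_ fU t]]]; apply/latticeP.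
exact: (fgp_radd (lD i) (radd_res (tensor_radd fU t))).
Qed.

Lemma twist_ffun (I : Type) (S : pred I) (D : I -> lmodType A) i n : S i ->
  twists S D {ffun 'I_n -> D i}.
Proof.
move=> Si; exists i, {ffun 'I_n -> R^o}; split=> //.
  exact: fgp_free.
exact: tensor_ffun.
Qed.

Lemma twist_self (I : Type) (S : pred I) (D : I -> lmodType A) i : S i -> twists S D (D i).
Proof.
by move=> Si; exists i, R^o; split; [| apply: fgp_unit | apply: tensor_unit].
Qed.

Lemma twist_imp (I : Type) (S S' : pred I) (D : I -> lmodType A) X :
  (forall i, S i -> S' i) -> twists S D X -> twists S' D X.
Proof. by move=> SS [i [U [/SS Si fU t]]]; exists i, U. Qed.

End Standard.

Section Costandard.
Variables (R : idomainType) (hR : noetherian R) (A : ralgType R).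
Variables (d : Order.disp_t) (L : finPOrderType d) (Delta nabla : L -> lmodType A).
Hypotheses (qh : split_qh Delta) (cs : costandard Delta nabla).
Implicit Types l m n : L.
Implicit Types M N X Y : lmodType A.

Let fA : fgp (res A^o) := qh_alg qh.

(** The presentation is that of the standard module [dual (nabla l)] over the opposite algebra;
    [Ext1_dual] interchanges the two arguments. *)
Lemma Ext1_costandard l m : ~~ (l < m)%O -> Ext1_zero (nabla m) (nabla l).
Proof.
move=> lm; have [K [Q [k [q [se pQ K0]]]]] := standard_presentation (cs_op cs) lm.
have [gm fm] := cs_lattice cs m; have [_ fl] := cs_lattice cs l.
exact: Ext1_dual fA gm fm fl se pQ K0.
Qed.

Lemma Ext1_Filt M N : Filt (tilde Delta) M -> Filt (tilde nabla) N -> Ext1_zero M N.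
Proof.
by move=> FM /(cs_filt cs) [_ /(_ M FM)]; apply: Ext1_of_Ext_zero.
Qed.

Lemma nabla_fgp l : fgp (res (nabla l)).
Proof. by case: (cs_lattice cs l). Qed.

Lemma Delta_fin_gen l : fin_gen (Delta l).
Proof. exact/fin_gen_res/(qh_proj qh l).1. Qed.

(** [cs_filt] tests against all standardly filtered modules; filtrations and twists reduce this to
    the standard modules. *)
Lemma Filt_nablaI X : lattice X -> (forall l, Ext1_zero (Delta l) X) -> Filt (tilde nabla) X.
Proof.
move=> lX E; apply/(cs_filt cs); split=> // M [lM FM].
apply: (Ext_zero_of_Ext1 hR fA.1); first by case/latticeP: lM.
apply: (Ext1_filtered_l _ FM) => Y [l [U [_ fU t]]].
exact: (Ext1_radd_l (Delta_fin_gen l) (tensor_radd fU t)).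
Qed.

Lemma filtered_nabla (S : pred L) X : filtered (twists S nabla) X -> Filt (tilde nabla) X.
Proof.
move=> FX; split.
  by apply: (filtered_lattice _ FX) => Y; apply: twist_lattice nabla_fgp.
by apply: (filtered_imp _ FX) => Y; apply: twist_imp.
Qed.

Lemma filtered_Delta (S : pred L) X : filtered (twists S Delta) X -> Filt (tilde Delta) X.
Proof.
move=> FX; split.
  by apply: (filtered_lattice _ FX) => Y; apply: twist_lattice (qh_proj qh).
by apply: (filtered_imp _ FX) => Y; apply: twist_imp.
Qed.

Lemma Filt_Delta_standard l : Filt (tilde Delta) (Delta l).
Proof. exact/(@filtered_Delta predT)/filtered1/twist_self. Qed.

Lemma Ext1_Delta_nabla l N : Filt (tilde nabla) N -> Ext1_zero (Delta l) N.
Proof. exact: Ext1_Filt (Filt_Delta_standard l). Qed.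

Lemma standard_scalar l (v : {linear Delta l -> Delta l}) :
  exists r : R, forall x, v x = (alg_map r : A) *: x.
Proof.
have [f [[g fg gf] fr]] := qh_end qh l.
exists (f (v : Endo (Delta l))) => x.
have e : (v : Endo (Delta l)) = alg_map (f (v : Endo (Delta l)) : R).
  by apply: (can_inj fg); rewrite fr.
exact: (congr1 (fun w : homm (Delta l) (Delta l) => w x) e).
Qed.

Lemma standard_faithful l (r : R) :
  (forall x : Delta l, (alg_map r : A) *: x = 0) -> r = 0.
Proof.
move=> r0; have [f [fb fr]] := qh_end qh l.
have e : alg_map r = 0 :> Endo (Delta l) by apply: linear_ext => x; apply: r0.
by rewrite -[r]/(alg_map r : R^o) -fr e rmorph0.
Qed.

Lemma costandard_generator l : exists ga : {linear Delta l -> nabla l},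
  (forall u : {linear Delta l -> nabla l},
     exists r : R, forall x, u x = (alg_map r : A) *: ga x) /\
  (forall r : R, (forall x, (alg_map r : A) *: ga x = 0) -> r = 0).
Proof.
have [th [th' thK th'K]] := cs_hom cs l.
pose ga : homm (Delta l) (nabla l) := th' 1.
have thZ (r : R) : th (r *: (ga : res (homm (Delta l) (nabla l)))) = r.
  by rewrite linearZ /= th'K -[LHS]/(r * 1) mulr1.
exists ga; split=> [u|r r0].
  exists (th (u : homm (Delta l) (nabla l))) => x; rewrite -(res_hommE _ ga).
  apply: (congr1 (fun v : homm (Delta l) (nabla l) => v x)).
  by apply: (can_inj thK); rewrite thZ.
rewrite -[LHS]thZ -[RHS](linear0 th); congr (th _).
by apply: linear_ext => x; rewrite (res_hommE r ga) r0.
Qed.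

(* Universal extensions by [Delta m], [m < l], with [m] minimal among the indices
   treated so far: then the vanishing already achieved is not destroyed. *)
Lemma tilting_extension l (k : nat) (S : {set L}) : #|S| = k ->
  (forall m, m \in S -> (m < l)%O) ->
  exists (E : lmodType A) (j : {linear Delta l -> E}),
  [/\ injective j,
      forall u : {linear Delta l -> E}, exists v : {linear Delta l -> Delta l},
        forall x, u x = j (v x),
      filtered (twists (fun m => (m <= l)%O) Delta) E
    & forall m, m \in S -> Ext1_zero (Delta m) E].
Proof.
elim: k S => [|k IH] S cS Sl.
  exists (Delta l), (idl _); split=> //.
  - by move=> u; exists u.
  - by apply/filtered1/twist_self/Order.POrderTheory.lexx.
  - by move=> m; rewrite (cards0_eq cS) inE.
have [m0 m0S] : exists m, m \in S by apply/card_gt0P; rewrite cS.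
(* The number of indices strictly below is strictly increasing, so an index of [S] with the least
   value is minimal in [S]. *)
pose ht m := #|[set n | (n < m)%O]|.
have [m mS mmin] : exists2 m, m \in S & forall n, n \in S -> (ht m <= ht n)%N.
  by case: (arg_minnP ht m0S) => m; exists m.
have [||E [j [ji ju FE EE]]] := IH (S :\ m).
- by move: cS; rewrite (cardsD1 m S) (mS : m \in S) => -[].
- by move=> n; rewrite !inE => /andP [_ /Sl].
have [lE _] := filtered_Delta FE.
have [n [E' [f [g [se E'm]]]]] := universal_extension hR fA.1 (qh_proj qh m).1
  (proj1 ((latticeP E).1 lE)) (Ext1_standard qh (negbT (Order.POrderTheory.ltxx m))).
have [fi fg gs] := se.
have ml := Sl _ mS.
exists E', (compl f j); split.
- by move=> x y /fi /ji.
(* As [m < l], there is no nonzero map from [Delta l] to [Delta m], so maps from [Delta l] to the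
   larger module still factor through [j]. *)
- move=> u; have u0 : forall x, g (u x) = 0.
    have := @hom0_radd_r _ _ (Delta l) _ _ (radd_ffun (Delta m) 'I_n).
    move=> /(_ (standard_hom0 qh _)) h0 x.
    by apply: (h0 _ (compl g u)); rewrite (Order.POrderTheory.lt_geF ml).
  have [|w wK] := factor_inj (h := u) fi; first by move=> x; apply/fg.
  by have [v vK] := ju w; exists v => x; rewrite -wK vK.
- apply: (filtered_step FE _ se); apply: twist_ffun.
  exact: Order.POrderTheory.ltW.
move=> p pS; have [->//|pm] := eqVneq p m.
apply: (Ext1_ext_r (Delta_fin_gen p) se); first by apply: EE; rewrite !inE pm.
apply: (Ext1_radd_r (radd_ffun _ _)); apply: (Ext1_standard qh).
apply/negP => pltm; have := mmin _ pS; rewrite leqNgt => /negP; apply.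
apply: proper_card; apply/properP; split.
  apply/subsetP => q; rewrite !inE => qp.
  exact: Order.POrderTheory.lt_trans qp pltm.
by exists p; rewrite inE // Order.POrderTheory.ltxx.
Qed.

(* The factors [nabla l] of a filtration can be moved to the top, because
   Ext^1(nabla m, nabla l) = 0 for [m <= l]. *)
Lemma nabla_top l X : filtered (tilde nabla) X ->
  (forall m, ~~ (m <= l)%O -> hom0 (Delta m) X) ->
  exists (X' Y : lmodType A) (U : lmodType R) (f : {linear X' -> X}) (g : {linear X -> Y}),
  [/\ fgp U, is_tensor_mod (nabla l) U Y, short_exact f g
    & filtered (twists (fun m => (m < l)%O) nabla) X'].
Proof.
elim=> [{}X X0|X1 {}X V f g FX1 IH [m [U [_ fU tV]]] se] H.
  exists X, X, {ffun void -> R^o}, (idl X), (zerol X X); split.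
  - exact: fgp_free.
  - exact: tensor_zero.
  - split=> [//|y|y]; last by exists 0; rewrite [RHS]X0.
    by split=> // _; exists y.
  - exact: filtered_zero.
have [fi fg gs] := se.
have [|X' [Y [U1 [f1 [g1 [fU1 tY se1 FX']]]]]] := IH.
  move=> n nl u x; apply: fi; rewrite linear0.
  exact: (H n nl (compl f u)).
have [f1i fg1 g1s] := se1.
have EV : ~~ (l < m)%O -> Ext1_zero V Y.
  move=> lm; apply: (Ext1_radd_l (fin_gen_res (nabla_fgp m).1) (tensor_radd fU tV)).
  by apply: (Ext1_radd_r (tensor_radd fU1 tY)); apply: Ext1_costandard.
have [ml|ml] := boolP (m <= l)%O; last first.
  (* Unless [m <= l] the factor vanishes: maps from [Delta m] to [V] lift to [X], hence are zero,
     while the generator [ga] tensored with [w i] is such a map and vanishes only if [w i] does. *)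
  have V0 : zero_mod V.
    have h0 : hom0 (Delta m) V.
      move=> u x; have [v vK] := Ext1_lift u se (Ext1_Delta_nabla (filtered_nabla FX1)).
      by rewrite -vK (H m ml) linear0.
    have [I [w [phi wphi]]] := (fgpP U).1 fU.
    have [b [bt bA]] := tV; have [bl br bs] := bt.1.
    have [e [be eb]] := tensor_coords wphi bt bA.
    have [ga [_ ga0]] := costandard_generator m.
    move=> v; rewrite (be v); apply: big1 => i _.
    suff -> : w i = 0 by apply: (raddf0 (mkadd (br (e i v)))).
    rewrite (wphi (w i)) big1 // => k _.
    suff -> : phi k (w i) = 0 by rewrite scale0r.
    apply: ga0 => x; rewrite -eb.
    have := h0 (compl (mklin (tensor_slice_linear (w i) bt.1 bA)) ga) x.
    by move=> /= ->; rewrite linear0.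
  have fs : surj f by move=> x; apply/fg; apply: V0.
  have [|k kK] := factor_surj (h := g1) fs.
    by move=> x; rewrite -(linear0 f) => /fi ->; rewrite linear0.
  exists X', Y, U1, (compl f f1), k; split=> //; split.
  - by move=> x y /= /fi /f1i.
  - move=> x; have [y <-] := fs x; rewrite kK; split=> [/fg1 [z <-]|[z /= /fi <-]].
      by exists z.
    by apply/fg1; exists z.
  - by move=> y; have [x <-] := g1s y; exists (f x); rewrite kK.
(* [g1] extends from [X1] to [X], so the old top factor [Y] is still a quotient of [X]. *)
have [k kK] := EV (negbT (Order.POrderTheory.le_gtF ml)) _ _ f g se g1.
(* For [m = l] the new factor joins [Y] as a direct summand; for [m < l] it becomes a factor of the
   kernel of [k]. *)
move: ml; rewrite Order.POrderTheory.le_eqVlt => /orP [/eqP ml|ml].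
  rewrite ml in tV.
  exists X', (Y * V)%type, (U1 * U)%type, (compl f f1), (mkpairl k g); split=> //.
  - exact: fgp_pair.
  - exact: tensor_pair.
  split.
  - by move=> x y /= /fi /f1i.
  - move=> x; split=> [[kx /fg [y yx]]|[y <-]].
      have [|z zy] := (fg1 y).1; first by rewrite -kK yx.
      by exists z; rewrite /= zy.
    apply: injective_projections; first by rewrite /= kK (exact_comp0 fg1).
    by rewrite /= (exact_comp0 fg).
  - move=> [y v]; have [x xv] := gs v; have [z zy] := g1s (y - k x).
    exists (x + f z); apply: injective_projections => /=.
      by rewrite linearD kK zy addrC subrK.
    by rewrite linearD (exact_comp0 fg) addr0.
have ks : surj k by move=> y; have [x <-] := g1s y; exists (f x).
exists (kerm k), Y, U1, (kerm_val k), k; split=> //.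
  exact: ker_short_exact.
have [|h hK] := factor_inj (h := compl f f1) (@kerm_val_inj _ _ _ k).
  by move=> x; apply/kerm_exact; rewrite /= kK (exact_comp0 fg1).
apply: (@filtered_step _ _ X' _ V h (compl g (kerm_val k)) FX').
  by exists m, U; split.
split.
- by move=> x y e; apply/f1i/fi; rewrite -[LHS]hK -[RHS]hK e.
- move=> x; split=> [/fg [y yx]|[z <-]].
    have [|z zy] := (fg1 y).1; first by rewrite -kK yx (exact_comp0 (kerm_exact k)).
    by exists z; apply: kerm_val_inj; rewrite hK /= zy.
  by rewrite /= hK (exact_comp0 fg).
- move=> v; have [x xv] := gs v; have [z zx] := g1s (k x).
  have [|y yE] := (kerm_exact k (x - f z)).1; first by rewrite linearB kK zx subrr.
  by exists y; rewrite /= yE linearB (exact_comp0 fg) subr0.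
Qed.

(** [Delta l] has neither maps nor extensions into [X'], so Hom(Delta l, E) and Hom(Delta l, Y)
    agree. The former is free of rank one because every map to [E] factors through [j]; the latter
    is the multiplicity module [U] of the top factor. Hence [Y] is a copy of [nabla l]. *)
Lemma tilting_cover l : exists (E X' : lmodType A) (f : {linear X' -> E})
    (g : {linear E -> nabla l}),
  [/\ short_exact f g, filtered (twists (fun m => (m < l)%O) nabla) X',
      Filt (tilde Delta) E & Filt (tilde nabla) E].
Proof.
have [|E [j [ji ju FE EE]]] := @tilting_extension l _ [set m | (m < l)%O] erefl.
  by move=> m; rewrite inE.
have FDE := filtered_Delta FE.
(* For [m < l] the extensions were killed by construction; otherwise [m] is strictly below no index
   [n <= l], and Ext^1(Delta m, Delta n) vanishes for every factor of [E]. *)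
have FNE : Filt (tilde nabla) E.
  apply: Filt_nablaI FDE.1 _ => m; have [ml|ml] := boolP (m < l)%O.
    by apply: EE; rewrite inE.
  apply: (Ext1_filtered_r (Delta_fin_gen m) _ FE) => X [n [U [nl fU t]]].
  apply: (Ext1_radd_r (tensor_radd fU t)); apply: (Ext1_standard qh).
  by apply: contra ml => mn; apply: Order.POrderTheory.lt_le_trans nl.
have [|X' [Y [U [f [g [fU tY se FX']]]]]] := nabla_top (l := l) FNE.2.
  move=> m ml; apply: (hom0_filtered_r _ FE) => X [n [V [nl fV t]]].
  apply: (hom0_radd_r (tensor_radd fV t)); apply: (standard_hom0 qh).
  by apply: contra ml => mn; apply: Order.POrderTheory.le_trans nl.
have FNX' := filtered_nabla FX'.
have X'0 : hom0 (Delta l) X'.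
  apply: (hom0_filtered_r _ FX') => X [n [V [nl fV t]]].
  apply: (hom0_radd_r (tensor_radd fV t)) => u x.
  have ln : l != n by rewrite eq_sym Order.POrderTheory.lt_eqF.
  by rewrite (cs_hom0 cs ln u).
have [fi fg gs] := se.
pose w : {linear Delta l -> Y} := compl g j.
have wgen (u : {linear Delta l -> Y}) : exists r : R, forall x, u x = (alg_map r : A) *: w x.
  have [v vK] := Ext1_lift u se (Ext1_Delta_nabla FNX').
  have [v' v'K] := ju v; have [r rP] := standard_scalar v'.
  by exists r => x; rewrite -vK v'K rP /= !linearZ.
have wfree (r : R) : (forall x, (alg_map r : A) *: w x = 0) -> r = 0.
  move=> r0; apply: (@standard_faithful l) => x.
  have [|t tK] := factor_inj (h := compl (scl E r) j) fi.
    by move=> y; apply/fg; rewrite linearZ; exact: r0.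
  by apply: ji; rewrite linearZ linear0 -[LHS]tK X'0 linear0.
have [b [bt bA]] := tY; have [bl br bs] := bt.1.
pose sl v := mklin (tensor_slice_linear v bt.1 bA).
have [ga [gaP ga0]] := costandard_generator l.
have [I [u [phi uphi]]] := (fgpP U).1 fU.
have [e [be eb]] := tensor_coords uphi bt bA.
have bscale r x v : (alg_map r : A) *: b x v = b x (r *: v) by rewrite -bs -bA.
have [r rP] := choice (fun i => gaP (compl (e i) w)).
(* [u0] is the element of [U] that corresponds to [w]; it will be a basis of [U]. *)
pose u0 := \sum_i r i *: u i.
have wu0 x : w x = b (ga x) u0.
  rewrite (be (w x)) (balanced_sum _ _ bt.1); apply: eq_bigr => i _.
  by rewrite -[e i (w x)]/(compl (e i) w x) rP bA bscale.
have binj v : (forall x, b (ga x) v = 0) -> v = 0.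
  move=> v0; rewrite (uphi v) big1 // => i _.
  suff -> : phi i v = 0 by rewrite scale0r.
  by apply: ga0 => x; rewrite -eb v0 linear0.
have u0i : injective (scall u0).
  apply: inj0 => s /= s0; apply: wfree => x.
  by rewrite wu0 bscale s0; apply: (raddf0 (mkadd (br (ga x)))).
have [|psi psiK] := factor_inj (h := idl U) u0i.
  move=> v; have [s sP] := wgen (compl (sl v) ga); exists s.
  apply/eqP; rewrite -subr_eq0; apply/eqP/binj => x.
  by rewrite br -[scall u0 s]/(s *: u0) -bscale -wu0 -sP; apply: subrr.
have psi0 : psi u0 = 1 by apply: u0i; rewrite psiK /= scale1r.
have u0psi : dual_basis (fun _ : unit => u0) (fun=> psi).
  by move=> v; rewrite (big_pred1 tt) ?[RHS]psiK // => -[].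
have [ee [bee eeb]] := tensor_coords u0psi bt bA.
have beet y : y = b (ee tt y) u0.
  by rewrite [LHS](bee y) (big_pred1 tt) // => -[].
have eebt x : ee tt (b x u0) = x by rewrite eeb psi0 rmorph1 scale1r.
exists E, X', f, (compl (ee tt) g); split=> //; split=> //.
  move=> x; rewrite -fg; split=> [/= ex|gx]; last by rewrite /= gx linear0.
  by rewrite (beet (g x)) ex; apply: (raddf0 (mkadd (bl u0))).
by move=> x; have [y yE] := gs (b x u0); exists y; rewrite /= yE eebt.
Qed.

End Costandard.

(** * The Ringel dual *)

Section Reconstruction.
Variables (R : comPzRingType) (A : ralgType R).
Implicit Types M N X Y S W : lmodType A.

(** Linearity over End(S)^op is compatibility with precomposition by endomorphisms of [S]. *)
Lemma hom_linear_comb S X Y (phi : {linear homm S X -> homm S Y})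
    (J : finType) (a : J -> {linear S -> X}) (b : J -> {linear S -> S}) (al : {linear S -> X}) :
  (forall s, al s = \sum_j a j (b j s)) ->
  forall s, (phi al : homm S Y) s = \sum_j (phi (a j) : homm S Y) (b j s).
Proof.
move=> e s.
have -> : (al : homm S X) = \sum_j (b j : (Endo S)^c) *: (a j : homm S X).
  by apply: linear_ext => t; rewrite homm_sumE; apply: e.
rewrite linear_sum homm_sumE; apply: eq_bigr => j _.
by rewrite linearZ.
Qed.

(* The maps [a j] are the components of an epimorphism [S^J -> X] that remains
   onto under [Hom(S, -)]; the last hypothesis says that its kernel is generated
   by [S], up to a multiple [r] acting injectively on [Y]. *)
Lemma hom_reconstruct S X Y (J : finType) (a : J -> {linear S -> X}) :
  (forall x, exists t : J -> S, x = \sum_j a j (t j)) ->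
  (forall al : {linear S -> X}, exists b : J -> {linear S -> S},
     forall s, al s = \sum_j a j (b j s)) ->
  (forall t : J -> S, \sum_j a j (t j) = 0 ->
     exists r : R, (forall y : Y, (alg_map r : A) *: y = 0 -> y = 0) /\
     exists (K : finType) (c : K -> J -> {linear S -> S}) (z : K -> S),
       (forall k s, \sum_j a j (c k j s) = 0) /\
       (forall j, (alg_map r : A) *: t j = \sum_k c k j (z k))) ->
  forall phi : {linear homm S X -> homm S Y},
    exists g : {linear X -> Y}, forall (al : {linear S -> X}) s,
      (phi al : homm S Y) s = g (al s).
Proof.
move=> gen lift rel phi.
have [||g gK] := factor_surj (p := summl a) (h := summl (fun j => (phi (a j) : homm S Y))).
- by move=> x; have [t ->] := gen x; exists [ffun j => t j];
    rewrite summlE; apply: eq_bigr => j _; rewrite ffunE.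
- move=> t; rewrite summlE => /rel [r [rY [K [c [z [c0 ct]]]]]].
  apply: rY; rewrite summlE scaler_sumr.
  transitivity (\sum_j \sum_k (phi (a j) : homm S Y) (c k j (z k))).
    by apply: eq_bigr => j _; rewrite -linearZ ct linear_sum.
  rewrite exchange_big big1 //= => k _.
  rewrite -(@hom_linear_comb _ _ _ phi _ a (c k) (zerol S X)).
    have -> : (zerol S X : homm S X) = 0 by apply: linear_ext.
    by rewrite linear0.
  by move=> s; rewrite c0.
exists g => al s; have [b bP] := lift al.
rewrite (hom_linear_comb phi bP) bP linear_sum; apply: eq_bigr => j _.
by have := gK (delta j (b j s)); rewrite !summlE !sum_delta => ->.
Qed.

Lemma hom_reconstruct_radd S X Y (phi : {linear homm S X -> homm S Y}) : radd S X ->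
  exists g : {linear X -> Y}, forall (al : {linear S -> X}) s,
    (phi al : homm S Y) s = g (al s).
Proof.
move=> [J [a [b ab]]].
exists (lsum (fun j => compl (phi (a j) : homm S Y) (b j))) => al s.
by apply: (@hom_linear_comb _ _ _ phi _ a (fun j => compl (b j) al) al) => t; apply: ab.
Qed.

(** The long exact sequence: the lifting hypothesis makes the connecting map from Hom(M, X) to
    Ext^1(M, N) zero, and Ext^1(M, W) vanishes. *)
Lemma Ext1_ker M N W X (f : {linear N -> W}) (g : {linear W -> X}) :
  short_exact f g -> Ext1_zero M W ->
  (forall phi : {linear M -> X}, exists b : {linear M -> W}, forall m, g (b m) = phi m) ->
  Ext1_zero M N.
Proof.
move=> [fi fg gs] E lift C P i p se h; have [ii ip ps] := se.
have [k kK] := E _ _ _ _ se (compl f h).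
have [|phi phiK] := factor_surj (p := p) (h := compl g k) ps.
  by move=> x /ip [c <-]; rewrite /= kK (exact_comp0 fg).
have [b bK] := lift phi.
have [|v vK] := factor_inj (h := subl k (compl b p)) fi.
  by move=> x; apply/fg; rewrite linearB /= bK phiK subrr.
by exists v => c; apply: fi; rewrite vK /= kK (exact_comp0 ip) linear0 subr0.
Qed.

Lemma alg_iso_scalar : (forall a : A, exists r : R, a = alg_map r) ->
  (forall r : R, alg_map r = 0 :> A -> r = 0) -> alg_iso A R^o.
Proof.
move=> surjA injA; have [f fP] := choice surjA.
have inj : injective (@alg_map R A).
  move=> r s /eqP; rewrite -subr_eq0 -rmorphB => /eqP/injA/eqP.
  by rewrite subr_eq0 => /eqP.
have fK a : alg_map (f a) = a by rewrite -fP.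
have fz : zmod_morphism f by move=> x y; apply: inj; rewrite rmorphB /= !fK.
have fm : monoid_morphism f.
  split; first by apply: inj; rewrite fK rmorph1.
  by move=> x y; apply: inj; rewrite rmorphM /= !fK.
pose F : {rmorphism A -> R^o} := HB.pack (f : A -> R^o)
  (GRing.isZmodMorphism.Build A R^o f fz) (GRing.isMonoidMorphism.Build A R^o f fm).
exists F; split; last by move=> r; apply: inj; apply: fK.
by exists (@alg_map R A) => x; [apply: fK | apply: inj; apply: fK].
Qed.

End Reconstruction.

Section DirectSums.
Variables (A : pzRingType) (I : finType) (P : I -> lmodType A).

Lemma dproj_linear i : linear (fun x : dsum P => x i).
Proof. by []. Qed.
Definition dproj i : {linear dsum P -> P i} := mklin (dproj_linear i).

Definition dinj_fun i (y : P i) : dsum P :=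
  fun j => match pselect (i = j) with left e => eq_rect i P y j e | right _ => 0 end.
Lemma dinj_same i y : dinj_fun y i = y :> P i.
Proof. by rewrite /dinj_fun; case: pselect => // e; rewrite (Prop_irrelevance e erefl). Qed.
Lemma dinj_other i j y : i <> j -> @dinj_fun i y j = 0.
Proof. by rewrite /dinj_fun; case: pselect. Qed.
Lemma dinj_linear i : linear (@dinj_fun i).
Proof.
move=> a x y; apply: functional_extensionality_dep => j.
rewrite -[RHS]/(a *: dinj_fun x j + dinj_fun y j).
have [e|e] := pselect (i = j); first by subst j; rewrite !dinj_same.
by rewrite !dinj_other // scaler0 addr0.
Qed.
Definition dinj i : {linear P i -> dsum P} := mklin (@dinj_linear i).

Lemma dsum_eval (J : finType) (F : J -> dsum P) i : (\sum_j F j) i = \sum_j F j i.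
Proof. exact: (linear_sum (dproj i)). Qed.

Lemma dsum_decomp (x : dsum P) : x = \sum_i dinj i (x i).
Proof.
apply: functional_extensionality_dep => j; rewrite dsum_eval (bigD1 j) //=.
rewrite dinj_same big1 ?addr0 // => i /eqP ij.
exact: dinj_other.
Qed.

Lemma fgp_dsum : (forall i, fgp (P i)) -> fgp (dsum P : lmodType A).
Proof.
move=> fP; have H i := cid ((fgpP (P i)).1 (fP i)).
pose J i : finType := projT1 (H i).
have [g gP] : exists g : forall i, J i -> P i, forall i, exists f, dual_basis (g i) f.
  exists (fun i => projT1 (cid (projT2 (H i)))) => i.
  exact: (projT2 (cid (projT2 (H i)))).
pose f i := projT1 (cid (gP i)).
have fgE i : dual_basis (g i) (f i) := projT2 (cid (gP i)).
apply/fgpP; exists {i : I & J i}, (fun k => dinj (tag k) (g _ (tagged k))),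
  (fun k => compl (f _ (tagged k)) (dproj (tag k))) => x.
transitivity (\sum_i \sum_(j : J i) (f i j (x i) : A) *: dinj i (g i j)).
  rewrite [LHS]dsum_decomp; apply: eq_bigr => i _; rewrite {1}(fgE i (x i)) linear_sum.
  by apply: eq_bigr => j _; rewrite linearZ.
by rewrite (sig_big_dep xpredT (fun=> xpredT)).
Qed.

End DirectSums.

Section RingelDual.
Variables (R : idomainType) (hR : noetherian R) (A : ralgType R).
Variables (d : Order.disp_t) (L : finPOrderType d) (Delta nabla : L -> lmodType A).
Hypotheses (qh : split_qh Delta) (cs : costandard Delta nabla).
Implicit Types l m n : L.
Implicit Types M N X Y : lmodType A.

(* The modules [W i] provide a surjective right approximation of [X], with
   respect to all modules having a standard filtration. *)
Definition approx (I : Type) (W : I -> lmodType A) X : Prop :=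
  exists (J : finType) (k : J -> I) (a : forall j, {linear W (k j) -> X}),
    (forall x, exists t : forall j, W (k j), x = \sum_j a j (t j)) /\
    (forall M (phi : {linear M -> X}), Filt (tilde Delta) M ->
       exists b : forall j, {linear M -> W (k j)}, forall y, phi y = \sum_j a j (b j y)).

(** Induction along the filtration: approximations of the top factor lift to [X] because Ext^1 from
    each [W i] to [X1] vanishes. After subtracting what they reach, every element and every map
    lands in [X1]. *)
Lemma approx_filtered (I : Type) (W : I -> lmodType A) X :
  (forall i, Filt (tilde Delta) (W i)) -> (forall l, approx W (nabla l)) ->
  filtered (tilde nabla) X -> approx W X.
Proof.
move=> FW apW; elim=> [{}X X0|X1 {}X V f g FX1 [J [k [a [gen lift]]]] [m [U [_ fU tV]]] se].
  exists void, (fun v : void => match v with end), (fun v : void => match v with end).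
  split=> [x|M phi _]; first by exists (fun v : void => match v with end); rewrite big1 ?X0 // => -[].
  by exists (fun v : void => match v with end) => y; rewrite big1 ?X0 // => -[].
have [fi fg gs] := se.
have FNX1 := filtered_nabla cs FX1.
have [D [u [phi uphi]]] := (fgpP U).1 fU.
have [b [bt bA]] := tV.
have [e [be eb]] := tensor_coords uphi bt bA.
pose sl i := mklin (tensor_slice_linear (u i) bt.1 bA).
have [J' [k' [a' [gen' lift']]]] := apW m.
have H i j := cid (Ext1_lift (compl (sl i) (a' j)) se (Ext1_Filt cs (FW (k' j)) FNX1)).
pose q i j : {linear W (k' j) -> X} := projT1 (H i j).
have qE i j y : g (q i j y) = sl i (a' j y) := projT2 (H i j) y.
pose k2 (z : J + (D * J')) : I := match z with inl j => k j | inr p => k' p.2 end.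
pose a2 (z : J + (D * J')) : {linear W (k2 z) -> X} :=
  match z return {linear W (k2 z) -> X} with
  | inl j => compl f (a j) | inr p => q p.1 p.2 end.
have sl_sum v (t : D -> forall j, W (k' j)) : (forall i, e i v = \sum_j a' j (t i j)) ->
    g (\sum_(p : D * J') q p.1 p.2 (t p.1 p.2)) = v.
  move=> te; rewrite linear_sum /= [RHS](be v).
  under eq_bigr do rewrite qE.
  rewrite -(pair_bigA _ (fun i j => sl i (a' j (t i j)))) /=.
  by apply: eq_bigr => i _; rewrite -[RHS]/(sl i (e i v)) te linear_sum.
exists (J + (D * J'))%type, k2, a2; split=> [x|M psi FM].
  have [t tE] := choice (fun i => gen' (e i (g x))).
  have [|x1 x1E] := (fg (x - \sum_(p : D * J') q p.1 p.2 (t p.1 p.2))).1.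
    by rewrite linearB (sl_sum _ _ tE) subrr.
  have [t1 t1E] := gen x1.
  exists (fun z => match z return W (k2 z) with inl j => t1 j | inr p => t p.1 p.2 end).
  rewrite big_sumType /= -[LHS](subrK (\sum_(p : D * J') q p.1 p.2 (t p.1 p.2))) -x1E.
  by rewrite t1E linear_sum.
have [t tE] := choice (fun i => lift' M (compl (e i) (compl g psi)) FM).
pose s := lsum (fun p : D * J' => compl (q p.1 p.2) (t p.1 p.2)).
have [|psi1 psi1E] := factor_inj (h := subl psi s) fi.
  move=> y; apply/fg; rewrite linearB /= (sl_sum (g (psi y)) (fun i j => t i j y)) ?subrr //.
  by move=> i; rewrite -(tE i y).
have [t1 t1E] := lift M psi1 FM.
exists (fun z => match z return {linear M -> W (k2 z)} with inl j => t1 j | inr p => t p.1 p.2 end).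
move=> y; rewrite big_sumType /= -[LHS](subrK (s y)).
by congr (_ + _); rewrite -[LHS]psi1E t1E linear_sum.
Qed.

(** Hom(Delta l, nabla m) is [R] or zero, and vanishing of Ext^1 makes Hom exact along both
    filtrations. *)
Lemma hom_fgp M N : Filt (tilde Delta) M -> Filt (tilde nabla) N -> fgp (res (homm M N)).
Proof.
move=> [_ FM] FN.
have base l : fgp (res (homm (Delta l) N)).
  case: FN => _; elim=> [X X0|X' X X'' f g F' IH [m [U [_ fU t]]] se].
    by apply: hom_fgp_zero => f x; apply: X0.
  apply: (hom_fgp_ext_r se (Ext1_Delta_nabla qh cs (filtered_nabla cs F')) IH).
  apply: (hom_fgp_radd_r (tensor_radd fU t)).
  have [->|lm] := eqVneq l m; last first.
    by apply: hom_fgp_zero => h x; rewrite (cs_hom0 cs lm h).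
  have [th [th' thK th'K]] := cs_hom cs m.
  apply: (fgp_radd (fgp_unit R)); have [|v vK] := factor_inj (h := idl R^o) (can_inj thK).
    by move=> r; exists (th' r).
  exists unit, (fun=> v), (fun=> th) => x; rewrite (big_pred1 tt) => [|[] //].
  by apply: (can_inj thK); rewrite vK.
elim: FM => [X X0|X' X X'' f g F' IH [m [U [_ fU t]]] se].
  by apply: hom_fgp_zero => f x; rewrite (X0 x) linear0.
have rX'' := tensor_radd fU t.
apply: (hom_fgp_ext_l se _ IH); last exact: hom_fgp_radd_l rX'' (base m).
exact: (Ext1_radd_l (Delta_fin_gen qh m) rX'' (Ext1_Delta_nabla qh cs FN)).
Qed.

Variable T : lmodType A.
Hypothesis hT : char_tilting Delta nabla T.

Lemma tiltingP X : Filt (tilde Delta) X -> Filt (tilde nabla) X -> radd T X.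
Proof. by move=> FD FN; apply/add_catP/hT.2. Qed.

Lemma tilting_Filt : Filt (tilde Delta) T /\ Filt (tilde nabla) T.
Proof. exact/hT.2/add_catP/radd_refl. Qed.

Lemma Ext1_tilting N : Filt (tilde nabla) N -> Ext1_zero T N.
Proof. by move=> FN; apply: (Ext1_Filt cs tilting_Filt.1 FN). Qed.

(** The modules of [tilting_cover] lie in add T, and their maps onto [nabla l] stay onto under Hom
    from standardly filtered modules because the kernels are costandardly filtered. *)
Lemma approx_tilting X : Filt (tilde nabla) X -> approx (fun _ : unit => T) X.
Proof.
move=> [_ FX]; apply: (approx_filtered _ _ FX) => [_|l]; first exact: tilting_Filt.1.
have [E [X' [f [g [se FX' FD FN]]]]] := tilting_cover hR qh cs l.
have [J [a [b ab]]] := tiltingP FD FN.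
have [fi fg gs] := se.
exists J, (fun=> tt), (fun j => compl g (a j)); split=> [x|M phi FM].
  have [y <-] := gs x; exists (fun j => b j y).
  by rewrite [in LHS](ab y) linear_sum.
have [v vK] := Ext1_lift phi se (Ext1_Filt cs FM (filtered_nabla cs FX')).
exists (fun j => compl (b j) v) => y.
by rewrite -vK [in LHS](ab (v y)) linear_sum.
Qed.

Lemma tilting_gen X : Filt (tilde nabla) X ->
  exists (J : finType) (a : J -> {linear T -> X}), forall x, exists t : J -> T, x = \sum_j a j (t j).
Proof. by move=> /approx_tilting [J [k [a [gen _]]]]; exists J, a. Qed.

Lemma tilting_hom_full X Y (phi : {linear homm T X -> homm T Y}) : Filt (tilde nabla) X ->
  exists g : {linear X -> Y}, forall (al : {linear T -> X}) s,
    (phi al : homm T Y) s = g (al s).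
Proof.
move=> FX; have [J [k [a [gen lift]]]] := approx_tilting FX.
have ps : surj (summl a).
  move=> x; have [t ->] := gen x; exists [ffun j => t j].
  by rewrite summlE; apply: eq_bigr => j _; rewrite ffunE.
have se := ker_short_exact ps.
have FW : Filt (tilde nabla) {ffun J -> T}.
  exact: (proj2 ((hT.2 _).1 ((add_catP _ _).2 (radd_ffun T J)))).
(* The lifting property of the approximation is what kills extensions of the [Delta l] by the
   kernel. *)
have FN : Filt (tilde nabla) (kerm (summl a)).
  apply: (Filt_nablaI hR qh cs).
    apply/latticeP; apply: (fgp_kernel (short_exact_res se)).
      by have [/latticeP] := FW.
    by have [/latticeP] := FX.
  move=> l; apply: (Ext1_ker se (Ext1_Delta_nabla qh cs FW)) => psi.
  have [b bP] := lift _ psi (Filt_Delta_standard qh l).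
  exists (tupl b) => y; rewrite summlE bP.
  by apply: eq_bigr => j _; rewrite ffunE.
have [K [c cP]] := tilting_gen FN.
apply: (hom_reconstruct (a := a) gen (fun al => lift _ al tilting_Filt.1)) => t t0.
exists 1; split=> [y|]; first by rewrite rmorph1 scale1r.
have [|n nE] := (kerm_exact (summl a) [ffun j => t j]).1.
  by rewrite summlE -[RHS]t0; apply: eq_bigr => j _; rewrite ffunE.
have [z zE] := cP n.
exists K, (fun k j => compl (projl T j) (compl (kerm_val _) (c k))), z; split.
  by move=> i s; exact: (exact_comp0 (kerm_exact (summl a)) (c i s)).
move=> j; rewrite rmorph1 scale1r.
have := congr1 (fun w : {ffun J -> T} => w j) nE; rewrite ffunE => <-.
by rewrite zE linear_sum sum_ffunE.
Qed.

Let B : ralgType R := (Endo T)^c.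
Let DB : L^d -> lmodType B := fun l => homm T (nabla l).

Lemma hom_tilting_short_exact X' X X'' (f : {linear X' -> X}) (g : {linear X -> X''}) :
  short_exact f g -> Filt (tilde nabla) X' -> short_exact (hom_map T f) (hom_map T g).
Proof.
move=> se FX'; have [fi fg gs] := se; split.
- move=> u v e; apply: linear_ext => x; apply: fi.
  exact: (congr1 (fun w : homm T X => w x) e).
- move=> u; split=> [e|[v <-]].
    have [|w wK] := factor_inj (h := u) fi.
      by move=> x; apply/fg; exact: (congr1 (fun w : homm T X'' => w x) e).
    by exists w; apply: linear_ext.
  by apply: linear_ext => x; exact: (exact_comp0 fg (v x)).
by move=> u; have [v vK] := Ext1_lift u se (Ext1_tilting FX'); exists v; apply: linear_ext.
Qed.

Lemma filtered_hom_tilting (S : pred L) X : filtered (twists S nabla) X ->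
  filtered (twists (S : pred L^d) DB) (homm T X : lmodType B).
Proof.
elim=> [Y Y0|X' Y X'' f g F' IH [m [U [Sm fU t]]] se].
  by apply: filtered_zero => u; apply: linear_ext => x; apply: Y0.
apply: (filtered_step IH _ (hom_tilting_short_exact se (filtered_nabla cs F'))).
by exists m, U; split=> //; apply: tensor_hom.
Qed.

Lemma radd_hom X Y : radd X Y -> radd (homm T X : lmodType B) (homm T Y).
Proof.
move=> [J [a [b ab]]]; exists J, (fun j => hom_map T (a j)), (fun j => hom_map T (b j)) => u.
by apply: linear_ext => x; rewrite homm_sumE; apply: ab.
Qed.

(** [B^o] and [homm T T] have the same elements, but one carries the regular structure and the other
    precomposition; identity maps pass between them. *)
Definition End_to_hom_fun (b : B^o) : homm T T := b.
Fact End_to_hom_linear : linear End_to_hom_fun. Proof. by []. Qed.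
Definition End_to_hom : {linear B^o -> homm T T} := mklin End_to_hom_linear.
Definition hom_to_End_fun (b : homm T T) : B^o := b.
Fact hom_to_End_linear : linear hom_to_End_fun. Proof. by []. Qed.
Definition hom_to_End : {linear homm T T -> B^o} := mklin hom_to_End_linear.

Lemma radd_End_hom : radd (B^o : lmodType B) (homm T T).
Proof.
exists unit, (fun=> End_to_hom), (fun=> hom_to_End) => x.
by rewrite (big_pred1 tt) // => -[].
Qed.

Lemma radd_hom_End : radd (homm T T : lmodType B) B^o.
Proof.
exists unit, (fun=> hom_to_End), (fun=> End_to_hom) => x.
by rewrite (big_pred1 tt) // => -[].
Qed.

Lemma fgp_hom_radd X : radd T X -> fgp (homm T X : lmodType B).
Proof. by move=> rX; apply/fgp_radd_free/(radd_trans radd_End_hom)/radd_hom. Qed.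

(** [dual (nabla l)] is standard over the opposite algebra, so the transpose of [v] is a scalar, and
    functionals separate the points of [nabla l]. *)
Lemma costandard_scalar l (v : {linear nabla l -> nabla l}) :
  exists r : R, forall x, v x = (alg_map r : A) *: x.
Proof.
have [r rP] := standard_scalar (cs_op cs) (dmap v).
exists r => x; apply: (ev_sep (nabla_fgp cs l)) => xi.
rewrite -[LHS]/(ev (dmap v xi) x) rP ev_scale; symmetry.
exact: (linearZ_LR (xi : homm (res (nabla l)) R^o)).
Qed.

Lemma costandard_faithful l (r : R) :
  (forall x : nabla l, (alg_map r : A) *: x = 0) -> r = 0.
Proof.
move=> r0; apply: (standard_faithful (cs_op cs) (l := l)) => xi.
apply: linear_ext => x; rewrite -[LHS]/(ev xi ((alg_map r : A) *: (x : nabla l))) r0.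
exact: (linear0 (xi : homm (res (nabla l)) R^o)).
Qed.

Lemma Filt_nabla_costandard l : Filt (tilde nabla) (nabla l).
Proof. exact/(@filtered_nabla _ _ _ _ _ _ cs predT)/filtered1/twist_self. Qed.

Lemma ringel_dual_end l : alg_iso (Endo (DB l)) R^o.
Proof.
have FN := Filt_nabla_costandard l.
apply: alg_iso_scalar => [phi|r r0].
  have [g gE] := tilting_hom_full phi FN.
  have [r rP] := costandard_scalar g; exists r.
  apply: linear_ext => al; apply: linear_ext => s.
  rewrite gE rP; symmetry; exact: (linearZ_LR (al : homm T (nabla l))).
apply: (@costandard_faithful l) => x.
have [J [a gen]] := tilting_gen FN; have [t ->] := gen x.
rewrite scaler_sumr big1 // => j _.
have e : (alg_map r : Endo (DB l)) (a j : DB l) = 0 by rewrite r0.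
have := congr1 (fun w : homm T (nabla l) => w (t j)) e.
by move=> /= <-; rewrite -linearZ.
Qed.

Lemma ringel_dual_split_qh : split_qh DB.
Proof.
have cover l := cid (tilting_cover hR qh cs l).
pose E l := projT1 (cover l).
have EP l : exists (X' : lmodType A) (f : {linear X' -> E l}) (g : {linear E l -> nabla l}),
  [/\ short_exact f g, filtered (twists (fun m => (m < l)%O) nabla) X',
      Filt (tilde Delta) (E l) & Filt (tilde nabla) (E l)] := projT2 (cover l).
have ET l : radd T (E l).
  by have [X' [f [g [_ _ FD FN]]]] := EP l; apply: tiltingP.
have DBfgp (l : L^d) : fgp (res (DB l)).
  exact: (hom_fgp tilting_Filt.1 (Filt_nabla_costandard l)).
split.
- apply: fgp_radd (radd_res radd_hom_End).
  exact: (hom_fgp tilting_Filt.1 tilting_Filt.2).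
- by move=> l; apply: fin_gen_res (DBfgp l).1.
- exact: DBfgp.
- move=> l m [phi [al /eqP al0]].
  have [g gE] := tilting_hom_full phi (Filt_nabla_costandard l).
  (* The transpose reverses the direction of the map, in accordance with the order on [L^d]. *)
  apply: (qh_order (cs_op cs)); exists (dmap g).
  apply: contrapT => no; apply: al0; apply: linear_ext => s.
  apply: (ev_sep (nabla_fgp cs m)) => xi; rewrite gE.
  have -> : ev xi (g ((al : homm T (nabla l)) s)) =
      ev (dmap g xi) ((al : homm T (nabla l)) s) by [].
  have -> : dmap g xi = 0.
    by apply/eqP/negPn/negP => h; apply: no; exists xi.
  by symmetry; exact: (linear0 (xi : homm (res (nabla m)) R^o)).
- exact: ringel_dual_end.
exists (fun l : L^d => homm T (E l) : lmodType B); split=> [l|].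
  split; first exact: fgp_hom_radd (ET l).
  have [X' [f [g [se FX' _ _]]]] := EP l.
  exists (homm T X'), (hom_map T f), (hom_map T g); split.
    exact: hom_tilting_short_exact se (filtered_nabla cs FX').
  (* The indices [m < l] of [L] are those above [l] in [L^d]. *)
  exact: filtered_hom_tilting FX'.
split=> [|X [m [x xP]]].
  by apply: fgp_dsum => l; apply: fgp_hom_radd (ET l).
have apE l : approx E (nabla l).
  have [X' [f [g [se FX' _ _]]]] := EP l; have [fi fg gs] := se.
  exists unit, (fun=> l), (fun=> g); split=> [y|M phi FM].
    have [z <-] := gs y; exists (fun=> z).
    by rewrite (big_pred1 tt) // => -[].
  have [v vK] := Ext1_lift phi se (Ext1_Filt cs FM (filtered_nabla cs FX')).
  by exists (fun=> v) => y; rewrite (big_pred1 tt) ?vK // => -[].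
have FE l : Filt (tilde Delta) (E l) by have [X' [f [g [_ _ ]]]] := EP l.
(* The modules [E l] approximate [T]; lifting the identity of [T] makes it a summand of a finite sum
   of them, so the Hom(T, E l) together generate the regular module. *)
have [J [k [a [_ lift]]]] := approx_filtered FE apE tilting_Filt.2.2.
have [b bE] := lift T (idl T) tilting_Filt.1.
pose D := dsum (fun l : L^d => homm T (E l) : lmodType B).
pose q (p : J * 'I_m) : {linear D -> X} :=
  compl (scall (x p.2)) (compl hom_to_End (compl (hom_map T (a p.1)) (dproj _ (k p.1)))).
exists #|{: J * 'I_m}|, (summl (fun i => q (enum_val i))) => y.
have [c ->] := xP y.
pose z (p : J * 'I_m) : D :=
  dinj _ (k p.1) (compl (b p.1) (c p.2 : homm T T) : homm T (E (k p.1))).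
exists [ffun i => z (enum_val i)]; rewrite summlE.
transitivity (\sum_(p : J * 'I_m) q p (z p)).
  by rewrite [RHS]sum_enum_val; apply: eq_bigr => i _; rewrite ffunE.
rewrite -(pair_bigA _ (fun j i => q (j, i) (z (j, i)))) exchange_big /=.
apply: eq_bigr => i _.
transitivity ((\sum_j (hom_map T (a j) (compl (b j) (c i : homm T T) : homm T (E (k j))) : homm T T) : B) *: x i).
  rewrite scaler_suml; apply: eq_bigr => j _.
  rewrite -[LHS]/((hom_to_End (hom_map T (a j) (z (j, i) (k j))) : B) *: x i).
  congr (_ *: _); apply: (congr1 (fun w => hom_to_End (hom_map T (a j) w))).
  exact: dinj_same.
congr (_ *: _); apply: linear_ext => s; rewrite homm_sumE.
by rewrite -[RHS]/(idl T ((c i : homm T T) s)) bE.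
Qed.

End RingelDual.

(** * Clearing denominators *)

Section Denominators.
Variable R : idomainType.
Local Notation K := {fraction R}.

Lemma fraction_repr (k : K) : exists a s : R, s != 0 /\ tofrac s * k = tofrac a.
Proof.
elim/quotW: k => x; exists (frac x).1, (frac x).2; split; first exact: denom_ratioP.
unlock tofrac; rewrite -[LHS]/(FracField.mul _ _) !piE.
apply/eqmodP; rewrite /= FracField.equivfE /FracField.mulf.
by rewrite !numden_Ratio ?(oner_eq0, mul1r, mulr1) ?denom_ratioP.
Qed.

Lemma common_multiple (I : finType) (P : I -> R -> Prop) :
  (forall i, exists2 s, s != 0 & P i s) -> (forall i s t, P i s -> P i (t * s)) ->
  exists2 s, s != 0 & forall i, P i s.
Proof.
move=> ex PM; have ex' i : exists s, s != 0 /\ P i s.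
  by have [s s0 Ps] := ex i; exists s.
have [s0 sP] := choice ex'.
exists (\prod_i s0 i) => [|i].
  by apply/prodf_neq0 => i _; case: (sP i).
by rewrite (bigD1 i) //= mulrC; apply: PM; case: (sP i).
Qed.

Lemma torsion_free (A : ralgType R) (M : lmodType A) (r : R) (x : M) :
  fgp (res M) -> r != 0 -> (alg_map r : A) *: x = 0 -> x = 0.
Proof.
move=> /fgpP [I [g [f gf]]] r0 rx; rewrite (gf x) big1 // => i _.
suff -> : f i x = 0 by rewrite scale0r.
apply/eqP; have : r * f i x == 0.
  by rewrite -[r * _](linearZ_LR (f i) r (x : res M)) res_scaleE rx linear0.
by rewrite mulf_eq0 (negbTE r0).
Qed.

Variables (A : ralgType R) (AK : ralgType K).
Implicit Types Z : lmodType AK.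

Definition fscale Z (s : R) (z : Z) : Z := (alg_map (tofrac s) : AK) *: z.

Lemma fscaleM Z s t (z : Z) : fscale (s * t) z = fscale s (fscale t z).
Proof. by rewrite /fscale rmorphM rmorphM /= scalerA. Qed.

Lemma fscaleC Z s t (z : Z) : fscale s (fscale t z) = fscale t (fscale s z).
Proof. by rewrite -!fscaleM mulrC. Qed.

Lemma fscale_linear Z s : linear (@fscale Z s).
Proof.
move=> a x y; rewrite /fscale scalerDr !scalerA; congr (_ *: _ + _).
exact: alg_map_central.
Qed.
Definition fscl Z s : {linear Z -> Z} := mklin (@fscale_linear Z s).

Lemma fscale_map Z Z' (g : {linear Z -> Z'}) s z : g (fscale s z) = fscale s (g z).
Proof. exact: (linearZ_LR g). Qed.

Lemma fscale_inj Z s : s != 0 -> injective (@fscale Z s).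
Proof.
move=> s0; apply: (inj0 (f := fscl Z s)) => z /= e.
rewrite -[z]scale1r -(rmorph1 (@alg_map K AK)).
have <- : (tofrac s)^-1 * tofrac s = 1 :> K by rewrite mulVf // tofrac_eq0.
by rewrite rmorphM -scalerA -/(fscale s z) e scaler0.
Qed.

Variable iA : res K^o -> res A^o -> AK.
Hypothesis hA : is_frac_alg iA.

Lemma frac_regular : is_frac_mod (M := A^o) (MK := AK^o) iA iA.
Proof. by case: hA => bt _ bM _; split. Qed.

Section Module.
Variables (M : lmodType A) (MK : lmodType AK) (iM : res K^o -> res M -> MK).
Hypothesis hM : is_frac_mod iA iM.

Let bt : is_tensor iM := hM.1.

Definition loc (m : M) : MK := iM (1 : K) m.

Lemma frac_modE (k k' : K) (m : M) : iM (k * k') m = (alg_map k : AK) *: iM k' m.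
Proof. by case: hA => _ _ _ ->; rewrite -hM.2 scale1r. Qed.

Lemma frac_modZ (k : K) (s : R) (m : M) :
  iM (tofrac s * k) m = iM k ((alg_map s : A) *: m).
Proof. by case: bt => [[_ _ bs] _]; apply: (bs s k m). Qed.

Lemma loc_scale (s : R) (m : M) : loc ((alg_map s : A) *: m) = fscale s (loc m).
Proof. by rewrite /loc -frac_modZ frac_modE. Qed.

Lemma loc_zmod : zmod_morphism loc.
Proof. by case: bt => [[_ br _] _] x y; apply: br. Qed.
HB.instance Definition _ := GRing.isZmodMorphism.Build M MK loc loc_zmod.

Lemma loc_act (a : A) (m : M) : loc (a *: m) = iA (1 : K) a *: loc m.
Proof. by rewrite /loc -hM.2 mulr1. Qed.

Lemma loc_lin (a : A) (x y : M) : loc (a *: x + y) = iA (1 : K) a *: loc x + loc y.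
Proof. by rewrite raddfD /= loc_act. Qed.

Lemma loc_sum (I : finType) (F : I -> M) : loc (\sum_i F i) = \sum_i loc (F i).
Proof. exact: raddf_sum. Qed.

Definition cleared (s : R) (y : MK) : Prop := exists m, fscale s y = loc m.

Lemma cleared_mul s t y : cleared s y -> cleared (t * s) y.
Proof.
by move=> [m e]; exists ((alg_map t : A) *: m); rewrite fscaleM e loc_scale.
Qed.

(** The elements with a denominator form a [K]-subspace containing all pure tensors, so the
    projection to its quotient is zero by uniqueness in the universal property. *)
Lemma clear_denominator (y : MK) : exists2 s, s != 0 & cleared s y.
Proof.
pose S (z : res MK) := exists2 s, s != 0 & cleared s (z : MK).
have S0 : S 0.
  exists 1; first exact: oner_neq0.
  by exists 0; rewrite raddf0; exact: (linear0 (fscl MK 1)).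
have SP (k : K) (x z : res MK) : S x -> S z -> S (k *: x + z).
  move=> [s s0 [m me]] [t t0 [n ne]]; have [a [u [u0 uk]]] := fraction_repr k.
  exists (u * (s * t)); first by rewrite !mulf_neq0.
  exists ((alg_map (t * a) : A) *: m + (alg_map (u * s) : A) *: n).
  rewrite raddfD /= !loc_scale -me -ne.
  rewrite -[LHS]/(fscl MK (u * (s * t)) ((alg_map k : AK) *: (x : MK) + z)) linearD.
  congr (_ + _); last by rewrite /= -[in RHS]fscaleM mulrA.
  rewrite /= -fscaleM /fscale scalerA -rmorphM /=; congr (alg_map _ *: _).
  by rewrite !rmorphM /= -uk; ring.
apply/(quot_exact S0 SP (y : res MK)).
move: y; apply: (tensor_ext (g := fun _ : MK => 0 : quot_mod S0 SP) bt) => [x y|x y|k m].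
- exact: (linearB (quot_proj S0 SP)).
- by rewrite subr0.
apply/quot_exact; have [a [s [s0 sk]]] := fraction_repr k.
exists s => //; exists ((alg_map a : A) *: m).
by rewrite /fscale -frac_modE sk -[tofrac a]mulr1 frac_modZ.
Qed.

(** Each coordinate functional [f i] extends to an additive map from [MK] to [K], and [tofrac] is
    injective. *)
Lemma loc_inj : fgp (res M) -> injective loc.
Proof.
move=> /fgpP [I [g [f gf]]] x y /eqP; rewrite -subr_eq0 -raddfB => /eqP e.
apply/eqP; rewrite -subr_eq0; apply/eqP; move: {x y}(x - y) e => m e.
rewrite (gf m) big1 // => i _; suff -> : f i m = 0 by rewrite scale0r.
pose c (k : res K^o) (n : res M) : K := k * tofrac (f i n : R).
have cb : balanced c.
  split=> [n x y|k x y|r k n]; rewrite /c.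
  - exact: mulrBl.
  - by rewrite linearB rmorphB mulrBr.
  - by rewrite linearZ /= rmorphM mulrA [k * _]mulrC.
have [[h hK] _] := bt.2 _ _ cb.
have := hK (1 : K) m; rewrite -/(loc m) e raddf0 /c mul1r => /esym/eqP.
by rewrite tofrac_eq0 => /eqP.
Qed.

Lemma loc_ext Z (f g : {linear MK -> Z}) : (forall m, f (loc m) = g (loc m)) -> f =1 g.
Proof.
move=> fg y; have [s s0 [m e]] := clear_denominator y.
by apply: (fscale_inj s0); rewrite -!fscale_map e.
Qed.

End Module.

Lemma clear_alg (al : AK) : exists2 s, s != 0 &
  exists a : A, (alg_map (tofrac s) : AK) * al = iA (1 : K) a.
Proof.
have [s s0 [a e]] := clear_denominator frac_regular (al : AK^o).
by exists s => //; exists a.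
Qed.

Section Maps.
Variables (M N : lmodType A) (MK NK : lmodType AK).
Variables (iM : res K^o -> res M -> MK) (iN : res K^o -> res N -> NK).
Hypotheses (hM : is_frac_mod iA iM) (hN : is_frac_mod iA iN).

(** The universal property gives an additive map commuting with scalars from [R]. For linearity over
    [AK], scalar and element are multiplied into the images of [A] and [M], and the nonzero factor
    is cancelled. *)
Lemma loc_map (f : {linear M -> N}) :
  exists g : {linear MK -> NK}, forall m, g (loc iM m) = loc iN (f m).
Proof.
pose c (k : res K^o) (m : res M) : NK := iN k (f m).
have [[bl br bs] _] := hN.1.
have cb : balanced c.
  split=> [m x y|k x y|r k m]; rewrite /c ?bl ?linearB ?br //.
  by rewrite bs; congr (iN _ _); rewrite !res_scaleE [in RHS]linearZ.
have [[h hK] _] := hM.1.2 _ _ cb.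
have hfs s y : h (fscale s y) = fscale s (h y).
  move: y; apply: (tensor_ext hM.1) => [x y|x y|k m].
  - by rewrite -raddfB; congr (h _); apply: (linearB (fscl MK s)).
  - by rewrite raddfB; apply: (linearB (fscl NK s)).
  - by rewrite /fscale -(frac_modE hM) !hK /c -(frac_modE hN).
have hl : linear h.
  move=> a x y; rewrite raddfD; congr (_ + _).
  have [s s0 [a' sa]] := clear_alg a.
  have [t t0 [m tx]] := clear_denominator hM x.
  have act Z (z : Z) : fscale (s * t) (a *: z) = iA (1 : K) a' *: fscale t z.
    rewrite fscaleM -sa -scalerA [fscale t _](linearZ_LR (fscl Z t)) /=.
    by rewrite /fscale.
  apply: (fscale_inj (mulf_neq0 s0 t0)); rewrite -hfs !act -hfs tx.
  rewrite -(loc_act hM) /loc !hK /c -[LHS]/(loc iN (f (a' *: m))) linearZ.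
  exact: (loc_act hN).
by exists (mklin hl) => m; rewrite mklinE hK.
Qed.

(** A common denominator for the images of finitely many generators works on all of [M]; injectivity
    of [loc] on [N] makes the resulting map linear. *)
Lemma clear_map (g : {linear MK -> NK}) : fin_gen (res M) -> fgp (res N) ->
  exists2 s, s != 0 & exists f : {linear M -> N},
    forall m, fscale s (g (loc iM m)) = loc iN (f m).
Proof.
move=> [n [u uP]] fN.
have [s s0 sP] : exists2 s, s != 0 & forall i, cleared iN s (g (loc iM (u i))).
  apply: common_multiple => [i|i s t]; first exact: clear_denominator hN _.
  exact: (cleared_mul hN).
exists s => //.
have [v vE] := choice sP.
have im m : exists x, fscale s (g (loc iM m)) = loc iN x.
  have [c cE] := uP m; exists (\sum_i (alg_map (c i) : A) *: v i).
  have -> : loc iM m = \sum_i fscale (c i) (loc iM (u i)).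
    rewrite {1}cE (loc_sum hM).
    by apply: eq_bigr => i _; apply: loc_scale hM _ _.
  rewrite (loc_sum hN) (linear_sum g).
  rewrite -[LHS]/(fscl NK s _) linear_sum; apply: eq_bigr => i _ /=.
  by rewrite (loc_scale hN) -vE fscaleC fscale_map.
have [f fE] := choice im.
have fl : linear f.
  move=> a x y; apply: (loc_inj hN fN); rewrite -fE.
  rewrite (loc_lin hN) -!fE (loc_lin hM) linearP -[LHS]/(fscl NK s _).
  exact: linearP.
by exists (mklin fl).
Qed.

End Maps.
End Denominators.

Section Codominant.
Variables (R : comPzRingType) (A : ralgType R).

(** If no sequence of length at least [n] existed, [n.-1] would bound the supremum. The length [m]
    may exceed [n], since sequences are not truncated here. *)
Lemma codomdim_seq (Q X : lmodType A) n : (0 < n)%N -> enat_le n (codomdim Q X) ->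
  codom_cover Q X /\ exists2 m, (n <= m)%N & codom_seq Q X m.
Proof.
move=> n0; rewrite /codomdim; case: pselect => [cov|_] /=; last by rewrite leqNgt n0.
move=> le; split=> //; apply: contrapT => no.
have bound m : codom_seq Q X m -> (m <= n.-1)%N.
  move=> sm; rewrite leqNgt; apply/negP => nm; apply: no; exists m => //.
  by rewrite -(prednK n0).
move: le; rewrite /enat_sup; case: pselect => [h|[]] /=; last first.
  by exists n.-1; apply/asboolP.
case: ex_minnP => m0 _ /(_ n.-1) mmin; rewrite leqNgt => /negP; apply.
by rewrite -(prednK n0) ltnS; apply: mmin; apply/asboolP.
Qed.

Lemma codom_coverP (Q X : lmodType A) : codom_cover Q X ->
  exists (J : finType) (a : J -> {linear Q -> X}),
    (forall x, exists t : J -> Q, x = \sum_j a j (t j)) /\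
    (forall al : {linear Q -> X}, exists b : J -> {linear Q -> Q},
       forall s, al s = \sum_j a j (b j s)).
Proof.
move=> [Y [p [/add_catP [J [a [b ab]]] ps hs]]].
exists J, (fun j => compl p (a j)); split=> [x|al].
  by have [y <-] := ps x; exists (fun j => b j y); rewrite {1}(ab y) linear_sum.
have [u ue] := hs al; exists (fun j => compl (b j) u) => s.
have -> : al s = p ((u : homm Q Y) s) by rewrite -ue.
by rewrite {1}(ab ((u : homm Q Y) s)) linear_sum.
Qed.

End Codominant.

Section FractionRelations.
Variable R : idomainType.
Local Notation K := {fraction R}.
Variables (A : ralgType R) (AK : ralgType K) (iA : res K^o -> res A^o -> AK).
Hypothesis hA : is_frac_alg iA.
Variables (Q T : lmodType A) (QK TK : lmodType AK).
Variables (iQ : res K^o -> res Q -> QK) (iT : res K^o -> res T -> TK).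
Hypotheses (hQ : is_frac_mod iA iQ) (hT : is_frac_mod iA iT).
Hypotheses (fQ : fgp (res Q)) (fT : fgp (res T)).
Variables (J : finType) (a : J -> {linear Q -> T}).
Hypothesis lift : forall al : {linear Q -> T}, exists b : J -> {linear Q -> Q},
  forall s, al s = \sum_j a j (b j s).
Variables (Q1 Q2 : lmodType AK) (eps : {linear Q1 -> TK}) (del : {linear Q2 -> Q1}).
Hypotheses (rQ1 : radd QK Q1) (rQ2 : radd QK Q2).
Hypotheses (exact1 : exact_at del eps) (surj1 : surj (hom_map QK eps)).

(* Comparing [Q_K^J -> T_K] with the approximation [eps] over [K] shows that its
   kernel is generated by [Q_K]; then denominators are cleared. *)
Lemma frac_relations (t : J -> Q) : \sum_j a j (t j) = 0 ->
  exists2 r : R, r != 0 &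
  exists (I : finType) (c : I -> J -> {linear Q -> Q}) (z : I -> Q),
    (forall k s, \sum_j a j (c k j s) = 0) /\
    (forall j, (alg_map r : A) *: t j = \sum_k c k j (z k)).
Proof.
move=> t0.
have [aK aKE] := choice (fun j => loc_map hA hQ hT (a j)).
have H j : exists u : {linear QK -> Q1}, forall y, eps (u y) = aK j y.
  have [u ue] := surj1 (aK j); exists u => y.
  exact: (congr1 (fun w : homm QK TK => w y) ue).
have {H} [u uE] := choice H.
have [M [P1 [B1 PB1]]] := rQ1; have [I2 [P2 [B2 PB2]]] := rQ2.
(* In the direction opposite to [u]: after multiplication by [s] the components of [eps] are defined
   over [R], and [lift] factors them through the [a j]. This gives [v] from [Q1] to the power of
   [QK]. *)
have [s s0 sP] : exists2 s, s != 0 & forall m, exists f : {linear Q -> T},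
    forall q, fscale s (eps (P1 m (loc iQ q))) = loc iT (f q).
  apply: common_multiple => [m|m s s' [f fE]].
    exact: (clear_map hA hQ hT (compl eps (P1 m)) fQ.1 fT).
  exists (compl (scl T s') f) => q.
  by rewrite fscaleM fE -(loc_scale hA hT).
have [f fE] := choice sP.
have [be beE] := choice (fun m => lift (f m)).
have H m : exists b : J -> {linear QK -> QK}, forall j q, b j (loc iQ q) = loc iQ (be m j q).
  by have [b bE] := choice (fun j => loc_map hA hQ hQ (be m j)); exists b.
have {H} [bK bKE] := choice H.
pose v j : {linear Q1 -> QK} := lsum (fun m => compl (bK m j) (B1 m)).
have vE w : \sum_j aK j (v j w) = fscale s (eps w).
  transitivity (\sum_m \sum_j aK j (bK m j (B1 m w))).
    by rewrite exchange_big; apply: eq_bigr => j _; rewrite linear_sum.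
  rewrite [in RHS](PB1 w) linear_sum -[RHS]/(fscl TK s _) linear_sum.
  apply: eq_bigr => m _; move: (B1 m w).
  apply: (loc_ext hA hQ (f := lsum (fun j => compl (aK j) (bK m j)))
    (g := compl (fscl TK s) (compl eps (P1 m)))) => q.
  rewrite [RHS]fE beE (loc_sum hT); apply: eq_bigr => j _.
  by rewrite -[LHS]/(aK j (bK m j (loc iQ q))) bKE aKE.
pose y j := loc iQ (t j).
have y0 : \sum_j aK j (y j) = 0.
  under eq_bigr do rewrite aKE.
  by rewrite -(loc_sum hT) t0 -[LHS]/(mkadd (loc_zmod hT) 0) raddf0.
pose x := \sum_j u j (y j).
have [w wx] : exists w, del w = x.
  apply/exact1; rewrite linear_sum -[RHS]y0.
  by apply: eq_bigr => j _; rewrite uE.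
(* Two kinds of relations: [s] times the identity minus the composite of [u] and [v], and [v] after
   [del]. The first contribute [s y - v x], the second give back [v x] because [x = del w]. *)
pose C (k : J + I2) j : {linear QK -> QK} := match k with
  | inl i => subl (if i == j then fscl QK s else zerol QK QK) (compl (v j) (u i))
  | inr i => compl (v j) (compl del (P2 i)) end.
pose Z (k : J + I2) : QK := match k with inl i => y i | inr i => B2 i w end.
have C0 k z : \sum_j aK j (C k j z) = 0.
  case: k => i /=; last by rewrite vE (exact_comp0 exact1); exact: (linear0 (fscl TK s)).
  under eq_bigr do rewrite linearB.
  rewrite sumrB vE uE (bigD1 i) //= eqxx big1 ?addr0 => [|j /negbTE ji].
    by rewrite -[X in _ - X]fscale_map; apply: subrr.
  by rewrite eq_sym ji linear0.
have CZ j : fscale s (y j) = \sum_k C k j (Z k).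
  rewrite big_sumType /= sumrB (bigD1 j) //= eqxx big1 => [|i /negbTE ->] //.
  have -> : \sum_i v j (u i (y i)) = v j x by rewrite linear_sum.
  have -> : \sum_i v j (del (P2 i (B2 i w))) = v j x.
    by rewrite -wx [in RHS](PB2 w) !linear_sum.
  by rewrite addr0 subrK.
(* [r1] clears the maps [C] and [r2] the elements [Z]; with the factor [s] above, the multiple is
   [r1 * (r2 * s)]. *)
have [r1 r10 r1P] : exists2 r, r != 0 & forall p : (J + I2) * J, exists f : {linear Q -> Q},
    forall q, fscale r (C p.1 p.2 (loc iQ q)) = loc iQ (f q).
  apply: common_multiple => [p|p r r' [g gE]].
    exact: (clear_map hA hQ hQ (C p.1 p.2) fQ.1 fQ).
  exists (compl (scl Q r') g) => q.
  by rewrite fscaleM gE -(loc_scale hA hQ).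
have [r2 r20 r2P] : exists2 r, r != 0 & forall k, cleared iQ r (Z k).
  apply: common_multiple => [k|k r r']; first exact: (clear_denominator hA hQ (Z k)).
  exact: (cleared_mul hA hQ).
have [c cE] := choice r1P; have [z zE] := choice r2P.
exists (r1 * (r2 * s)); first by rewrite !mulf_neq0.
exists (J + I2)%type, (fun k j => c (k, j)), z; split=> [k q|j].
  apply: (loc_inj hT fT); rewrite (loc_sum hT).
  rewrite -[RHS]/(mkadd (loc_zmod hT) 0) raddf0.
  under eq_bigr do rewrite -aKE -cE fscale_map.
  rewrite -(linear_sum (fscl TK r1)) /= C0; exact: (linear0 (fscl TK r1)).
apply: (loc_inj hQ fQ); rewrite (loc_scale hA hQ) (loc_sum hQ) !fscaleM -/(y j) CZ.
rewrite -[fscale r2 _]/(fscl QK r2 _) linear_sum -[LHS]/(fscl QK r1 _) linear_sum.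
by apply: eq_bigr => k _; rewrite /= -fscale_map zE -(cE (k, j)).
Qed.

End FractionRelations.

(** * Covers *)

Section ClosedModules.
Variables (B : pzRingType) (P : lmodType B).
Implicit Types M N X : lmodType B.

(* The unit of the adjunction between [Hom(P, -)] and its right adjoint is an
   isomorphism at [N]. *)
Definition hom_closed N : Prop :=
  (forall psi : {linear B^o -> N},
     (forall (c : {linear P -> B^o}) x, psi (c x) = 0) -> forall b, psi b = 0) /\
  (forall th : {linear homm P B^o -> homm P N},
     exists psi : {linear B^o -> N}, forall (c : {linear P -> B^o}) x,
       (th c : homm P N) x = psi (c x)).

Lemma hom_closed_zero N : zero_mod N -> hom_closed N.
Proof.
move=> N0; split=> [psi _ b|th]; first exact: N0.
by exists (zerol B^o N) => c x; rewrite [LHS]N0 [RHS]N0.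
Qed.

(** A diagram chase: [B^o] is free on [1], so the map found for [N''] lifts to [N] through a
    preimage [n] of its value at [1]; what remains of [th] takes values in Hom(P, N'). *)
Lemma hom_closed_ext N' N N'' (f : {linear N' -> N}) (g : {linear N -> N''}) :
  short_exact f g -> hom_closed N' -> hom_closed N'' -> hom_closed N.
Proof.
move=> [fi fg gs] [inj' full'] [inj'' full'']; split=> [psi psi0 b|th].
  have [|psi' psi'E] := factor_inj (h := psi) fi.
    move=> y; apply/fg; apply: (inj'' (compl g psi)) => c x.
    by rewrite /= psi0 linear0.
  rewrite -psi'E inj' ?linear0 // => c x.
  by apply: fi; rewrite psi'E psi0 linear0.
have [psi'' psi''E] := full'' (compl (hom_map P g) th).
have [n nE] := gs (psi'' 1).
have gn b : g (scall n b) = psi'' b.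
  by rewrite /= linearZ nE -linearZ /= [_ *: _]mulr1.
have hfi : injective (hom_map P f).
  move=> u v e; apply: linear_ext => x; apply: fi.
  exact: (congr1 (fun w : homm P N => w x) e).
have [|th' th'E] := factor_inj (h := subl th (hom_map P (scall n))) hfi.
  move=> c.
  have [|w wE] := factor_inj (h := subl (th c : homm P N) (compl (scall n) c)) fi.
    move=> x; apply/fg; rewrite linearB /= [X in _ - X]gn.
    by rewrite -[psi'' _]psi''E subrr.
  by exists w; apply: linear_ext.
have [psi' psi'E] := full' th'.
exists (addl (scall n) (compl f psi')) => c x.
rewrite /= -psi'E.
have := congr1 (fun w : homm P N => w x) (th'E c).
move=> /= ->; rewrite addrC; symmetry; exact: subrK.
Qed.

Lemma hom_closed_radd N X : radd N X -> hom_closed N -> hom_closed X.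
Proof.
move=> [I [a [b ab]]] [inj full]; split=> [psi psi0 y|th].
  rewrite [LHS]ab big1 // => i _.
  have -> : b i (psi y) = 0; last exact: linear0.
  by apply: (inj (compl (b i) psi)) => c x; rewrite /= psi0 linear0.
have [psi psiE] := choice (fun i => full (compl (hom_map P (b i)) th)).
exists (lsum (fun i => compl (a i) (psi i))) => c x.
by rewrite [LHS]ab; apply: eq_bigr => i _; rewrite /= -psiE.
Qed.

Lemma bijectiveI (X Y : Type) (f : X -> Y) : injective f -> surj f -> bijective f.
Proof.
move=> fi fs; have [g gK] := choice fs.
by exists g => x //; apply: fi; rewrite gK.
Qed.

(** An element [m] is a map from the regular module to [M], so [th] after it comes from some [psi m]
    on [B^o], and [psi m 1] is the image of [m]. Linearity and agreement with [th] are checked on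
    composites with maps from [P], by the injectivity part of [hom_closed]. *)
Lemma hom_closed_fully_faithful M N : hom_closed N ->
  bijective (hom_map P : {linear M -> N} -> {linear homm P M -> homm P N}).
Proof.
move=> [inj full]; apply: bijectiveI => [u v e|th].
  apply: linear_ext => m; apply/eqP; rewrite -subr_eq0; apply/eqP.
  have -> : u m - v m = compl (subl u v) (scall m) 1 by rewrite /= scale1r.
  apply: (inj (compl (subl u v) (scall m))) => c x.
  have := congr1 (fun w : {linear homm P M -> homm P N} =>
    (w (compl (scall m) c : homm P M) : homm P N) x) e.
  by move=> /= ->; rewrite subrr.
have [psi psiE] := choice (fun m => full (compl th (hom_map P (scall m)))).
have {}psiE m (c : {linear P -> B^o}) x :
  psi m (c x) = (th (compl (scall m) c : homm P M) : homm P N) x.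
  by rewrite -psiE; congr ((th _ : homm P N) x); apply: linear_ext.
have fl : linear (fun m => psi m 1).
  move=> r m m'.
  pose chi := subl (psi (r *: m + m')) (addl (compl (psi m) (scall (r : B^o))) (psi m')).
  have chi0 : chi 1 = 0.
    apply: inj => c x.
    rewrite -[LHS]/(psi (r *: m + m') (c x) -
      (psi m (compl (scall (r : B^o)) c x) + psi m' (c x))) !psiE.
    apply/eqP; rewrite subr_eq0; apply/eqP.
    rewrite -[RHS]/((th (compl (scall m) (compl (scall (r : B^o)) c) : homm P M) +
      th (compl (scall m') c : homm P M) : homm P N) x) -linearD.
    congr ((th _ : homm P N) x); apply: linear_ext => p.
    rewrite -[RHS]/(((c p : B) * r) *: m + (c p : B) *: m') /=.
    by rewrite scalerDr scalerA.
  have := chi0; rewrite -[LHS]/(psi (r *: m + m') 1 - (psi m (1 * r : B) + psi m' 1)).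
  move/eqP; rewrite subr_eq0 => /eqP ->; congr (_ + _).
  rewrite mul1r -linearZ; congr (psi m _); symmetry; exact: mulr1.
exists (mklin fl); apply: linear_ext => u; apply: linear_ext => x.
pose chi := subl (psi ((u : homm P M) x)) (compl (th u : homm P N) (scall x)).
have chi0 : chi 1 = 0.
  apply: inj => c p.
  rewrite -[LHS]/(psi ((u : homm P M) x) (c p) - (th u : homm P N) ((c p : B) *: x)) psiE.
  apply/eqP; rewrite subr_eq0; apply/eqP.
  have -> : (compl (scall ((u : homm P M) x)) c : homm P M) =
      (compl (scall x) c : (Endo P)^c) *: (u : homm P M).
    by apply: linear_ext => q; rewrite /= linearZ.
  by rewrite linearZ.
have := chi0; rewrite -[LHS]/(psi ((u : homm P M) x) 1 - (th u : homm P N) (1 *: x)).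
by rewrite scale1r => /eqP; rewrite subr_eq0 => /eqP.
Qed.

End ClosedModules.

(** * The endomorphism algebra of Q and the unit at Hom(T, X) *)

Section EndomorphismCover.
Variables (R : idomainType) (A : ralgType R) (T Q : lmodType A).
Hypothesis rQ : radd T Q.
Implicit Types X : lmodType A.

Let B : ralgType R := (Endo T)^c.
Let P : lmodType B := homm T Q.
Let E : ralgType R := (Endo Q)^c.

Lemma hom_radd_ext X (u v : {linear Q -> X}) :
  (forall (x : {linear T -> Q}) s, u (x s) = v (x s)) -> u =1 v.
Proof.
move=> uv q; have [J [a [b ab]]] := rQ.
by rewrite [in LHS](ab q) [in RHS](ab q) !linear_sum; apply: eq_bigr.
Qed.

Definition hom_end_fun (g : E) : (Endo P)^c := (hom_map T (g : homm Q Q) : homm P P).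
Fact hom_end_zmod : zmod_morphism hom_end_fun.
Proof. by move=> f g; apply: linear_ext => u; apply: linear_ext. Qed.
Fact hom_end_monoid : monoid_morphism hom_end_fun.
Proof. by split=> [|f g]; apply: linear_ext => u; apply: linear_ext. Qed.
HB.instance Definition _ := GRing.isZmodMorphism.Build E (Endo P)^c hom_end_fun hom_end_zmod.
HB.instance Definition _ := GRing.isMonoidMorphism.Build E (Endo P)^c hom_end_fun hom_end_monoid.

Lemma hom_end_iso : alg_iso E (Endo P)^c.
Proof.
exists hom_end_fun; split.
  apply: bijectiveI => [g h e|th].
    apply: linear_ext; apply: hom_radd_ext => x s.
    exact: (congr1 (fun w : homm P P => (w (x : homm T Q) : homm T Q) s) e).
  have [g gE] := hom_reconstruct_radd (th : homm P P) rQ.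
  exists (g : homm Q Q); apply: linear_ext => x; apply: linear_ext => s.
  by symmetry; exact: (gE x s).
move=> r; apply: linear_ext => x; apply: linear_ext => s.
by symmetry; exact: (linearZ_LR (x : homm T Q)).
Qed.

Variables (J : finType) (a : J -> {linear Q -> T}).
Hypothesis gen : forall x, exists t : J -> Q, x = \sum_j a j (t j).
Hypothesis lift : forall al : {linear Q -> T}, exists b : J -> {linear Q -> Q},
  forall s, al s = \sum_j a j (b j s).
Hypothesis rel : forall t : J -> Q, \sum_j a j (t j) = 0 ->
  exists2 r : R, r != 0 &
  exists (I : finType) (c : I -> J -> {linear Q -> Q}) (z : I -> Q),
    (forall k s, \sum_j a j (c k j s) = 0) /\
    (forall j, (alg_map r : A) *: t j = \sum_k c k j (z k)).

(** Through [post], maps from [P] to the regular module are maps from [Q] to [T]; [hom_to_regular]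
    shows that all of them arise so. *)
Let post (al : {linear Q -> T}) : {linear P -> B^o} := compl (hom_to_End T) (hom_map T al).

Lemma hom_to_regular (c : {linear P -> B^o}) :
  exists al : {linear Q -> T}, (c : homm P B^o) = post al.
Proof.
have [al alE] := hom_reconstruct_radd (compl (End_to_hom T) c) rQ.
exists al; apply: linear_ext => x; apply: linear_ext => s.
exact: (alE x s).
Qed.

(** As [Q] is in add T, maps from [P] to Hom(T, X) are maps from [Q] to [X]. So [th] becomes a map
    [phi] from Hom(Q, T) to Hom(Q, X), which [hom_reconstruct] with [S = Q] shows to be induced by a
    map from [T] to [X]. *)
Lemma hom_closed_hom X : fgp (res X) -> hom_closed P (homm T X : lmodType B).
Proof.
move=> fX; split=> [psi psi0 b|th].
  (* [psi] is determined by [psi 1], a map from [T] to [X] that vanishes on the images of the [a j],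
     and these generate [T]. *)
  have psiE (b' : B) : psi b' = b' *: psi 1.
    by rewrite -linearZ; congr (psi _); symmetry; exact: mulr1.
  rewrite psiE; suff -> : psi 1 = 0 by rewrite scaler0.
  apply: linear_ext => y; have [t ->] := gen y; rewrite linear_sum big1 // => j _.
  apply: (@hom_radd_ext X (compl (psi 1 : homm T X) (a j)) (zerol Q X)) => x s.
  have := psi0 (post (a j)) x; rewrite psiE => e.
  exact: (congr1 (fun w : homm T X => w s) e).
have ex (al : {linear Q -> T}) : exists u : {linear Q -> X}, forall (x : {linear T -> Q}) s,
    ((th (post al : homm P B^o) : homm P (homm T X)) (x : P) : homm T X) s = u (x s).
  exact: hom_reconstruct_radd (th (post al : homm P B^o) : homm P (homm T X)) rQ.
have [phi phiE] := choice ex.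
(* Linearity of [th] over End(P)^op is applied to the endomorphisms of [P] induced by those of
   [Q]. *)
have phil : linear (phi : homm Q T -> homm Q X).
  move=> e al al'; apply: linear_ext; apply: hom_radd_ext => x s.
  rewrite -phiE.
  have -> : (post ((e *: al + al' : homm Q T) : {linear Q -> T}) : homm P B^o) =
      (hom_end_fun e : (Endo P)^c) *: (post al : homm P B^o) + (post al' : homm P B^o).
    by apply: linear_ext => y; apply: linear_ext.
  rewrite linearP.
  rewrite -[RHS]/(phi al ((compl (e : homm Q Q) x) s) + phi al' (x s)) -!phiE.
  congr (_ + _).
  rewrite -[LHS]/(((th (post al : homm P B^o) : homm P (homm T X))
     ((hom_map T (e : homm Q Q) (x : homm T Q)) : P) : homm T X) s).
  congr (((th (post al : homm P B^o) : homm P (homm T X)) _ : homm T X) s).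
  exact: linear_ext.
have [t0|g gE] := hom_reconstruct (Y := X) gen lift _ (mklin phil).
  move=> /rel [r r0 H]; exists r; split=> // y.
  exact: torsion_free fX r0.
exists (compl (hom_map T g) (End_to_hom T)) => c x.
have [al ->] := hom_to_regular c; apply: linear_ext => s.
by rewrite phiE; exact: (gE al (x s)).
Qed.

End EndomorphismCover.

Theorem corollary5p3p6
    (R : idomainType) (hR : regular_ring R)
    (A : ralgType R) (d : Order.disp_t) (L : finPOrderType d)
    (Delta nabla : L -> lmodType A)
    (hDelta : split_qh Delta) (hnabla : costandard Delta nabla)
    (T : lmodType A) (hT : char_tilting Delta nabla T)
    (Q : lmodType A) (hQ : add_cat T Q)
    (hcodomR : enat_le 1 (codomdim Q T))
    (AK : ralgType {fraction R}) (iA : res {fraction R}^o -> res A^o -> AK)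
    (hAK : is_frac_alg iA)
    (QK : lmodType AK) (iQ : res {fraction R}^o -> res Q -> QK)
    (hQK : is_frac_mod iA iQ)
    (TK : lmodType AK) (iT : res {fraction R}^o -> res T -> TK)
    (hTK : is_frac_mod iA iT)
    (hcodomK : enat_le 2 (codomdim QK TK)) :
  let RA : ralgType R := (Endo T)^c in
  let DeltaRA : L^d -> lmodType RA := fun l => homm T (nabla l) in
  let P : lmodType RA := homm T Q in
  let E : ralgType R := (Endo Q)^c in
  (split_qh DeltaRA /\ is_cover P E) /\
  (split_qh DeltaRA /\ is_cover0 (Filt (tilde DeltaRA)) P E).
Proof.
move=> RA DeltaRA P E.
have qhRA : split_qh DeltaRA := ringel_dual_split_qh hR.1 hDelta hnabla hT.
have rQ : radd T Q by apply/add_catP.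
have fT : fgp (res T) by have [_ [/latticeP]] := tilting_Filt hT.
have fQ : fgp (res Q) := fgp_radd fT (radd_res rQ).
have [cov _] := codomdim_seq (isT : (0 < 1)%N) hcodomR.
have [J [a [gen lift]]] := codom_coverP cov.
(* Terms are numbered from [0], so Q_1 and Q_2 are [term C 0] and [term C 1], in a sequence of some
   length [n >= 2]. *)
have [_ [n n2 [C [Cadd Cex _ hCex]]]] := codomdim_seq (isT : (0 < 2)%N) hcodomK.
have [_ /(_ n2) ex1 _] := Cex.
have [/(_ (ltnW n2)) surj1 _ _] := hCex.
have rel := frac_relations hAK hQK hTK fQ fT lift
  ((add_catP _ _).1 (Cadd 0 (ltnW n2))) ((add_catP _ _).1 (Cadd 1 n2)) ex1 surj1.
have closedP X : fgp (res X) -> hom_closed P (homm T X : lmodType RA).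
  exact: (hom_closed_hom rQ gen lift rel).
have fP : fgp P := fgp_hom_radd rQ.
have iso := hom_end_iso rQ.
(* A finitely generated projective is a summand of a power of the regular module, which is Hom(T,
   T). *)
have closed_fgp N : fgp N -> hom_closed P N.
  move=> /fgp_radd_free rN.
  exact: (hom_closed_radd (radd_trans (radd_hom_End T) rN) (closedP T fT)).
(* Each filtration factor is a summand of a power of some Hom(T, nabla l), and [nabla l] is
   projective over [R]. *)
have closed_Filt N : Filt (tilde DeltaRA) N -> hom_closed P N.
  move=> [_]; elim=> [X|X' X X'' f g _ IH [l [U [_ fU t]]] se].
    exact: hom_closed_zero.
  apply: (hom_closed_ext se IH); apply: (hom_closed_radd (tensor_radd fU t)).
  exact/closedP/(nabla_fgp hnabla).
split; split=> //; split=> // M N _ hN; apply: hom_closed_fully_faithful.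
  exact: closed_fgp.
exact: closed_Filt.
Qed.
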